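(* Let $|A|=n\ge 2$, $k\ge 1$, and consider the subword order poset $A^*_{n,k}$. As $S_n$-modules, the Whitney homology $WH(A^*_{n,k})$ and the dual Whitney homology $WH^*(A^*_{n,k})$ are, for $1\le i\le k$, as follows: $$WH_i(A^*_{n,k})=S_{(n-1,1)}^{\otimes i}\oplus S_{(n-1,1)}^{\otimes(i-1)};$$ $$WH^*_{k+1-i}(A^*_{n,k})=\binom{k}{i}S_{(n-1,1)}^{\otimes(k-i)}\otimes\left(S_{(n-1,1)}\oplus S_{(n)}\right)^{\otimes i}=\bigoplus_{j=0}^{i}\binom{k}{i}\binom{i}{j}S_{(n-1,1)}^{\otimes (j+k-i)}.$$ Moreover $WH_0(A^*_{n,k})=S_{(n)}=WH^*_0(A^*_{n,k})$ (the trivial $S_n$-module).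
   Context: $A^*_{n,k}$ is the poset of all words of length at most $k$ (including the empty word $\hat 0$) over the alphabet $A$, $|A|=n$, under subword order ($u\le v$ if $u$ is obtained from $v$ by deleting letters), with an artificial top element $\hat 1$ attached. It is graded of rank $k+1$, the rank of a word being its length. $S_n$ acts by permuting letters. The Whitney homology is $WH_i(P)=\bigoplus_{x:\,\mathrm{rank}(x)=i}\tilde H_{i-2}(\hat 0,x)$ and the dual Whitney homology of a graded poset $P$ of rank $\rho$ is $WH^*_i(P)=\bigoplus_{x:\,\mathrm{rank}(x)=\rho-i}\tilde H_{i-2}(x,\hat 1)$, $0\le i\le \rho$, both with their natural $S_n$-action; here $\tilde H$ of an open interval is reduced homology over $\mathbb{C}$ of its order complex, with the conventions that $\tilde H_{-1}$ of the empty complex is $\mathbb{C}$ and that the degree $-2$ homology for $x$ equal to $\hat 0$ (resp. $\hat 1$) is the trivial one-dimensional module. $S_\lambda$ is the irreducible $S_n$-module indexed by $\lambda$; the $0$th tensor power is the trivial module $S_{(n)}$; $b\,V$ denotes a direct sum of $b$ copies of $V$. *)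

(* Defs.v *)
From HB Require Import structures.
From mathcomp Require Import all_boot all_order all_algebra all_fingroup.
From mathcomp Require Import mxrepresentation character zify.

Set Implicit Arguments.
Unset Strict Implicit.
Unset Printing Implicit Defensive.

Import Order.TTheory GRing.Theory.
Local Open Scope ring_scope.

Section BasisVectors.
Variables (F : fieldType) (T : finType).

Definition basis_vec (t : T) : 'rV[F]_#|T| := delta_mx 0 (enum_rank t).

Lemma row_matrix_basis n (f : T -> 'rV[F]_n) (t : T) :
  basis_vec t *m (\matrix_(i < #|T|) f (enum_val i)) = f t.
Proof. by rewrite -rowE rowK enum_rankK. Qed.

Lemma eq_on_basis n (M N : 'M[F]_(#|T|, n)) :
  (forall t, basis_vec t *m M = basis_vec t *m N) -> M = N.
Proof.
by move=> eqMN; apply/row_matrixP => i; rewrite !rowE -(enum_valK i) eqMN.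
Qed.

End BasisVectors.

Section PermutationModule.
Variables (F : fieldType) (gT : finGroupType) (T : finType).
Variable to : {action gT &-> T}.

Definition perm_module_mx (g : gT) : 'M[F]_#|T| :=
  \matrix_(i < #|T|) basis_vec F (to (enum_val i) g).

Fact perm_module_mx_repr : mx_repr [set: gT] perm_module_mx.
Proof.
have mxE t g := row_matrix_basis (fun t => basis_vec F (to t g)) t.
split=> [|g h _ _]; apply: eq_on_basis => t.
  by rewrite mxE act1 mulmx1.
by rewrite mulmxA !mxE actM.
Qed.

Definition perm_module : mx_representation F [set: gT] #|T| :=
  MxRepresentation perm_module_mx_repr.

Lemma perm_moduleE t g :
  basis_vec F t *m perm_module g = basis_vec F (to t g).
Proof. exact: (row_matrix_basis (fun t => basis_vec F (to t g))). Qed.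

End PermutationModule.

Section Homology.
Variables (F : fieldType) (d : Order.disp_t) (P : finPOrderType d).
Implicit Type Q : {set P}.

Definition face m (t : m.+1.-tuple P) (j : 'I_m.+1) : m.-tuple P :=
  [tuple tnth t (lift j l) | l < m].

Definition boundary m : 'M[F]_(#|{: m.+1.-tuple P}|, #|{: m.-tuple P}|) :=
  \matrix_(i < #|{: m.+1.-tuple P}|)
    \sum_(j < m.+1) (-1) ^+ j *: basis_vec F (face (enum_val i) j).

(* The row space of [chains m Q] is the space of oriented simplicial chains of
   dimension [m - 1] of the order complex of [Q]: the span, inside the free
   vector space on all m-tuples, of the [x_1 < ... < x_m] with all [x_l] in
   [Q]. The empty tuple spans the augmentation degree -1. *)
Definition chains m (Q : {set P}) : 'M[F]_#|{: m.-tuple P}| :=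
  (\sum_(t : m.-tuple P | sorted <%O t && all (mem Q) t) <<basis_vec F t>>)%MS.

(* The index [i] stands for homological degree [i - 2]: degree [m - 1] cycles
   and boundaries live in the span of the m-tuples, with [m = i.-1]. For
   [i = 0] (degree -2) the conventional one-dimensional module is obtained as
   the span of the empty tuple, with no boundaries. *)
Definition cycles i (Q : {set P}) : 'M[F]_#|{: i.-1.-tuple P}| :=
  match i return 'M[F]_#|{: i.-1.-tuple P}| with
  | m.+2 => (chains m.+1 Q :&: kermx (boundary m))%MS
  | _ => chains 0 Q
  end.

Definition boundaries i (Q : {set P}) : 'M[F]_#|{: i.-1.-tuple P}| :=
  match i return 'M[F]_#|{: i.-1.-tuple P}| with
  | m.+1 => <<chains m.+1 Q *m boundary m>>%MS
  | 0 => 0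
  end.

(* Reduced homology of degree [i - 2] of the order complex of [Q], in
   coordinates: [hom_space i Q] is the image of the cycles in the quotient of
   the ambient space by the boundaries, and it is identified with the row
   vectors of size [hom_dim i Q]. [hom_class] sends a cycle to its class, and
   [hom_lift] sends a class to a representative. *)
Definition hom_space i (Q : {set P}) :=
  <<in_factmod (boundaries i Q) (cycles i Q)>>%MS.

Definition hom_dim i (Q : {set P}) : nat := \rank (hom_space i Q).

Definition hom_class i (Q : {set P}) n (v : 'M[F]_(n, #|{: i.-1.-tuple P}|)) :
    'M[F]_(n, hom_dim i Q) :=
  in_submod (hom_space i Q) (in_factmod (boundaries i Q) v).

Definition hom_lift i (Q : {set P}) n (w : 'M[F]_(n, hom_dim i Q)) :
    'M[F]_(n, #|{: i.-1.-tuple P}|) :=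
  val_factmod (val_submod w).

Lemma hom_liftE i Q n (w : 'M_(n, hom_dim i Q)) :
  hom_lift w = w *m hom_lift 1%:M.
Proof. by rewrite /hom_lift /val_factmod /val_submod /= !mulmxA mulmx1. Qed.

Lemma hom_classM i Q n p (w : 'M_(p, n)) (v : 'M_(n, #|{: i.-1.-tuple P}|)) :
  hom_class Q (w *m v) = w *m hom_class Q v.
Proof. by rewrite /hom_class /in_submod /in_factmod /= !mulmxA. Qed.

Lemma hom_liftK i Q n : cancel (@hom_lift i Q n) (@hom_class i Q n).
Proof. by move=> w; rewrite /hom_class /hom_lift val_factmodK val_submodK. Qed.

Lemma hom_lift_sub i Q n (w : 'M_(n, hom_dim i Q)) :
  (hom_lift w <= boundaries i Q + cycles i Q)%MS.
Proof.
apply: (submx_trans _ (proj_factmodS (boundaries i Q) (cycles i Q))).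
by rewrite /hom_lift val_factmodS (submx_trans (val_submodP w)) ?genmxE.
Qed.

Lemma hom_classK i Q n (v : 'M_(n, #|{: i.-1.-tuple P}|)) :
  (v <= boundaries i Q + cycles i Q)%MS ->
  (v - hom_lift (hom_class Q v) <= boundaries i Q)%MS.
Proof.
move=> sv; rewrite -in_factmod_eq0 linearB /= /hom_lift val_factmodK.
rewrite in_submodK ?subrr // genmxE.
by rewrite -(in_factmod_addsK _ (cycles i Q)) [X in (X <= _)%MS]in_factmodE
   [X in (_ <= X)%MS]in_factmodE submxMr.
Qed.

Lemma hom_class0 i Q n (v : 'M_(n, #|{: i.-1.-tuple P}|)) :
  (v <= boundaries i Q)%MS -> hom_class Q v = 0.
Proof. by rewrite -in_factmod_eq0 /hom_class => /eqP->; rewrite linear0. Qed.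

Lemma boundaryE m (t : m.+1.-tuple P) :
  basis_vec F t *m boundary m =
    \sum_(j < m.+1) (-1) ^+ j *: basis_vec F (face t j).
Proof.
exact: (row_matrix_basis
  (fun t => \sum_(j < m.+1) (-1) ^+ j *: basis_vec F (face t j))).
Qed.

Lemma boundary_boundary m : boundary m.+1 *m boundary m = 0.
Proof.
apply: eq_on_basis => t; rewrite mulmx0 mulmxA boundaryE mulmx_suml.
under eq_bigr do rewrite -scalemxAl boundaryE scaler_sumr.
rewrite pair_big /=.
under eq_bigr do rewrite scalerA -exprD.
rewrite (bigID (fun p : 'I_m.+2 * 'I_m.+1 => (p.2 < p.1)%N)) /=.
have [sw [sw1 sw2]] : exists sw : 'I_m.+2 * 'I_m.+1 -> 'I_m.+2 * 'I_m.+1,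
    (forall p, (sw p).1 = bump p.1 p.2 :> nat) /\
    (forall p, (sw p).2 = unbump p.2 p.1 :> nat).
  exists (fun p => (lift p.1 p.2, inord (unbump p.2 p.1))).
  split=> // p; rewrite /= inordK //; have := ltn_ord p.1.
  by have := ltn_ord p.2; rewrite /unbump; case: (ltnP p.2 p.1); lia.
have swK : involutive sw.
  move=> p; suff [e1 e2] : (sw (sw p)).1 = p.1 /\ (sw (sw p)).2 = p.2.
    by rewrite [LHS]surjective_pairing [RHS]surjective_pairing e1 e2.
  split; apply: val_inj; rewrite /= ?(sw1 (sw p)) ?(sw2 (sw p)) sw1 sw2 /bump;
  by rewrite /unbump; case: (leqP p.1 p.2); lia.
rewrite [X in _ + X](reindex_inj (inv_inj swK)) /=.
apply/eqP; rewrite addr_eq0 -sumrN; apply/eqP/eq_big => p.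
  by rewrite -leqNgt sw1 sw2 /bump /unbump; lia.
move=> ltp; rewrite -scaleNr; congr (_ *: basis_vec F _).
  rewrite -[RHS]mulN1r -[RHS]exprS -[LHS]signr_odd -[RHS]signr_odd.
  congr (_ ^+ nat_of_bool _); rewrite sw1 sw2 /bump /unbump ltp.
  by case: (leqP p.1 p.2) ltp; lia.
apply: eq_from_tnth => h; rewrite !tnth_mktuple; congr (tnth t _).
by apply: val_inj; rewrite /= sw1 sw2 /bump /unbump; lia.
Qed.

Lemma chains_subP m Q n (M : 'M_(#|{: m.-tuple P}|, n)) p (V : 'M_(p, n)) :
  (forall t : m.-tuple P, sorted <%O t -> all (mem Q) t ->
     (basis_vec F t *m M <= V)%MS) ->
  (chains m Q *m M <= V)%MS.
Proof.
move=> sub; rewrite sumsmxMr_gen; apply/sumsmx_subP => t /andP[lt_t Qt].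
rewrite genmxE; apply: submx_trans (sub t lt_t Qt).
by apply: submxMr; rewrite genmxE.
Qed.

Lemma basis_vec_chains m Q (t : m.-tuple P) :
  sorted <%O t -> all (mem Q) t -> (basis_vec F t <= chains m Q)%MS.
Proof.
by move=> lt_t Qt; rewrite (sumsmx_sup t) ?lt_t //= genmxE.
Qed.

Lemma face_sorted m (t : m.+1.-tuple P) j :
  sorted <%O t -> sorted <%O (face t j).
Proof.
move=> lt_t; have x0 := thead t.
have homo (l l' : 'I_m) :
    (l < l')%N -> (tnth t (lift j l) < tnth t (lift j l'))%O.
  move=> ltl; rewrite !(tnth_nth x0).
  apply: (sorted_ltn_nth (@lt_trans _ P) x0 lt_t);
    rewrite ?inE ?size_tuple ?ltn_ord //=.
  by rewrite /bump; lia.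
rewrite /=; apply: (homo_sorted homo).
by have := iota_ltn_sorted 0 m; rewrite -val_enum_ord sorted_map.
Qed.

Lemma face_all m (t : m.+1.-tuple P) j Q :
  all (mem Q) t -> all (mem Q) (face t j).
Proof.
move=> /all_tnthP Qt; apply/all_tnthP => l; rewrite tnth_mktuple; exact: Qt.
Qed.

Lemma chains_boundary m Q : (chains m.+1 Q *m boundary m <= chains m Q)%MS.
Proof.
apply: chains_subP => t lt_t Qt; rewrite boundaryE summx_sub // => j _.
by rewrite scalemx_sub ?basis_vec_chains ?face_sorted ?face_all.
Qed.

Lemma boundaries_cycles i Q : (boundaries i Q <= cycles i Q)%MS.
Proof.
case: i => [|[|m]] /=; rewrite ?sub0mx ?genmxE ?chains_boundary //.
rewrite sub_capmx chains_boundary; apply/sub_kermxP.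
by rewrite -mulmxA boundary_boundary mulmx0.
Qed.

End Homology.

Section HomologyAction.
Variables (F : fieldType) (d : Order.disp_t) (P : finPOrderType d).
Variables (gT : finGroupType) (to : {action gT &-> P}).
Hypothesis to_mono : forall g, {mono to^~ g : x y / (x <= y)%O}.

Fact tuple_act1 m : (fun (t : m.-tuple P) g => map_tuple (to^~ g) t)^~ 1%g =1 id.
Proof. by move=> t; apply: eq_from_tnth => j; rewrite tnth_map act1. Qed.

Fact tuple_actM m (t : m.-tuple P) :
  act_morph (fun (t : m.-tuple P) g => map_tuple (to^~ g) t) t.
Proof. by move=> g h; apply: eq_from_tnth => j; rewrite !tnth_map actM. Qed.

Definition tuple_action m : {action gT &-> m.-tuple P} :=
  TotalAction (@tuple_act1 m) (@tuple_actM m).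

Local Notation act_mx m := (perm_module F (tuple_action m)).

(* The map induced in homology by the action of [g]. It is meaningful only when
   [g] sends [Q] to [Q']. *)
Definition hom_map i (Q Q' : {set P}) (g : gT) :
    'M[F]_(hom_dim F i Q, hom_dim F i Q') :=
  hom_class Q' (hom_lift 1%:M *m act_mx i.-1 g).

Lemma boundary_act m g :
  boundary F P m *m act_mx m g = act_mx m.+1 g *m boundary F P m.
Proof.
apply: eq_on_basis => t; rewrite !mulmxA perm_moduleE !boundaryE mulmx_suml.
apply: eq_bigr => j _; rewrite -scalemxAl perm_moduleE.
congr (_ *: basis_vec F _).
by apply: eq_from_tnth => l; rewrite /= !(tnth_map, tnth_mktuple).
Qed.

Lemma chains_act m (Q Q' : {set P}) g :
  {in Q, forall x, to x g \in Q'} ->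
  (chains F m Q *m act_mx m g <= chains F m Q')%MS.
Proof.
move=> sQ; apply: chains_subP => t lt_t Qt; rewrite perm_moduleE.
apply: basis_vec_chains.
  apply: (homo_sorted _) lt_t => x y; rewrite /=.
  by rewrite !lt_neqAle to_mono (inj_eq (act_inj to g)).
by rewrite all_map; apply: sub_all Qt => x /sQ.
Qed.

Lemma cycles_act i (Q Q' : {set P}) g :
  {in Q, forall x, to x g \in Q'} ->
  (cycles F i Q *m act_mx i.-1 g <= cycles F i Q')%MS.
Proof.
move=> sQ; case: i => [|[|m]]; try by apply: chains_act.
rewrite /= sub_capmx (submx_trans _ (chains_act m.+1 sQ)) ?submxMr ?capmxSl //.
apply/sub_kermxP; rewrite -mulmxA -boundary_act mulmxA.
by rewrite (sub_kermxP (capmxSr _ _)) mul0mx.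
Qed.

Lemma boundaries_act i (Q Q' : {set P}) g :
  {in Q, forall x, to x g \in Q'} ->
  (boundaries F i Q *m act_mx i.-1 g <= boundaries F i Q')%MS.
Proof.
move=> sQ; case: i => [|m]; rewrite /= ?mul0mx ?sub0mx // genmxE.
rewrite (eqmxMr _ (genmxE _)) -mulmxA boundary_act mulmxA.
by rewrite submxMr ?chains_act.
Qed.

Lemma hom_map1 i Q : hom_map i Q Q 1%g = 1%:M.
Proof. by rewrite /hom_map repr_mx1 mulmx1 hom_liftK. Qed.

Lemma hom_mapM i (Q Q' Q'' : {set P}) g h :
    {in Q, forall x, to x g \in Q'} -> {in Q', forall x, to x h \in Q''} ->
  hom_map i Q Q' g *m hom_map i Q' Q'' h = hom_map i Q Q'' (g * h)%g.
Proof.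
move=> sQ sQ'; rewrite /hom_map -hom_classM mulmxA -hom_liftE.
rewrite repr_mxM ?inE // mulmxA; set v := _ *m act_mx _ g.
have v_sub : (v <= boundaries F i Q' + cycles F i Q')%MS.
  rewrite (submx_trans (submxMr _ (hom_lift_sub _))) // addsmxMr.
  by rewrite addsmxS ?boundaries_act ?cycles_act.
apply/eqP; rewrite eq_sym -subr_eq0 /hom_class -!linearB /= -mulmxBl.
apply/eqP/hom_class0; apply: submx_trans (boundaries_act _ sQ').
exact/submxMr/hom_classK.
Qed.

End HomologyAction.

(* The group acts on the direct sum of the [H_(i-2)(Q x)], x in [S], through the
   maps induced in homology by [Q x -> Q (to x g)]: this is a matrix with one
   block for each pair of elements of [S], the only nonzero blocks being those
   indexed by a pair [(x, to x g)]. *)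
Section HomologySum.
Variables (F : fieldType) (d : Order.disp_t) (P : finPOrderType d).
Variables (gT : finGroupType) (to : {action gT &-> P}).
Hypothesis to_mono : forall g, {mono to^~ g : x y / (x <= y)%O}.
Variables (S : {set P}) (Q : P -> {set P}) (i : nat).
Hypothesis S_act : forall g, {in S, forall x, to x g \in S}.
Hypothesis Q_act : forall g,
  {in S, forall x, {in Q x, forall y, to y g \in Q (to x g)}}.

Definition hom_sum_mx (g : gT) :
    'M[F]_(\sum_(j < #|S|) hom_dim F i (Q (enum_val j))) :=
  \mxblock_(j < #|S|, l < #|S|)
    if enum_val l == to (enum_val j) g
    then hom_map F to i (Q (enum_val j)) (Q (enum_val l)) g else 0.

Fact hom_sum_mx_repr : mx_repr [set: gT] hom_sum_mx.
Proof.
split=> [|g h _ _].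
  rewrite -mxdiagZ; apply/eq_mxblockP => j l.
  rewrite act1 (inj_eq enum_val_inj) eq_sym.
  by case: eqVneq => // <-; rewrite hom_map1 conform_mx_id.
rewrite /hom_sum_mx mul_mxblock; apply/eq_mxblockP => j l.
have Sj := enum_valP j; have Sjg := S_act g Sj.
rewrite (bigD1 (enum_rank_in Sj (to (enum_val j) g))) //= big1 => [|k neq_k].
  rewrite enum_rankK_in // eqxx addr0 actM.
  case: eqP => [->|_]; last by rewrite mulmx0.
  by rewrite (hom_mapM _ to_mono) //; apply: Q_act.
case: eqP => [def_k|_]; last by rewrite mul0mx.
by rewrite -def_k enum_valK_in eqxx in neq_k.
Qed.

Definition hom_sum : representation F [set: gT] :=
  Representation (MxRepresentation hom_sum_mx_repr).

End HomologySum.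

Section Whitney.
Variables (F : fieldType) (d : Order.disp_t) (P : finTBPOrderType d).
Variables (gT : finGroupType) (to : {action gT &-> P}) (rk : P -> nat).
Hypothesis to_mono : forall g, {mono to^~ g : x y / (x <= y)%O}.
Hypothesis rk_act : forall x g, rk (to x g) = rk x.

Definition open_interval (x y : P) : {set P} := [set z | (x < z < y)%O].

Let to_lt g : {mono to^~ g : x y / (x < y)%O}.
Proof. by move=> x y; rewrite !lt_neqAle to_mono (inj_eq (act_inj to g)). Qed.

Let to_bot g : to \bot%O g = \bot%O.
Proof. by apply/eqP; rewrite -lex0 -{2}(actKV to g \bot%O) to_mono le0x. Qed.

Let to_top g : to \top%O g = \top%O.
Proof. by apply/eqP; rewrite -le1x -{1}(actKV to g \top%O) to_mono lex1. Qed.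

Definition rank_set (i : nat) : {set P} := [set x | rk x == i].

Fact rank_set_act i g : {in rank_set i, forall x, to x g \in rank_set i}.
Proof. by move=> x; rewrite !inE rk_act. Qed.

Fact lower_act i g : {in rank_set i, forall x, {in open_interval \bot%O x,
  forall y, to y g \in open_interval \bot%O (to x g)}}.
Proof. by move=> x _ y; rewrite !inE -{2}(to_bot g) !to_lt. Qed.

Fact upper_act i g : {in rank_set i, forall x, {in open_interval x \top%O,
  forall y, to y g \in open_interval (to x g) \top%O}}.
Proof. by move=> x _ y; rewrite !inE -{2}(to_top g) !to_lt. Qed.

Definition Whitney_homology (i : nat) : representation F [set: gT] :=
  hom_sum F to_mono i (@rank_set_act i) (@lower_act i).

Definition dual_Whitney_homology (i : nat) : representation F [set: gT] :=
  hom_sum F to_mono i (@rank_set_act (rk \top%O - i))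
    (@upper_act (rk \top%O - i)).

End Whitney.

Section SubwordPoset.
Variables (A : finType) (k : nat).

(* [None] is the artificial top element. *)
Definition subword_poset : Type := option (k.-bseq A).

HB.instance Definition _ := Finite.on subword_poset.

Definition subword_le (u v : subword_poset) : bool :=
  match u, v with
  | _, None => true
  | None, Some _ => false
  | Some u, Some v => subseq u v
  end.

Fact subword_le_refl : reflexive subword_le.
Proof. by case=> //= u; apply: subseq_refl. Qed.

Fact subword_le_anti : antisymmetric subword_le.
Proof.
case=> [u|] [v|] //= /andP[uv vu]; congr Some; apply: val_inj => /=.
apply/eqP; rewrite -(size_subseq_leqif uv).
by rewrite eqn_leq (size_subseq uv) (size_subseq vu).
Qed.

Fact subword_le_trans : transitive subword_le.
Proof. by case=> [u|] [v|] [w|] //=; apply: subseq_trans. Qed.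

Fact subword_display : Order.disp_t. Proof. exact: Order.Disp tt tt. Qed.

HB.instance Definition _ := Order.Le_isPOrder.Build subword_display
  subword_poset subword_le_refl subword_le_anti subword_le_trans.

Fact subword_bot (u : subword_poset) : ((Some [bseq] : subword_poset) <= u)%O.
Proof. by case: u => //= u; apply: sub0seq. Qed.

Fact subword_top (u : subword_poset) : (u <= (None : subword_poset))%O.
Proof. by case: u. Qed.

HB.instance Definition _ :=
  Order.hasBottom.Build subword_display subword_poset subword_bot.
HB.instance Definition _ :=
  Order.hasTop.Build subword_display subword_poset subword_top.

Definition subword_rank (u : subword_poset) : nat :=
  if u is Some w then size w else k.+1.

Definition rename (u : subword_poset) (g : {perm A}) : subword_poset :=
  omap (fun w : k.-bseq A => [bseq of map g w]) u.

Fact rename1 : rename^~ 1%g =1 id.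
Proof.
case=> //= w; congr Some; apply: val_inj => /=.
by rewrite (eq_map (@perm1 A)) map_id.
Qed.

Fact renameM u : act_morph rename u.
Proof.
move=> g h; case: u => //= w; congr Some; apply: val_inj => /=.
by rewrite -map_comp; apply: eq_map => a; rewrite /= permM.
Qed.

Definition rename_action : {action {perm A} &-> subword_poset} :=
  TotalAction rename1 renameM.

Fact rename_mono g : {mono rename_action^~ g : u v / (u <= v)%O}.
Proof.
have homo h : {homo rename_action^~ h : u v / (u <= v)%O}.
  by case=> [u|] [v|] //= uv; apply: map_subseq.
move=> u v; apply/idP/idP; last exact: homo.
by move/(homo g^-1%g); rewrite !actK.
Qed.

Fact rename_rank u g : subword_rank (rename_action u g) = subword_rank u.
Proof. by case: u => //= w; rewrite size_map. Qed.

End SubwordPoset.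

Definition subword_WH (F : fieldType) (A : finType) (k i : nat) :
    representation F [set: {perm A}] :=
  Whitney_homology F (@rename_mono A k) (@rename_rank A k) i.

Definition subword_dual_WH (F : fieldType) (A : finType) (k i : nat) :
    representation F [set: {perm A}] :=
  dual_Whitney_homology F (@rename_mono A k) (@rename_rank A k) i.

(* Specht modules. A tableau of shape [la] with entries in [A] is encoded by the
   injective map [t] sending each entry to its cell (row, column) of the Young
   diagram. A tabloid only remembers the row of each entry. *)
Section Specht.
Variables (F : fieldType) (A : finType) (la : seq nat).

Notation tabloid := {ffun A -> 'I_(size la)}.
Notation filling := {ffun A -> 'I_(size la) * 'I_(head 0 la)}.

Definition is_tableau (t : filling) : bool :=
  injectiveb t && [forall c, (c \in codom t) == (c.2 < nth 0 la c.1)%N].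

Definition tabloid_act (f : tabloid) (g : {perm A}) : tabloid :=
  [ffun a => f (g^-1%g a)].

Fact tabloid_act1 : tabloid_act^~ 1%g =1 id.
Proof. by move=> f; apply/ffunP=> a; rewrite ffunE invg1 perm1. Qed.

Fact tabloid_actM f : act_morph tabloid_act f.
Proof. by move=> g h; apply/ffunP=> a; rewrite !ffunE invMg permM. Qed.

Definition tabloid_action : {action {perm A} &-> tabloid} :=
  TotalAction tabloid_act1 tabloid_actM.

Definition polytabloid (t : filling) : 'rV[F]_#|{: tabloid}| :=
  \sum_(s : {perm A} | [forall a, (t (s a)).2 == (t a).2])
    (-1) ^+ s *: basis_vec F [ffun a => (t (s a)).1].

Definition Specht_space : 'M[F]_#|{: tabloid}| :=
  (\sum_(t : filling | is_tableau t) <<polytabloid t>>)%MS.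

Fact Specht_module : mxmodule (perm_module F tabloid_action) Specht_space.
Proof.
apply/mxmoduleP => g _; rewrite sumsmxMr_gen; apply/sumsmx_subP => t tabt.
rewrite genmxE (eqmxMr _ (genmxE _)).
pose t' : filling := [ffun a => t (g^-1%g a)].
have tabt' : is_tableau t'.
  case/andP: tabt => /injectiveP injt /forallP imt; apply/andP; split.
    by apply/injectiveP=> a b; rewrite !ffunE => /injt/perm_inj.
  apply/forallP => c; suff -> : (c \in codom t') = (c \in codom t) by [].
  apply/codomP/codomP => -[a ->]; first by exists (g^-1%g a); rewrite ffunE.
  by exists (g a); rewrite ffunE permK.
rewrite (sumsmx_sup t') // genmxE /polytabloid mulmx_suml.
rewrite (reindex_inj (conjg_inj g^-1%g)) /=.
set v := (X in (X <= _)%MS); set w := (X in (_ <= X)%MS); suff -> : v = w by [].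
apply: eq_big => [s|s _].
  apply/forallP/forallP => h a.
    by have := h (g^-1%g a); rewrite !ffunE conjgE invgK !permM permKV.
  by have := h (g a); rewrite !ffunE conjgE invgK !permM permK.
rewrite -scalemxAl perm_moduleE odd_permJ; congr (_ *: basis_vec F _).
by apply/ffunP => a; rewrite !ffunE conjgE invgK !permM permKV.
Qed.

Definition Specht : representation F [set: {perm A}] :=
  Representation (submod_repr Specht_module).

End Specht.

Section TensorPower.
Variables (F : fieldType) (gT : finGroupType) (G : {group gT}).

Fact trivial_mx_repr : mx_repr G (fun _ : gT => 1%:M : 'M[F]_1).
Proof. by split=> // g h _ _; rewrite mulmx1. Qed.

Definition tensor (V W : representation F G) : representation F G :=
  Representation (prod_repr V W).

Definition tensor_power (V : representation F G) (m : nat) :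
    representation F G :=
  iter m (tensor V) (Representation (MxRepresentation trivial_mx_repr)).

End TensorPower.

(* Main.v *)
(** Both Whitney homologies live in the top degree of their intervals, hence they
    are spaces of cycles: functions on maximal chains whose sum over the elements
    that fill any given gap vanishes. Deleting some marked letters of a word in
    all possible orders, with signs, produces a cycle of [(x, w)], and zero-sum
    combinations of words in the marked letters produce cycles of [(x, 1)]. This
    yields an equivariant map from the sum, over the sets of marked positions, of
    the tensor products of copies of the standard module [S] (at the marked
    positions) and of the permutation module [S + 1] (at the others).
    It is injective because the coefficients of these cycles on the falling chains
    are triangular, and it is onto because a shelling argument shows that a cycle
    that vanishes on the falling chains is zero. For [(x, 1)] there are
    binomial(k, i) sets of marked positions; for [(0, x)] all the letters are
    marked, and the first one is not subject to the zero-sum condition. *)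

Require Import Defs.
From HB Require Import structures.
From mathcomp Require Import all_boot all_order all_algebra all_fingroup.
From mathcomp Require Import mxrepresentation character reals complex.
From mathcomp Require Import zify.

Set Implicit Arguments.
Unset Strict Implicit.
Unset Printing Implicit Defensive.

Import Order.TTheory GRing.Theory.

(** * Words and falling chains *)

(** Deleting any letter of a run of equal letters gives the same word, so the words covered by a
    given word correspond to its run starts. The marked letters of a falling chain must therefore
    differ from the letter before them. At a marked position exactly one letter is thus excluded,
    and the zero-sum condition there is what recovers the value at that letter: a function with
    vanishing sums is determined by its values on the words for which the mask is good, and these
    values can be prescribed freely. The first letter has no predecessor, so nothing is excluded
    there; this matches the absence of a condition on it in [(0, x)]. For [(x, 1)] the condition on
    the first letter is recovered afterwards, from the face opposite to the top word.

    No dimension is counted: injectivity and surjectivity are both proved by induction on masks. All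
    modules are compared as spaces of functions on [S_n]-sets, where an isomorphism is given by an
    equivariant kernel, and the final identities between sums of tensor powers become identities
    between polynomials. *)

Section Words.
Variable A : eqType.
Implicit Types (c : option A) (w y : seq A) (p q : nat).

Definition del (T : Type) p (s : seq T) := take p s ++ drop p.+1 s.

Definition covers w y := subseq y w && (size w == (size y).+1).

(* [p] is the position of the first letter of a run of equal letters of [w],
   where [c] is the letter that precedes [w], if any. *)
Fixpoint run_start c w p : bool :=
  match w, p with
  | [::], _ => false
  | a :: _, 0 => c != Some a
  | a :: w', q.+1 => run_start (Some a) w' q
  end.

Lemma del0 (T : Type) (x : T) s : del 0 (x :: s) = s.
Proof. by rewrite /del /= drop0. Qed.

Lemma delS (T : Type) p (x : T) s : del p.+1 (x :: s) = x :: del p s.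
Proof. by []. Qed.

Lemma run_start_lt c w p : run_start c w p -> p < size w.
Proof. by elim: w c p => [|a w IH] c [|p] //= /IH. Qed.

Lemma size_del (T : Type) p (s : seq T) : p < size s -> size (del p s) = (size s).-1.
Proof. by move=> lt; rewrite size_cat size_take lt size_drop; lia. Qed.

Lemma run_start_prev c c' w p : 0 < p -> run_start c w p = run_start c' w p.
Proof. by case: w p => [|a w] [|p]. Qed.

Lemma del_subseq (T : eqType) p (s : seq T) : subseq (del p s) s.
Proof.
rewrite -[X in subseq _ X](cat_take_drop p s) cat_subseq //.
by rewrite -(addn1 p) addnC -drop_drop drop_subseq.
Qed.

Lemma covers_del p w : p < size w -> covers w (del p w).
Proof. by move=> lt; rewrite /covers del_subseq size_del //; apply/eqP; lia. Qed.

Lemma path_covers_size w (ys : seq (seq A)) : path covers w ys ->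
  (size ys + size (last w ys) = size w)%N.
Proof.
elim: ys w => //= y ys IH w /andP[/andP[_ /eqP->] /IH <-].
by rewrite addSn.
Qed.

(** A deletion inside a run can always be moved to the first letter of that run. *)
Lemma coversP w y : covers w y -> exists2 p, run_start None w p & y = del p w.
Proof.
elim: w y => [|a w IH] y /andP[]; first by case: y.
case: y => [|b y] sub /eqP/= [sz].
  by case: w sz {IH sub} => // _; exists 0.
move: sub => /=; case: eqP => [->|_] sub; last first.
  exists 0 => //; rewrite del0; apply/eqP.
  by rewrite -(size_subseq_leqif sub) /= sz.
have [|p gp ->] := IH y; first by rewrite /covers sub sz /=.
case: p gp => [|p] gp; last by exists p.+2; rewrite //= (run_start_prev _ None).
case: w {IH sub sz} gp => // a' w _.
have [->|ne] := eqVneq a' a; first by exists 0; rewrite ?del0.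
by exists 1 => //=; apply: contra_neq ne => -[].
Qed.

(** Equality would force all letters of [w] up to position [q] to be [a], and then no run could
    start at [q]. *)
Lemma del_neq_shift a w q : run_start (Some a) w q -> a :: del q w <> w.
Proof.
elim: w a q => [|b w IH] a [|q] //=; first by move=> ne [eab _]; rewrite eab eqxx in ne.
by move=> gq [_]; apply: (IH _ _ gq).
Qed.

(** Equality would give [w] period 2 up to position [p + 1] and make it constant from there to
    [q + 1]. In [del p w] the letter at [q] would then equal its predecessor, so that no run could
    start there. *)
Lemma del2_neq_shift a b w p q :
  run_start (Some b) w p -> p <= q -> run_start (Some b) (del p w) q -> a != b ->
  a :: b :: del q (del p w) <> w.
Proof.
elim/ltn_ind: p q w => p IH q w gp lepq gq neab eqw.
case: w eqw gp gq => // _ w [<-] eqw gp gq.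
case: p IH lepq gp gq eqw => [|p] IH lepq gp gq eqw.
  by rewrite del0 in gq eqw; apply: (del_neq_shift gq eqw).
case: q lepq gq eqw => // q lepq; rewrite delS => gq eqw.
case: w eqw gp gq => // _ w [<-] eqw gp gq.
case: p IH lepq gp gq eqw => [|p] IH lepq gp gq eqw.
  rewrite delS del0 in eqw; rewrite /= del0 in gq; exact: (del_neq_shift gq eqw).
case: q lepq gq eqw => // q lepq; rewrite delS => gq eqw.
exact: (IH p _ q w).
Qed.

(* Greedy comparison: up to the position [p] the two words can only agree if
   [w] is constant or alternating there, which [run_start] forbids. *)
Lemma run_start_no_cross_cons a w p q :
  run_start (Some a) w p -> p <= q -> run_start (Some a) (del p w) q ->
  ~~ subseq (a :: del q (del p w)) w.
Proof.
elim: w p q => [|b w IH] p q // gp lepq gq; apply/negP => /= sub.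
have lp := run_start_lt gp; have lq := run_start_lt gq.
have szq := size_del lq; have szp := size_del lp; rewrite /= in lp szp.
case: p gp lepq gq lp lq szp szq sub => [|p] /= gp lepq gq lp lq szp szq.
  case: eqP => [eba|_ sub]; first by rewrite eba eqxx in gp.
  apply: (@del_neq_shift a w q); first by rewrite del0 in gq.
  apply/eqP; rewrite del0 in sub szq lq.
  by rewrite -(size_subseq_leqif sub) /= szq; apply/eqP; lia.
case: q lepq gq lq szq => // q lepq gq lq szq; rewrite !delS /=.
rewrite !delS /= in gq lq szq *.
case: eqP => [eab|/eqP neab] sub.
  by subst b; have := IH p q gp lepq gq; rewrite sub.
apply: (@del2_neq_shift a b w p q) => //.
apply/eqP; rewrite -(size_subseq_leqif sub) /=; apply/eqP; lia.
Qed.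

(** When two deletions go from left to right, every other way to fill the gap deletes from [w] a run
    start beyond [p]. This is the exchange property behind the shelling. *)
Lemma run_start_no_cross w p p' q :
  run_start None w p -> p' < p -> p <= q -> run_start None (del p w) q ->
  ~~ covers (del p' w) (del q (del p w)).
Proof.
move=> gp ltp lepq gq; rewrite negb_and; apply/orP; left.
elim: w p p' q gp ltp lepq gq => [|a w IH] [|p] [|p'] [|q] //= gp ltp lepq gq.
  by rewrite del0 !delS; apply: run_start_no_cross_cons.
rewrite !delS /= eqxx; apply: IH => //.
  by rewrite (run_start_prev _ (Some a)) //; lia.
by rewrite (run_start_prev _ (Some a)) //; lia.
Qed.

Implicit Types (u v : seq (bool * A)) (ys : seq (seq A)).

(* Marked words: the letters paired with [true] are to be deleted. *)
Definition letters v := [seq x.2 | x <- v].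
Definition marks v := [seq x.1 | x <- v].
Definition unmarked v := [seq x.2 | x <- v & ~~ x.1].

Fixpoint good_marking c v : bool :=
  if v is x :: v' then (x.1 ==> (c != Some x.2)) && good_marking (Some x.2) v' else true.

(* The words obtained by deleting the marked letters one by one, from right to
   left. *)
Fixpoint fall v : seq (seq A) :=
  if v is x :: v' then
    [seq x.2 :: y | y <- fall v'] ++ (if x.1 then [:: unmarked v'] else [::])
  else [::].

Lemma size_letters v : size (letters v) = size v. Proof. exact: size_map. Qed.

Lemma size_fall v : size (fall v) = count id (marks v).
Proof.
by elim: v => //= x v IH; rewrite size_cat size_map IH; case: x.1; rewrite /= addnC.
Qed.

Lemma unmarked_letters v : ~~ has id (marks v) -> unmarked v = letters v.
Proof.
elim: v => //= x v IH; rewrite negb_or /unmarked /= => /andP[-> /IH e] /=.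
by rewrite -e.
Qed.

Lemma fall_nomark v : ~~ has id (marks v) -> fall v = [::].
Proof.
move=> nm; apply/size0nil; rewrite size_fall; apply/eqP.
by rewrite -leqn0 leqNgt -has_count.
Qed.

(** The recursion of [fall] peels letters off the left end, whereas the deletions begin at the
    rightmost mark. *)
Lemma fall_last v0 a v1 : ~~ has id (marks v1) ->
  fall (v0 ++ (true, a) :: v1) = letters (v0 ++ v1) :: fall (v0 ++ v1).
Proof.
move=> nm; elim: v0 => [|x v IH] /=; first by rewrite fall_nomark //= unmarked_letters.
by rewrite IH /= /unmarked !filter_cat.
Qed.

Lemma last_mark v : has id (marks v) ->
  exists v0 a v1, v = v0 ++ (true, a) :: v1 /\ ~~ has id (marks v1).
Proof.
elim: v => //= -[x a] v IH /=.
have [hv _|nm] := boolP (has id (marks v)).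
  by have [v0 [b [v1 [-> nm]]]] := IH hv; exists ((x, a) :: v0), b, v1.
by rewrite orbF => /= hx; exists [::], a, v; rewrite hx.
Qed.

Lemma good_marking_cat c v0 v1 :
  good_marking c (v0 ++ v1) =
  good_marking c v0 && good_marking (last c [seq Some x.2 | x <- v0]) v1.
Proof. by elim: v0 c => //= x v IH c; rewrite IH andbA. Qed.

Lemma good_marking_nomark c v : ~~ has id (marks v) -> good_marking c v.
Proof. by elim: v c => //= x v IH c; rewrite negb_or => /andP[/negbTE-> /IH->]. Qed.

Lemma run_start_cat c w0 a w1 :
  run_start c (w0 ++ a :: w1) (size w0) = (last c [seq Some b | b <- w0] != Some a).
Proof. by elim: w0 c => //= b w IH c. Qed.

Lemma del_cat (T : Type) (s0 : seq T) x s1 : del (size s0) (s0 ++ x :: s1) = s0 ++ s1.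
Proof.
rewrite /del take_size_cat // drop_cat ltnNge leqnSn /=.
by rewrite subSnn /= drop0.
Qed.

Lemma path_fall v : path covers (letters v) (fall v).
Proof.
have [n] := ubnP (size v); elim: n v => // n IH v ltn.
have [hv|nm] := boolP (has id (marks v)); last by rewrite fall_nomark.
have [v0 [a [v1 [ev nm]]]] := last_mark hv.
rewrite ev fall_last //= IH ?andbT; last first.
  by rewrite ev !size_cat /= in ltn *; lia.
rewrite /letters !map_cat /= -[_ ++ map snd v1](del_cat _ a).
by rewrite covers_del // size_cat /=; lia.
Qed.

(** The element [y] is replaced only when a word [y1] follows it: the bottom of the chain stays
    fixed. *)
Definition fillable (Z : seq (seq A) -> Prop) w := forall pre y y1 post,
  (forall y', covers (last w pre) y' -> covers y' y1 -> y' != y ->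
     Z (pre ++ y' :: y1 :: post)) ->
  Z (pre ++ y :: y1 :: post).

(* A property of chains below [w] which passes to a chain as soon as it holds
   for all the chains that differ from it in one given interior element holds
   everywhere if it holds on the falling chains of good markings: these are the
   homology facets of a (dual) lexicographic shelling, the other chains being
   reached by induction in reverse lexicographic order. *)
Lemma shelling_ind m w (Z : seq (seq A) -> Prop) : fillable Z w ->
  (forall v, letters v = w -> good_marking None v -> count id (marks v) = m -> Z (fall v)) ->
  forall ys, path covers w ys -> size ys = m -> Z ys.
Proof.
elim: m w Z => [|m IHm] w Z fillZ fallZ ys.
  case: ys => // _ _.
  have := fallZ [seq (false, a) | a <- w].
  have eqm : marks [seq (false, a) | a <- w] = nseq (size w) false.
    by rewrite /marks -map_comp; elim: (w) => //= ? ? ->.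
  have nm : ~~ has id (marks [seq (false, a) | a <- w]).
    by rewrite eqm has_nseq andbF.
  rewrite fall_nomark //; apply.
  - by rewrite /letters -map_comp map_id.
  - exact: good_marking_nomark.
  - by apply/eqP; rewrite -leqn0 leqNgt -has_count.
case: ys => // y1 ys /= /andP[/coversP[p gp ->] pys] [szys].
move: p gp ys pys szys.
(* Inner induction on the first deletion, from the right end of [w] to the left: [d] bounds the room
   to the right of [p]. *)
suff H: forall d p, size w - p <= d -> run_start None w p -> forall ys,
    path covers (del p w) ys -> size ys = m -> Z (del p w :: ys).
  by move=> p gp; apply: (H (size w) p) => //; apply: leq_subr.
elim=> [|d IHd] p; first by move=> led /run_start_lt; lia.
move=> led gp; have ltp := run_start_lt gp.
apply: (IHm (del p w) (fun ys => Z (del p w :: ys))) => [pre y z post H|v lv gv cv].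
  by apply: (fillZ (del p w :: pre)) => y' c1 c2 ne; apply: H.
have szv : size v = (size w).-1 by rewrite -size_letters lv size_del.
(* If [v] has a mark at or beyond [p], the first two deletions go from left to right. All the other
   fillers of that gap delete beyond [p] and are covered by the inner induction. *)
have [hv|nm] := boolP (has id (marks (drop p v))).
  have [v0' [b [v1 [ev nm]]]] := last_mark hv.
  set v0 := take p v ++ v0'.
  have ev0 : v = v0 ++ (true, b) :: v1 by rewrite -catA -ev cat_take_drop.
  have szv0 : p <= size v0 by rewrite size_cat size_take; case: ltnP; lia.
  clearbody v0; rewrite [in fall v]ev0 fall_last //.
  have gq : run_start None (del p w) (size v0).
    move: gv; rewrite -lv ev0 good_marking_cat /= => /and3P[_ + _].
    by rewrite /letters map_cat /= -(size_map snd v0) run_start_cat -map_comp.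
  have edq : letters (v0 ++ v1) = del (size v0) (del p w).
    by rewrite -lv ev0 /letters !map_cat /= -(size_map snd v0) del_cat.
  apply: (fillZ [::]) => y' /= cw cy ne.
  have [p' gp' ey'] := coversP cw.
  have ltp' : p < p'.
    rewrite ltnNge leq_eqVlt; apply/norP; split.
      by apply: contra_neq ne => <-.
    apply/negP => ltp'.
    by have := run_start_no_cross gp ltp' szv0 gq; rewrite -edq -ey' cy.
  rewrite ey'; apply: IHd => //; first by lia.
    by rewrite /= -ey' cy path_fall.
  rewrite -[RHS]cv -size_fall ev0 fall_last //.
have [w0 [a [w1 [ew sz0]]]] : exists w0 a w1, w = w0 ++ a :: w1 /\ size w0 = p.
  case: (drop p w) (cat_take_drop p w) (size_drop p w) => [|a w1] ew sz /=.
    by move: sz => /=; lia.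
  by exists (take p w), a, w1; rewrite ew size_take ltp.
have edel : del p w = w0 ++ w1 by rewrite ew -sz0 del_cat.
(* All marks lie before [p]: putting the deleted letter back, marked, exhibits the whole chain as a
   falling chain of [w]. *)
set v' := take p v ++ (true, a) :: drop p v.
have lv' : letters v' = w.
  rewrite /letters map_cat /= map_take map_drop -/(letters v) lv edel.
  by rewrite -sz0 take_size_cat // drop_size_cat // ew.
have <- : fall v' = del p w :: fall v.
  by rewrite /v' fall_last // cat_take_drop lv.
apply: fallZ => //.
  have goodv : good_marking None (take p v ++ drop p v) by rewrite cat_take_drop.
  move: goodv; rewrite /v' !good_marking_cat /= => /andP[-> _] /=.
  rewrite (good_marking_nomark _ nm) andbT.
  move: gp; rewrite -lv' /v' /letters map_cat /=.
  have szt : size (map snd (take p v)) = p.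
    by rewrite size_map size_take; case: ltnP; lia.
  by rewrite -[X in run_start _ _ X]szt run_start_cat -map_comp.
rewrite /v' /marks map_cat count_cat /= addnCA -count_cat -map_cat.
by rewrite cat_take_drop -/(marks v) cv.
Qed.

End Words.

(** * Cycles of marked words *)

Section MarkedCycles.
Local Open Scope ring_scope.
Variables (F : fieldType) (A : finType).
Implicit Types (u v : seq (bool * A)) (ys : seq (seq A)) (w y : seq A).
Implicit Types (h g : seq (bool * A) -> F).

(* Alternating sum of [h] over the ways of deleting one marked letter of [u]; the
   sign is given by the number of marked letters to the left. *)
Fixpoint delta h u : F :=
  if u is x :: u' then
    (if x.1 then h u' else 0) + (-1) ^+ x.1 * delta (fun u => h (x :: u)) u'
  else 0.

Lemma delta_neq0 h u : delta h u != 0 ->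
  exists u0 a u1, u = u0 ++ (true, a) :: u1 /\ h (u0 ++ u1) != 0.
Proof.
elim: u h => [|[x a] u IH] h /=; first by rewrite eqxx.
have [d0|/IH[u0 [b [u1 [-> hu]]]] _] := eqVneq (delta (fun u => h ((x, a) :: u)) u) 0.
  rewrite d0 mulr0 addr0; case: x {d0} => [hu|]; last by rewrite eqxx.
  by exists [::], a, u.
by exists ((x, a) :: u0), b, u1.
Qed.

Lemma eq_delta h h' u :
  (forall u', size u' = (size u).-1 -> h u' = h' u') -> delta h u = delta h' u.
Proof.
elim: u h h' => //= x u IH h h' eqh; rewrite eqh //; congr (_ + _ * _).
case: u IH eqh => [|x' u] IH eqh //.
by apply: IH => u' su; apply: eqh; rewrite /= su.
Qed.

Lemma delta_sum (I : finType) (h : I -> seq (bool * A) -> F) u :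
  \sum_i delta (h i) u = delta (fun u => \sum_i h i u) u.
Proof.
elim: u h => [|x u IH] h /=; first by rewrite big1.
rewrite big_split /= -mulr_sumr IH; congr (_ + _).
by case: x.1; rewrite // big1.
Qed.

Lemma delta_lin a h h' u :
  delta (fun u => h' u + a * h u) u = delta h' u + a * delta h u.
Proof.
elim: u h h' => [|x u IH] h h' /=; first by rewrite mulr0 addr0.
rewrite IH !mulrDr addrACA mulrCA; congr (_ + _).
by case: x.1; rewrite ?mulr0 ?addr0.
Qed.

Lemma delta0 h u : (forall u', h u' = 0) -> delta h u = 0.
Proof.
by elim: u h => //= x u IH h h0; rewrite IH // mulr0 addr0 h0; case: x.1.
Qed.

Lemma deltaZ a h u : delta (fun u => a * h u) u = a * delta h u.
Proof.
rewrite -[RHS]add0r -(delta0 (h := fun=> 0) u) // -delta_lin.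
by apply: eq_delta => u' _; rewrite add0r.
Qed.

(** Two marked letters can be deleted in either order. Deleting the left one first changes the sign
    attached to the other, so the two contributions cancel. *)
Lemma delta_delta h u : delta (delta h) u = 0.
Proof.
elim: u h => //= -[x a] u IH h /=; rewrite delta_lin IH mulr0 addr0.
case: x => /=; first by rewrite expr1 mulN1r subrr.
by rewrite delta0 // mulr0 addr0.
Qed.

(* [chain_coef_rec ys g u] is the signed sum of [g] over the ways of deleting marked
   letters of [u] one by one so that the successive words are those of [ys]. *)
Fixpoint chain_coef_rec ys g u : F :=
  if ys is y :: ys' then
    delta (fun u' => (letters u' == y)%:R * chain_coef_rec ys' g u') u
  else g u.

(** As the final weight of a chain, it discards the sequences of deletions that leave a marked
    letter. *)
Definition unmark u : F := (~~ has id (marks u))%:R.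

Definition chain_coef ys := chain_coef_rec ys unmark.

(** Coefficient of the chain [c], listed from the top word down, in the cycle attached to [u]. *)
Definition cycle_coef (c : seq (seq A)) u : F :=
  if c is w :: ys then (letters u == w)%:R * chain_coef ys u else 0.

Lemma chain_coef_rec_cat ys1 ys2 g u :
  chain_coef_rec (ys1 ++ ys2) g u = chain_coef_rec ys1 (chain_coef_rec ys2 g) u.
Proof.
by elim: ys1 u => //= y ys1 IH u; apply: eq_delta => u' _; rewrite IH.
Qed.

Lemma eq_chain_coef_rec ys g g' u :
  (forall u', letters u' = last (letters u) ys -> g u' = g' u') ->
  chain_coef_rec ys g u = chain_coef_rec ys g' u.
Proof.
elim: ys u => [|y ys IH] u /= eqg; first exact: eqg.
apply: eq_delta => u' _; case: eqP => [eu'|]; last by rewrite !mul0r.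
by rewrite (IH u') // eu'.
Qed.

Lemma chain_coef_rec0 ys u : chain_coef_rec ys (fun=> 0) u = 0.
Proof.
elim: ys u => //= y ys IH u; apply: delta0 => u'; by rewrite IH mulr0.
Qed.

Lemma chain_coef_supp ys u : chain_coef ys u != 0 ->
  path (@covers A) (letters u) ys && (size ys == count id (marks u)).
Proof.
elim: ys u => [|y ys IH] u /=.
  by rewrite /chain_coef /= /unmark has_count -leqNgt leqn0; case: count => // n; rewrite eqxx.
move/delta_neq0 => [u0 [a [u1 [-> ]]]].
case: (_ =P y) => [<-|_]; last by rewrite mul0r eqxx.
rewrite mul1r => /IH /andP[-> /eqP->]; rewrite andbT; apply/andP; split.
  rewrite /letters !map_cat /= -[_ ++ map snd u1](del_cat _ a).
  by rewrite covers_del // size_cat /=; lia.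
by rewrite /marks !map_cat !count_cat /=; apply/eqP; lia.
Qed.

Lemma sum_eq_tuple j y (f : seq A -> F) :
  \sum_(z : j.-tuple A) (y == z)%:R * f z = (size y == j)%:R * f y.
Proof.
have [szy|ne] := eqVneq (size y) j; last first.
  rewrite big1 ?mul0r // => z _; case: eqP => [e|]; last by rewrite mul0r.
  by rewrite e size_tuple eqxx in ne.
rewrite (bigD1 (Tuple (introT eqP szy))) //= eqxx !mul1r big1 ?addr0 // => z.
by rewrite -val_eqE /= eq_sym => /negbTE->; rewrite mul0r.
Qed.

(** Summing over the filler lifts the constraint on the intermediate word, and the two successive
    deletions then cancel by [delta_delta]. *)
Lemma chain_coef_filler pre y1 ys u j : size u = (size pre + j).+1 ->
  \sum_(y : j.-tuple A) chain_coef (pre ++ val y :: y1 :: ys) u = 0.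
Proof.
rewrite /chain_coef; elim: pre u => [|y pre IH] u /= szu.
  rewrite delta_sum -[RHS](delta_delta (fun u => (letters u == y1)%:R * chain_coef ys u) u).
  apply: eq_delta => u' su'.
  rewrite (sum_eq_tuple _ _ (fun=> delta (fun u => (letters u == y1)%:R * chain_coef ys u) u')).
  by rewrite size_letters su' szu eqxx mul1r.
rewrite delta_sum -[RHS](delta0 (h := fun=> 0) u) //.
apply: eq_delta => u' su'; rewrite -mulr_sumr IH ?mulr0 //.
by rewrite su' szu.
Qed.

Lemma cycle_coef_filler pre y1 post u j : pre != [::] -> size u = (size pre + j)%N ->
  \sum_(y : j.-tuple A) cycle_coef (pre ++ val y :: y1 :: post) u = 0.
Proof.
case: pre => // w pre _ szu; rewrite /= -mulr_sumr chain_coef_filler ?mulr0 //.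
Qed.

(* Comparing codes amounts to comparing masks lexicographically. *)
Fixpoint code (b : seq bool) : nat :=
  if b is x :: b' then (x * 2 ^ size b' + code b')%N else 0%N.

Lemma code_lt b : (code b < 2 ^ size b)%N.
Proof. by elim: b => //= x b IH; rewrite expnS; case: x; lia. Qed.

(** By [del_neq_shift], deleting the head never produces the next word of the chain. All deletions
    thus take place behind the head, and each one contributes a sign when the head is marked. *)
Lemma chain_coef_rec_fall_cons a x v u g : good_marking (Some a) v -> letters u = letters v ->
  chain_coef_rec [seq a :: y | y <- fall v] g ((x, a) :: u) =
  (-1) ^+ (x * count id (marks v)) * chain_coef_rec (fall v) (fun u => g ((x, a) :: u)) u.
Proof.
have [n] := ubnP (size v); elim: n v u => // n IH v u ltn gv luv.
have [hv|nm] := boolP (has id (marks v)); last first.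
  rewrite fall_nomark //=; move: nm; rewrite has_count -leqNgt leqn0 => /eqP->.
  by rewrite muln0 mul1r.
have [v0 [b [v1 [ev nm]]]] := last_mark hv.
have gv2 : good_marking (Some a) (v0 ++ v1).
  by move: gv; rewrite ev !good_marking_cat => /andP[-> _]; apply: good_marking_nomark.
have -> : fall v = letters (v0 ++ v1) :: fall (v0 ++ v1) by rewrite ev fall_last.
have -> : count id (marks v) = (count id (marks (v0 ++ v1))).+1.
  by rewrite ev /marks !map_cat !count_cat /= addnCA.
set v2 := v0 ++ v1 in gv2 *.
have sv2 : (size v2 < n)%N.
  by move: ltn; rewrite ev /v2 !size_cat /=; lia.
have ne : (letters u == a :: letters v2) = false.
  apply/eqP => /esym; rewrite luv ev /v2 /letters !map_cat /=.
  rewrite -[_ ++ map snd v1](del_cat _ b); apply: del_neq_shift.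
  move: gv; rewrite ev good_marking_cat /= => /and3P[_ + _].
  by rewrite run_start_cat -map_comp.
rewrite /= ne mul0r if_same add0r mulnS exprD -mulrA; congr (_ * _).
rewrite -deltaZ; apply: eq_delta => u' _.
have [eu'|ne'] := eqVneq (letters u') (letters v2).
  by rewrite eu' eqxx !mul1r IH.
by rewrite eqseq_cons (negbTE ne') andbF !mul0r mulr0.
Qed.

Lemma last_fall v : last (letters v) (fall v) = unmarked v.
Proof.
elim: v => //= -[x a] v IH /=; rewrite last_cat last_map IH.
by case: x.
Qed.

(* The matrix that gives the coefficients of the cycles of all markings of a word
   on its falling chains is triangular for the lexicographic order of marks. *)
Lemma chain_coef_fall c u v : good_marking c v -> letters u = letters v ->
  (u = v -> chain_coef (fall v) u != 0) /\
  (chain_coef (fall v) u != 0 -> u != v -> (code (marks u) < code (marks v))%N).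
Proof.
elim: v c u => [|[x a] v IH] c [|[x' a'] u] //= => [_ _|/andP[gx gv] []].
  by rewrite /chain_coef /= /unmark /= oner_eq0.
move=> -> {a'} luv; have [IH1 IH2] := IH _ _ gv luv.
have szc : size (marks u) = size (marks v).
  by rewrite !size_map -(size_map snd u) -/(letters u) luv size_map.
have := code_lt (marks u); rewrite szc => ltu.
case: x gx => gx; last first.
  rewrite cats0 /chain_coef chain_coef_rec_fall_cons //.
  set e := (-1) ^+ _; have e0 : e != 0 by rewrite expf_neq0 // oppr_eq0 oner_eq0.
  (* A head marked in [u] but not in [v] is never deleted along [fall v], so a mark remains and the
     coefficient is zero. *)
  case: x' @e e0 => e e0.
    by split=> //; rewrite (eq_chain_coef_rec (g' := fun=> 0)) // chain_coef_rec0 mulr0 eqxx.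
  rewrite mulf_eq0 negb_or e0 /=; split.
    by move=> [/IH1].
  by move=> /IH2 + ne; rewrite /= !mul0n !add0n; apply; apply: contra_neq ne => ->.
(* A head marked in [v] only decides the comparison of codes by its leading bit. *)
case: x'; last first.
  by split=> //= _ _; rewrite mul0n add0n mul1n; lia.
rewrite /chain_coef chain_coef_rec_cat chain_coef_rec_fall_cons //.
set e := (-1) ^+ _; have e0 : e != 0 by rewrite expf_neq0 // oppr_eq0 oner_eq0.
(* The last deletion has to remove the head: any other one would leave it marked. *)
rewrite (eq_chain_coef_rec (g' := unmark)).
  rewrite mulf_eq0 negb_or e0 /=; split.
    by move=> [/IH1].
  by move=> /IH2 + ne; rewrite /= ltn_add2l; apply; apply: contra_neq ne => ->.
move=> u'; rewrite luv last_fall => lu' /=.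
rewrite lu' eqxx mul1r delta0 ?mulr0 ?addr0 // => u''.
by rewrite /unmark /= mulr0.
Qed.

End MarkedCycles.

(** * Spaces of cycles *)

Section CycleSpaces.
Local Open Scope ring_scope.
Variables (F : fieldType) (A : finType).
Implicit Types (u v : seq (bool * A)) (ys c : seq (seq A)) (w y : seq A).
Implicit Types (h t : seq (bool * A) -> F) (z : seq (seq A) -> F) (b : seq bool).
Implicit Types (f : seq A -> F) (d : bool) (o : option A) (k m : nat).

Lemma sum_tupleS (T : finType) k (f : seq T -> F) :
  \sum_(u : k.+1.-tuple T) f u = \sum_x \sum_(u : k.-tuple T) f (x :: u).
Proof.
rewrite pair_big (reindex (fun p : T * k.-tuple T => [tuple of p.1 :: p.2])) //=.
exists (fun u : k.+1.-tuple T => (thead u, [tuple of behead u])) => [[x u]|u] _ /=.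
  by congr (_, _); apply: val_inj.
by rewrite [RHS]tuple_eta; apply: val_inj.
Qed.

Lemma sum_tuple0 (T : finType) (f : seq T -> F) : \sum_(u : 0.-tuple T) f u = f [::].
Proof.
rewrite (big_pred1 [tuple]) // => u; apply/esym/eqP/val_inj.
by rewrite (tuple0 u).
Qed.

(* For [d = false] no condition is imposed on the first letter. *)
Definition marked_sum0 d k t := forall u0 u1, (size u0 + size u1).+1 = k ->
  d || (u0 != [::]) -> \sum_a t (u0 ++ (true, a) :: u1) = 0.

Lemma marked_sum0_cons d d' k t x : marked_sum0 d k.+1 t -> marked_sum0 d' k (fun u => t (x :: u)).
Proof.
by move=> zt u0 u1 sz _; apply: (zt (x :: u0)); rewrite /= ?orbT // -sz.
Qed.

Lemma sum_marked (g : bool * A -> F) :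
  \sum_(x : bool * A) (if x.1 then g x else 0) = \sum_a g (true, a).
Proof.
transitivity (\sum_(x : bool * A) if x.1 then g (x.1, x.2) else 0).
  by apply: eq_bigr => -[].
rewrite -(pair_bigA _ (fun i j => if i then g (i, j) else 0)) /= big_bool /=.
by rewrite [X in _ + X]big1 ?addr0.
Qed.

Lemma sum_deltaS k t h :
  \sum_(u : k.+1.-tuple (bool * A)) t u * delta h u =
  \sum_(u : k.-tuple (bool * A)) (\sum_a t ((true, a) :: u)) * h u +
  \sum_(x : bool * A) (-1) ^+ x.1 *
    \sum_(u : k.-tuple (bool * A)) t (x :: u) * delta (fun u => h (x :: u)) u.
Proof.
rewrite (sum_tupleS _ (fun u => t u * delta h u)) /=.
under eq_bigr do under eq_bigr do rewrite mulrDr mulrCA.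
under eq_bigr do rewrite big_split /= -mulr_sumr.
rewrite big_split /=; congr (_ + _); rewrite exchange_big /=.
apply: eq_bigr => u _; rewrite mulr_suml -(sum_marked (fun x => t (x :: u) * h u)).
by apply: eq_bigr => x _; case: x.1; rewrite ?mulr0.
Qed.

(** Each term of [delta h] ignores the deleted letter, so the sum of [t] over that letter factors
    out. *)
Lemma sum_delta0 k t h : marked_sum0 true k t ->
  \sum_(u : k.-tuple (bool * A)) t u * delta h u = 0.
Proof.
elim: k t h => [|k IH] t h zt.
  by rewrite (sum_tuple0 (fun u => t u * delta h u)) /= mulr0.
rewrite sum_deltaS !big1 ?addr0 // => [x _|u _].
  by rewrite (IH (fun u => t (x :: u))) ?mulr0 //; apply: marked_sum0_cons zt.
by have /= -> := zt [::] u (congr1 S (size_tuple u)) isT; rewrite mul0r.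
Qed.

(** Only the deletion of the first letter survives, since [t] has zero sums at all the later
    marks. *)
Lemma sum_delta k t h : marked_sum0 false k.+1 t ->
  \sum_(u : k.+1.-tuple (bool * A)) t u * delta h u =
  \sum_(u : k.-tuple (bool * A)) (\sum_a t ((true, a) :: u)) * h u.
Proof.
move=> zt; rewrite sum_deltaS [X in _ + X]big1 ?addr0 // => x _.
by rewrite (@sum_delta0 k (fun u => t (x :: u))) ?mulr0 //; apply: marked_sum0_cons zt.
Qed.

Definition cycle_of k t c : F := \sum_(u : k.-tuple (bool * A)) t u * cycle_coef F c u.

(** The zero-sum conditions for one mask [b]. Here [o] is the letter before the word; a first
    position without predecessor is free. *)
Definition coord_sum0 o b f := forall w0 w1, (size w0 + size w1).+1 = size b ->
  nth false b (size w0) -> (o != None) || (w0 != [::]) ->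
  \sum_a f (w0 ++ a :: w1) = 0.

Lemma coord_sum0_cons o x b f a : coord_sum0 o (x :: b) f ->
  coord_sum0 (Some a) b (fun w => f (a :: w)).
Proof.
by move=> zf w0 w1 sz nb _; apply: (zf (a :: w0)); rewrite ?orbT //= -sz.
Qed.

(** At a marked position the good words miss only the letter equal to its predecessor, and the zero
    sum gives the value there from the values at the other letters. *)
Lemma coord_sum0_eq0 o b f : coord_sum0 o b f ->
  (forall w, size w = size b -> good_marking o (zip b w) -> f w = 0) ->
  forall w, size w = size b -> f w = 0.
Proof.
elim: b o f => [|x b IH] o f zf f0 [|a w] // => [_|[szw]]; first exact: f0.
have full_chain a' : x ==> (o != Some a') -> f (a' :: w) = 0.
  move=> xa'; apply: (IH _ _ (coord_sum0_cons (a := a') zf)) => // w' sz gw.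
  by apply: f0; rewrite /= ?sz ?xa'.
have [ga|] := boolP (x ==> (o != Some a)); first exact: full_chain.
rewrite negb_imply negbK => /andP[hx /eqP eo].
have := zf [::] w; rewrite /= hx eo szw => /(_ erefl isT isT).
rewrite (bigD1 a) //= big1 ?addr0 // => a' ne; apply: full_chain.
by rewrite eo; apply/implyP => _; apply: contra_neq ne => -[->].
Qed.

(* The function that coincides with [f] on the words for which [b] is a good
   marking and whose sums over the marked coordinates vanish. *)
Fixpoint extend o b f w : F :=
  match b, w with
  | x :: b', a :: w' =>
    if x && (o == Some a) then
      - \sum_(a' | a' != a) extend (Some a') b' (fun w => f (a' :: w)) w'
    else extend (Some a) b' (fun w => f (a :: w)) w'
  | _, _ => f w
  end.

Lemma extend_good o b f w : size w = size b -> good_marking o (zip b w) -> extend o b f w = f w.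
Proof.
elim: b o f w => [|x b IH] o f [|a w] //= [sz] /andP[gx gw].
by case: x gx => /= [/negbTE->|_]; apply: IH.
Qed.

Lemma coord_sum0_extend o b f : coord_sum0 o b (extend o b f).
Proof.
elim: b o f => [|x b IH] o f // [|a w0] w1 /= [sz].
  rewrite orbF => hx; case: o => // a _; rewrite (bigD1 a) //= hx eqxx /=.
  rewrite addrC; apply/eqP; rewrite subr_eq0; apply/eqP/eq_bigr => a' ne.
  by rewrite [Some a == _]eq_sym (inj_eq (@Some_inj _)) (negbTE ne).
move=> nb _; have zero a' g : \sum_a0 extend (Some a') b g (w0 ++ a0 :: w1) = 0.
  by apply: IH.
by case: (x && _); rewrite ?zero // sumrN exchange_big /= big1 ?oppr0.
Qed.

Lemma zip_marks v : zip (marks v) (letters v) = v.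
Proof. by elim: v => //= -[x a] v ->. Qed.

Lemma marked_coord_sum0 k t b : marked_sum0 false k t -> size b = k ->
  coord_sum0 None b (fun w => t (zip b w)).
Proof.
move=> zt sb w0 w1 sz nb /= n0.
have lt0 : (size w0 < size b)%N by lia.
have e1 : b = take (size w0) b ++ true :: drop (size w0).+1 b.
  by rewrite -[in LHS](cat_take_drop (size w0) b) (drop_nth false lt0) nb.
have := zt (zip (take (size w0) b) w0) (zip (drop (size w0).+1 b) w1).
rewrite !size_zip size_takel ?size_drop; last by lia.
rewrite minnn minnC -sz subSS addKn minnn sz sb => /(_ erefl) H.
rewrite -[RHS]H; last by case: (w0) n0 (b) lt0 => // ? ? _ [].
apply: eq_bigr => a _; congr (t _); rewrite {1}e1 zip_cat //.
by rewrite size_takel //; lia.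
Qed.

Lemma chain_coef_fall_self v : good_marking None v -> chain_coef F (fall v) v != 0.
Proof. by move=> gv; have [] := @chain_coef_fall F A None v v gv erefl; move/(_ erefl). Qed.

(** By [chain_coef_fall] the only marked words that reach this chain are [v] and words of smaller
    code, on which [t] vanishes. *)
Lemma cycle_of_fall k t v : size v = k -> good_marking None v ->
  (forall u, size u = k -> (code (marks u) < code (marks v))%N -> t u = 0) ->
  cycle_of k t (letters v :: fall v) = t v * chain_coef F (fall v) v.
Proof.
move=> szv gv t0; have szv' : size v == k by apply/eqP.
rewrite /cycle_of (bigD1 (Tuple szv')) //= eqxx mul1r big1 ?addr0 // => u ne.
have [luv|] := eqVneq (letters u) (letters v); last by rewrite mul0r mulr0.
have [_ lt] := @chain_coef_fall F A None u v gv luv; rewrite mul1r.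
have [->|k0] := eqVneq (chain_coef F (fall v) u) 0; first by rewrite mulr0.
by rewrite t0 ?mul0r ?size_tuple // lt.
Qed.

(** Induction on the code: once [t] vanishes on the smaller masks, the falling chains read off its
    values on the good words of the next mask, and these determine the others. *)
Lemma cycle_of_inj k t : marked_sum0 false k t ->
  (forall v, size v = k -> good_marking None v -> cycle_of k t (letters v :: fall v) = 0) ->
  forall u, size u = k -> t u = 0.
Proof.
move=> zt Phi0 u; have [n] := ubnP (code (marks u)).
elim: n u => // n IH u ltn szu.
rewrite -(zip_marks u); set b := marks u.
have sb : size b = k by rewrite /b size_map.
apply: (coord_sum0_eq0 (marked_coord_sum0 zt sb)) => [w sz gw|]; last by rewrite !size_map.
have mz : marks (zip b w) = b by rewrite /marks -/(unzip1 _) unzip1_zip // sz.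
have szz : size (zip b w) = k by rewrite size_zip sz minnn.
have := Phi0 _ szz gw; rewrite cycle_of_fall //.
  by move/eqP; rewrite mulf_eq0 (negbTE (chain_coef_fall_self gw)) orbF => /eqP.
move=> u' szu'; rewrite mz => ltu'; apply: IH => //.
by apply: leq_trans ltu' _; rewrite -ltnS.
Qed.

Definition chain k m c :=
  if c is w :: ys then [&& size w == k, size ys == m & path (@covers A) w ys]
  else false.

(* Chains are listed from the top down. For [d = true] the face opposite to the
   top word is taken into account too: these are the cycles of the intervals
   whose upper end is the artificial top element. *)
Record chain_cycle d k m z : Prop := Cycle {
  cycle_supp : forall c, z c != 0 -> chain k m c;
  cycle_fill : forall pre y post, d || (pre != [::]) ->
    \sum_(y' : (k - size pre).-tuple A) z (pre ++ val y' :: y :: post) = 0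
}.

Definition marks_supp m t := forall u, count id (marks u) != m -> t u = 0.

Lemma cycle_coef_chain k c u : size u = k -> cycle_coef F c u != 0 ->
  chain k (count id (marks u)) c.
Proof.
move=> szu; case: c => /= [|w ys]; first by rewrite eqxx.
case: (letters u =P w) => [<-|]; last by rewrite mul0r eqxx.
by rewrite mul1r size_letters szu eqxx => /chain_coef_supp/andP[-> ->].
Qed.

(** The sums over interior gaps vanish for each marked word separately; the sum over the top word
    relies on the zero sums of [t]. *)
Lemma cycle_of_chain_cycle d k m t : marks_supp m t -> marked_sum0 d k t ->
  chain_cycle d k m (cycle_of k t).
Proof.
move=> st zt; split=> [c|pre y post].
  apply: contraNT => nc; rewrite /cycle_of big1 // => u _.
  have [em|/st->] := eqVneq (count id (marks u)) m; last by rewrite mul0r.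
  have [->|/cycle_coef_chain] := eqVneq (cycle_coef F c u) 0; first by rewrite mulr0.
  by move/(_ _ (size_tuple u)); rewrite em (negbTE nc).
rewrite /cycle_of exchange_big /=; under eq_bigr do rewrite -mulr_sumr.
case: pre => [|w pre] dn.
  rewrite -[RHS](@sum_delta0 k t (fun u => (letters u == y)%:R * chain_coef F post u)).
    apply: eq_bigr => u _; congr (_ * _) => /=; rewrite subn0.
    rewrite (sum_eq_tuple _ _ (fun _ => chain_coef F (y :: post) u)).
    by rewrite size_letters size_tuple eqxx mul1r.
  by move: dn; rewrite orbF => dt; rewrite dt in zt.
rewrite big1 // => u _.
(* When the prefix is too long the subtraction is truncated, but then no chain has such a prefix. *)
have [le|gt] := leqP (size (w :: pre)) k.
  by rewrite cycle_coef_filler ?mulr0 // size_tuple subnKC.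
rewrite big1 ?mulr0 // => y' _; apply/eqP; apply: contraTT gt => c0.
have := cycle_coef_chain (size_tuple u) c0 => /and3P[/eqP szw _ py].
rewrite -leqNgt /= -szw; move: py; rewrite cat_path /= => /and4P[p1 c1 c2 _].
have := path_covers_size p1.
by case/andP: c1 => _ /eqP e <-; rewrite e addnS ltnS leq_addr.
Qed.

Lemma cycle_sub d k m z z' : chain_cycle d k m z -> chain_cycle d k m z' ->
  chain_cycle d k m (fun c => z c - z' c).
Proof.
move=> [s1 f1] [s2 f2]; split=> [c|pre y post dn].
  have [->|/s1 //] := eqVneq (z c) 0.
  by rewrite sub0r oppr_eq0 => /s2.
by rewrite sumrB f1 // f2 // subrr.
Qed.

Lemma cycleW d k m z : chain_cycle d k m z -> chain_cycle false k m z.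
Proof. by case=> s f; split=> // pre y post /= dn; apply: f; rewrite dn orbT. Qed.

(** The gap relations make the vanishing of [z] a fillable property: in a zero sum, if all terms but
    one vanish, so does the last. *)
Lemma cycle_eq0 k m z : chain_cycle false k m z ->
  (forall v, size v = k -> good_marking None v -> count id (marks v) = m ->
     z (letters v :: fall v) = 0) ->
  forall c, z c = 0.
Proof.
move=> [zs zf] z0 c; apply/eqP/negPn/negP => nz; move/zs: (nz).
case: c nz => // w ys nz /and3P[/eqP szw /eqP szy pw].
move/eqP: nz; apply.
apply: (@shelling_ind A m w (fun ys => z (w :: ys) = 0)) => // [pre y y1 post H|v lv gv cv].
  have [->//|nz] := eqVneq (z (w :: pre ++ y :: y1 :: post)) 0.
  have := zs _ nz => /and3P[_ _]; rewrite cat_path /= => /and4P[p1 c1 c2 _].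
  have sz : size (last w pre) = (k - size pre)%N.
    by have := path_covers_size p1; rewrite szw => <-; rewrite addKn.
  have szy1 : size y == (k - (size pre).+1)%N.
    by case/andP: c1 => _ /eqP; rewrite sz subnS => ->.
  have := zf (w :: pre) y1 post isT; rewrite (bigD1 (Tuple szy1)) //=.
  rewrite big1 ?addr0 // => y' ne; apply/eqP/negPn/negP => nz'.
  have := zs _ nz' => /and3P[_ _]; rewrite cat_path /= => /and4P[_ c1' c2' _].
  by rewrite H ?eqxx // in nz'.
by rewrite -lv; apply: z0 => //; rewrite -size_letters lv.
Qed.

(** Triangular elimination: the values on falling chains are cleared by increasing code, until
    [cycle_eq0] applies to the remainder. *)
Lemma cycle_of_surj k m z : chain_cycle false k m z ->
  exists t, [/\ marked_sum0 false k t, marks_supp m t & forall c, z c = cycle_of k t c].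
Proof.
(* Here [n] is the number of codes that remain to be cleared. *)
suff H n : chain_cycle false k m z ->
    (forall v, size v = k -> good_marking None v -> count id (marks v) = m ->
       (code (marks v) < 2 ^ k - n)%N -> z (letters v :: fall v) = 0) ->
    exists t, [/\ marked_sum0 false k t, marks_supp m t & forall c, z c = cycle_of k t c].
  by move=> cz; apply: (H (2 ^ k)%N) => // v _ _ _; rewrite subnn.
elim: n z => [|n IH] z cz z0.
  exists (fun=> 0); split=> [u0 u1 _ _||c]; rewrite ?big1 //.
  rewrite /cycle_of big1 => [|u _]; last by rewrite mul0r.
  apply: (cycle_eq0 cz) => v sv gv cv; apply: z0 => //.
  by rewrite subn0 -sv -(size_map fst) code_lt.
pose N := (2 ^ k - n.+1)%N.
(* Dividing by the diagonal coefficient gives the values needed on the good words of code [N];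
   [extend] then restores the zero sums. *)
pose sol b w := z (w :: fall (zip b w)) / chain_coef F (fall (zip b w)) (zip b w).
pose t0 u := if (count id (marks u) == m) && (code (marks u) == N)
  then extend None (marks u) (sol (marks u)) (letters u) else 0.
have zt0 : marked_sum0 false k t0.
  move=> u0 u1 sz n0; rewrite /t0.
  under eq_bigr do rewrite /marks /letters !map_cat /=.
  case: (_ && _); last by rewrite big1.
  apply: coord_sum0_extend.
  - by rewrite size_cat /= !size_map; lia.
  - by rewrite nth_cat !size_map ltnn subnn.
  - by case: (u0) n0.
have st0 : marks_supp m t0 by move=> u /negbTE e; rewrite /t0 e.
have cz' : chain_cycle false k m (fun c => z c - cycle_of k t0 c).
  by apply: cycle_sub cz (cycle_of_chain_cycle st0 zt0).
have [|t [zt st et]] := IH _ cz'.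
  move=> v sv gv cv ltv; rewrite cycle_of_fall //; last first.
    move=> u su ltu; rewrite /t0; case: eqP => //= _; case: eqP => // e; exfalso.
    by rewrite e /N in ltu; lia.
  rewrite {1}/t0 cv eqxx /=; case: eqP => [eN|neN]; last first.
    rewrite mul0r subr0; apply: z0 => //.
    by move: neN; rewrite /N; lia.
  rewrite extend_good ?size_map ?zip_marks // /sol zip_marks.
  by rewrite divfK ?subrr // chain_coef_fall_self.
exists (fun u => t u + t0 u); split=> [u0 u1 sz n0|u su|c].
- by rewrite big_split /= zt // zt0 // addr0.
- by rewrite st // st0 // addr0.
rewrite /cycle_of; under eq_bigr do rewrite mulrDl.
by rewrite big_split /= -/(cycle_of k t c) -/(cycle_of k t0 c) -et subrK.
Qed.

(** For [d = true] the condition on the first letter is still missing. The sums of [t] over a marked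
    first letter form a function on shorter marked words, whose cycle is the face of [z] opposite to
    the top word. This face is zero, so [cycle_of_inj] for words with one letter less makes the sums
    vanish. *)
Lemma cycle_of_surj_sum0 d k m z : chain_cycle d k m z ->
  exists t, [/\ marked_sum0 d k t, marks_supp m t & forall c, z c = cycle_of k t c].
Proof.
move=> cz; have [t [zt st et]] := cycle_of_surj (cycleW cz).
exists t; split=> //; case: d cz => // cz.
move=> [|x u0] u1 sz _; last exact: zt.
case: k => // k in cz zt et sz *; rewrite add0n in sz; case: sz => sz /=.
apply: (@cycle_of_inj k (fun u => \sum_a t ((true, a) :: u))) => //.
  move=> v0 v1 szv n0; rewrite exchange_big big1 //= => a _.
  by apply: (zt ((true, a) :: v0)); rewrite //= -szv.
move=> v szv _; rewrite /cycle_of -(sum_delta (fun u => cycle_coef F (letters v :: fall v) u)) //.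
have := cycle_fill cz (pre := [::]) (letters v) (fall v) isT.
rewrite /= subn0; under eq_bigr do rewrite et /cycle_of /=.
rewrite exchange_big /= => e; rewrite -[RHS]e; apply: eq_bigr => u _.
rewrite -mulr_sumr; congr (_ * _).
rewrite (sum_eq_tuple _ _ (fun _ => chain_coef F (letters v :: fall v) u)).
by rewrite size_letters size_tuple eqxx mul1r.
Qed.

End CycleSpaces.

(** * Representations as function spaces *)

Section LinearAlgebra.
Local Open Scope ring_scope.
Variable F : fieldType.

Lemma row_free_inj m n (M : 'M[F]_(m, n)) :
  (forall v : 'rV_m, v *m M = 0 -> v = 0) -> row_free M.
Proof.
move=> injM; rewrite -kermx_eq0; apply/eqP/row_matrixP => i.
rewrite row0; apply: injM; apply/sub_kermxP; exact: row_sub.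
Qed.

Lemma row_free_eq0 m n (M : 'M[F]_(m, n)) (v : 'rV_m) :
  row_free M -> v *m M = 0 -> v = 0.
Proof. by move=> fM /eqP; rewrite mulmx_free_eq0 // => /eqP. Qed.

Lemma linear_mx m n (f : 'rV[F]_m -> 'rV[F]_n) :
  (forall a u v, f (a *: u + v) = a *: f u + f v) ->
  exists M : 'M_(m, n), forall v, v *m M = f v.
Proof.
move=> linf; pose fl : {linear 'rV[F]_m -> 'rV[F]_n} :=
  HB.pack f (GRing.isLinear.Build F _ _ _ f linf).
by exists (lin1_mx fl) => v; rewrite mul_rV_lin1.
Qed.

(* A variant of [mxvec] that follows the recursion of [tprod]. *)
Fixpoint tvec m n : 'M[F]_(m, n) -> 'rV[F]_(m * n) :=
  if m is m'.+1 return 'M[F]_(m, n) -> 'rV[F]_(m * n) then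
    fun C : 'M_(1 + m', n) => row_mx (usubmx C) (tvec (dsubmx C))
  else fun=> 0.

Fixpoint tunvec m n : 'rV[F]_(m * n) -> 'M[F]_(m, n) :=
  if m is m'.+1 return 'rV[F]_(m * n) -> 'M[F]_(m, n) then
    fun v : 'rV_(n + m' * n) => col_mx (lsubmx v) (tunvec (rsubmx v))
  else fun=> 0.

Lemma tvecK m n : cancel (@tvec m n) (@tunvec m n).
Proof.
elim: m => [|m IH] C; first by rewrite [LHS]flatmx0 [RHS]flatmx0.
by rewrite /= row_mxKl row_mxKr IH (@vsubmxK _ 1 m).
Qed.

Lemma tunvecK m n : cancel (@tunvec m n) (@tvec m n).
Proof.
elim: m => [|m IH] v; first by rewrite [LHS]thinmx0 [RHS]thinmx0.
by rewrite /= (@col_mxKu _ 1 m) (@col_mxKd _ 1 m) IH (@hsubmxK _ _ n (m * n)).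
Qed.

Lemma tvec_lin m n a (C D : 'M[F]_(m, n)) :
  tvec (a *: C + D) = a *: tvec C + tvec D.
Proof.
elim: m C D => [|m IH] C D /=; first by rewrite scaler0 addr0.
by rewrite !linearP /= IH scale_row_mx add_row_mx.
Qed.

Lemma tvecD m n (C D : 'M[F]_(m, n)) : tvec (C + D) = tvec C + tvec D.
Proof. by have := tvec_lin 1 C D; rewrite !scale1r. Qed.

Lemma tvec0 m n : tvec (0 : 'M[F]_(m, n)) = 0.
Proof. by apply: (addrI (tvec 0)); rewrite -tvecD !addr0. Qed.

Lemma tunvec_lin m n a (u v : 'rV[F]_(m * n)) :
  tunvec (a *: u + v) = a *: tunvec u + tunvec v.
Proof. by apply: (can_inj (@tvecK m n)); rewrite tvec_lin !tunvecK. Qed.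

Lemma mul_trow n1 m2 n2 (c : 'rV[F]_m2) (a : 'rV_n1) (B : 'M_(m2, n2)) :
  c *m trow a B = tvec (a^T *m c *m B).
Proof.
elim: n1 a => [|n1 IH] a /=; first by rewrite mulmx0.
rewrite mul_mx_row IH -scalemxAr; congr row_mx.
  rewrite !usumx_mul -(@trmx_lsub _ 1 1 n1) -mulmxA.
  by rewrite [in RHS](mx11_scalar (@lsubmx _ 1 1 n1 a)) tr_scalar_mx mul_scalar_mx.
by rewrite !dsumx_mul -(@trmx_rsub _ 1 1 n1).
Qed.

Lemma tvec_tprod m1 m2 n1 n2 (C : 'M[F]_(m1, m2)) (A : 'M_(m1, n1))
    (B : 'M_(m2, n2)) :
  tvec C *m tprod A B = tvec (A^T *m C *m B).
Proof.
elim: m1 C A => [|m1 IH] C A.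
  by rewrite [LHS]mul0mx [C]flatmx0 mulmx0 mul0mx tvec0.
rewrite /= (@mul_row_col _ 1 m2 (m1 * m2)) IH mul_trow.
rewrite -tvecD -mulmxDl; congr (tvec (_ *m _)).
rewrite -[in RHS](@vsubmxK _ 1 m1 _ C) -[in RHS](@vsubmxK _ 1 m1 _ A).
by rewrite (@tr_col_mx _ 1 m1) (@mul_row_col _ n1 1 m1).
Qed.

Definition rvfun (T : finType) (v : 'rV[F]_#|T|) : {ffun T -> F} :=
  [ffun t => v 0 (enum_rank t)].

Definition funrv (T : finType) (z : {ffun T -> F}) : 'rV[F]_#|T| :=
  \row_j z (enum_val j).

Lemma rvfunK (T : finType) : cancel (@rvfun T) (@funrv T).
Proof. by move=> v; apply/rowP => j; rewrite mxE ffunE enum_valK. Qed.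

Lemma funrvK (T : finType) : cancel (@funrv T) (@rvfun T).
Proof. by move=> z; apply/ffunP => t; rewrite ffunE mxE enum_rankK. Qed.

Lemma rvfunD (T : finType) (u v : 'rV_#|T|) : rvfun (u + v) = rvfun u + rvfun v.
Proof. by apply/ffunP => t; rewrite !ffunE mxE. Qed.

Lemma rvfun0 (T : finType) : rvfun (0 : 'rV_#|T|) = 0.
Proof. by apply/ffunP => t; rewrite !ffunE mxE. Qed.

Lemma rvfunZ (T : finType) a (v : 'rV_#|T|) t : rvfun (a *: v) t = a * rvfun v t.
Proof. by rewrite !ffunE mxE. Qed.

End LinearAlgebra.

Section Models.
Local Open Scope ring_scope.
Variables (F : fieldType) (gT : finGroupType).
Notation rep := (representation F [set: gT]).

(* [rG] is isomorphic to the space of the functions on the [gT]-set [T] that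
   satisfy [P], with [gT] acting by translation. *)
Definition model (T : finType) (s : gT -> T -> T) (rG : rep)
    (P : {ffun T -> F} -> Prop) :=
  exists M : 'M_(rdegree rG, #|T|),
  [/\ row_free M,
      forall g v t, rvfun (v *m rG g *m M) (s g t) = rvfun (v *m M) t
    & forall z, P z <-> exists v, z = rvfun (v *m M)].

Lemma model_lin (T : finType) (s : gT -> T -> T) (rG : rep) P
    (f : 'rV[F]_(rdegree rG) -> {ffun T -> F}) :
  (forall a u v t, f (a *: u + v) t = a * f u t + f v t) ->
  (forall v, f v = 0 -> v = 0) ->
  (forall g v t, f (v *m rG g) (s g t) = f v t) ->
  (forall z, P z <-> exists v, z = f v) ->
  model s rG P.
Proof.
move=> linf injf eqf imf.
have [|M eM] := @linear_mx F _ _ (fun v => funrv (f v)).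
  by move=> a u v; apply/rowP => j; rewrite !mxE linf.
have fM v : rvfun (v *m M) = f v by rewrite eM funrvK.
exists M; split=> [|g v t|z]; first 2 last.
- rewrite imf; split=> -[v ->]; exists v; by rewrite fM.
- by apply: row_free_inj => v vM0; apply: injf; rewrite -fM vM0 rvfun0.
by rewrite !fM eqf.
Qed.

Lemma model_ext (T : finType) (s : gT -> T -> T) rG (P P' : {ffun T -> F} -> Prop) :
  model s rG P -> (forall z, P z <-> P' z) -> model s rG P'.
Proof.
by move=> [M [fM eM imM]] PP'; exists M; split=> // z; rewrite -PP'.
Qed.

(** Both matrices have the row space cut out by [P], so a change of basis relates them; it commutes
    with the group because both actions become the same translation. *)
Lemma model_rsim (T : finType) (s : gT -> T -> T) r1 r2 (P : {ffun T -> F} -> Prop) :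
  (forall g, bijective (s g)) -> model s r1 P -> model s r2 P -> mx_rsim r1 r2.
Proof.
move=> bij_s [M1 [fM1 eM1 imM1]] [M2 [fM2 eM2 imM2]].
have le d1 d2 (N1 : 'M[F]_(d1, #|T|)) (N2 : 'M_(d2, #|T|)) :
    (forall z, P z <-> exists v, z = rvfun (v *m N1)) ->
    (forall z, P z <-> exists v, z = rvfun (v *m N2)) -> (N1 <= N2)%MS.
  move=> im1 im2; apply/rV_subP => u /submxP[v ->].
  have /im2[v' e] : P (rvfun (v *m N1)) by apply/im1; exists v.
  by rewrite (can_inj (@rvfunK F T) e) submxMl.
have le12 : (M1 <= M2)%MS by apply: le.
have le21 : (M2 <= M1)%MS by apply: le.
have eqM : \rank M1 = \rank M2 by apply/eqP; rewrite eqn_leq !mxrankS.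
have KM := mulmxKpV le12.
exists (M1 *m pinvmx M2).
- by rewrite -(eqP fM1) eqM (eqP fM2).
- apply: row_free_inj => v v0; apply: (row_free_eq0 fM1).
  by rewrite -KM mulmxA v0 mul0mx.
set B := M1 *m pinvmx M2 in KM *.
move=> g _; apply/row_matrixP => i; rewrite !rowE.
apply/eqP; rewrite -subr_eq0; apply/eqP/(row_free_eq0 fM2).
rewrite mulmxBl; apply/eqP; rewrite subr_eq0; apply/eqP.
apply: (can_inj (@rvfunK F T)); apply/ffunP => t'; have [s' _ sK] := bij_s g.
rewrite -(sK t') mulmxA -(mulmxA _ B) KM eM1.
by rewrite (mulmxA _ B) eM2 -(mulmxA _ B) KM.
Qed.

Lemma model_dadd (T : finType) (s : gT -> T -> T) (r1 r2 : rep) P1 P2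
    (P : {ffun T -> F} -> Prop) :
  model s r1 P1 -> model s r2 P2 ->
  (forall z, P z <-> exists z1 z2, [/\ P1 z1, P2 z2 & z = z1 + z2]) ->
  (forall z, P1 z -> P2 (- z) -> z = 0) ->
  model s (dadd_grepr r1 r2) P.
Proof.
move=> [M1 [fM1 eM1 imM1]] [M2 [fM2 eM2 imM2]] P12 dis.
have eM v : v *m col_mx M1 M2 = lsubmx v *m M1 + rsubmx v *m M2.
  by rewrite -{1}(hsubmxK v) mul_row_col.
exists (col_mx M1 M2); split=> [|g v t|z].
- apply: row_free_inj => v; rewrite eM => v0.
  have v1 : lsubmx v *m M1 = 0.
    apply: (can_inj (@rvfunK F T)); rewrite rvfun0; apply: dis.
      by apply/imM1; exists (lsubmx v).
    apply/imM2; exists (rsubmx v); rewrite -[RHS](addKr (rvfun (lsubmx v *m M1))).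
    by rewrite -rvfunD v0 rvfun0 addr0.
  move: v0; rewrite v1 add0r => v2; rewrite -(hsubmxK v).
  by rewrite (row_free_eq0 fM1 v1) (row_free_eq0 fM2 v2) row_mx0.
- rewrite !eM !rvfunD !ffunE /=.
  have -> : v *m block_mx (r1 g) 0 0 (r2 g) =
      row_mx (lsubmx v *m r1 g) (rsubmx v *m r2 g).
    by rewrite -{1}(hsubmxK v) mul_row_block !mulmx0 addr0 add0r.
  rewrite row_mxKl row_mxKr; congr (_ + _).
    by have := eM1 g (lsubmx v) t; rewrite !ffunE.
  by have := eM2 g (rsubmx v) t; rewrite !ffunE.
rewrite P12; split=> [[z1 [z2 [/imM1[v1 ->] /imM2[v2 ->] ->]]]|[v ->]].
  by exists (row_mx v1 v2); rewrite eM row_mxKl row_mxKr rvfunD.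
exists (rvfun (lsubmx v *m M1)), (rvfun (rsubmx v *m M2)); rewrite eM rvfunD.
split=> //; first by apply/imM1; exists (lsubmx v).
by apply/imM2; exists (rsubmx v).
Qed.

Lemma model_grepr0 (T : finType) (s : gT -> T -> T) (P : {ffun T -> F} -> Prop) :
  (forall z, P z <-> z = 0) -> model s grepr0 P.
Proof.
move=> P0; exists 0; split=> [|g v t|z].
- by apply: row_free_inj => v _; apply: thinmx0.
- by rewrite !mulmx0 !rvfun0 !ffunE.
rewrite P0; split=> [->|[v ->]]; last by rewrite mulmx0 rvfun0.
by exists 0; rewrite mulmx0 rvfun0.
Qed.

Definition push (T T' : finType) (K : T -> T' -> F) (z : {ffun T -> F}) :
    {ffun T' -> F} :=
  [ffun t' => \sum_t z t * K t t'].

Lemma model_push (T T' : finType) (s : gT -> T -> T) (s' : gT -> T' -> T') (rG : rep)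
    P (P' : {ffun T' -> F} -> Prop) (K : T -> T' -> F) :
  (forall g, bijective (s g)) ->
  model s rG P ->
  (forall g t t', K (s g t) (s' g t') = K t t') ->
  (forall z, P z -> push K z = 0 -> z = 0) ->
  (forall z', P' z' <-> exists z, P z /\ z' = push K z) ->
  model s' rG P'.
Proof.
move=> bij_s [M [fM eM imM]] eK injK imK.
apply: (@model_lin _ _ _ _ (fun v => push K (rvfun (v *m M)))).
- move=> a u v t; rewrite !ffunE mulr_sumr -big_split /=; apply: eq_bigr => t' _.
  by rewrite mulmxDl -scalemxAl rvfunD ffunE rvfunZ mulrDl mulrA.
- move=> v v0; apply: (row_free_eq0 fM); apply: (can_inj (@rvfunK F T)).
  by rewrite rvfun0; apply: injK v0; apply/imM; exists v.
- move=> g v t; rewrite !ffunE; have [s'' sK1 sK2] := bij_s g.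
  rewrite (reindex (s g)); last by apply: onW_bij; exists s''.
  by apply: eq_bigr => t' _; rewrite eK eM.
move=> z'; rewrite imK; split=> [[z [/imM[v ->] ->]]|[v ->]]; first by exists v.
by exists (rvfun (v *m M)); split=> //; apply/imM; exists v.
Qed.

(** A function on a product is a matrix. Its columns lie in the first space and its rows in the
    second exactly when it has the form [M1^T *m D *m M2], and such matrices [D] are the elements of
    the tensor product. *)
Lemma model_tensor (T1 T2 T : finType) (s1 : gT -> T1 -> T1) (s2 : gT -> T2 -> T2)
    (s : gT -> T -> T) (r1 r2 : rep) P1 P2 (P : {ffun T -> F} -> Prop)
    (p : T1 -> T2 -> T) (p1 : T -> T1) (p2 : T -> T2) :
  (forall t1 t2, p1 (p t1 t2) = t1) -> (forall t1 t2, p2 (p t1 t2) = t2) ->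
  (forall t, p (p1 t) (p2 t) = t) ->
  (forall g t1 t2, s g (p t1 t2) = p (s1 g t1) (s2 g t2)) ->
  model s1 r1 P1 -> model s2 r2 P2 ->
  (forall z, P z <-> (forall t2, P1 [ffun t1 => z (p t1 t2)]) /\
                     (forall t1, P2 [ffun t2 => z (p t1 t2)])) ->
  model s (tensor r1 r2) P.
Proof.
move=> p1K p2K pK sp [M1 [fM1 eM1 imM1]] [M2 [fM2 eM2 imM2]] P12.
pose W (v : 'rV[F]_(rdegree r1 * rdegree r2)) := M1^T *m tunvec v *m M2.
pose ev (N : 'M[F]_(#|T1|, #|T2|)) t := N (enum_rank (p1 t)) (enum_rank (p2 t)).
have fM2' := mulmxVp fM2; have fM1' := mulmxVp fM1.
have sM1 g t1 : col (enum_rank (s1 g t1)) (r1 g *m M1) = col (enum_rank t1) M1.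
  apply/matrixP => i j; rewrite ord1 {j} !mxE.
  have := eM1 g (delta_mx 0 i) t1; rewrite !ffunE -mulmxA -!rowE !mxE.
  by [].
have sM2 g t2 : col (enum_rank (s2 g t2)) (r2 g *m M2) = col (enum_rank t2) M2.
  apply/matrixP => i j; rewrite ord1 {j} !mxE.
  have := eM2 g (delta_mx 0 i) t2; rewrite !ffunE -mulmxA -!rowE !mxE.
  by [].
have entry m1 m2 (B1 : 'M[F]_(m1, #|T1|)) (C : 'M_(m1, m2)) (B2 : 'M_(m2, #|T2|)) i j :
    (B1^T *m C *m B2) i j = ((col i B1)^T *m C *m col j B2) 0 0.
  rewrite !colE trmx_mul trmx_delta !mulmxA -!(mulmxA (delta_mx 0 i)) -colE -rowE.
  by rewrite [RHS]mxE [RHS]mxE ?mulmxA.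
have Wlin a u v : W (a *: u + v) = a *: W u + W v.
  by rewrite /W tunvec_lin mulmxDr mulmxDl -scalemxAr -scalemxAl.
have pbij z z' : (forall t1 t2, z (p t1 t2) = z' (p t1 t2) :> F) -> forall t, z t = z' t.
  by move=> e t; rewrite -(pK t).
apply: (@model_lin _ _ (tensor r1 r2) _ (fun v => [ffun t => ev (W v) t])).
- by move=> a u v t; rewrite !ffunE /ev Wlin !mxE.
- move=> v v0; have W0 : W v = 0.
    apply/matrixP => i j; rewrite [RHS]mxE -(enum_valK i) -(enum_valK j).
    have /ffunP/(_ (p (enum_val i) (enum_val j))) := v0.
    by rewrite !ffunE /ev p1K p2K.
  rewrite -(tunvecK v); suff -> : tunvec v = 0 by apply: tvec0.
  apply/eqP; rewrite -trmx_eq0 -(mulmx_free_eq0 _ fM1) -trmx_eq0 trmx_mul trmxK.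
  by rewrite -(mulmx_free_eq0 _ fM2) -/(W v) W0.
- move=> g v t; rewrite !ffunE /ev -[in s g t](pK t) sp p1K p2K /W.
  rewrite -{1}(tunvecK v) /= tvec_tprod tvecK.
  have -> : M1^T *m ((r1 g)^T *m tunvec v *m r2 g) *m M2 =
      (r1 g *m M1)^T *m tunvec v *m (r2 g *m M2) by rewrite trmx_mul !mulmxA.
  by rewrite entry [RHS]entry sM1 sM2.
move=> z; rewrite P12; split=> [[z1 z2]|[v ->]].
  pose Z : 'M_(#|T1|, #|T2|) := \matrix_(i, j) z (p (enum_val i) (enum_val j)).
  have Z2 : (Z <= M2)%MS.
    apply/row_subP => i; have /imM2[v /ffunP e] := z2 (enum_val i).
    apply/submxP; exists v; apply/rowP => j; have := e (enum_val j).
    by rewrite !ffunE enum_valK !mxE => ->.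
  have Z1 : (Z^T <= M1)%MS.
    apply/row_subP => i; have /imM1[v /ffunP e] := z1 (enum_val i).
    apply/submxP; exists v; apply/rowP => j; have := e (enum_val j).
    by rewrite !ffunE enum_valK !mxE => ->.
  pose D := (pinvmx M1)^T *m Z *m pinvmx M2.
  have eZ : M1^T *m D *m M2 = Z.
    rewrite /D; move: (pinvmx M1) (pinvmx M2) (mulmxKpV Z1) (mulmxKpV Z2).
    move=> Q1 Q2 e1 e2; rewrite -!mulmxA (mulmxA Z) e2 mulmxA -trmx_mul.
    by apply: trmx_inj; rewrite [LHS]trmx_mul trmxK mulmxA e1.
  exists (tvec D); apply/ffunP => t; rewrite ffunE /ev /W tvecK eZ mxE.
  by rewrite !enum_rankK pK.
split=> [t2|t1].
  apply/imM1; exists (col (enum_rank t2) (tunvec v *m M2))^T.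
  apply/ffunP => t1; rewrite !ffunE /ev p1K p2K /W -mulmxA.
  have -> (X : 'M_(_, #|T2|)) j : (col j X)^T *m M1 = (col j (M1^T *m X))^T.
    by rewrite !colE -mulmxA [RHS]trmx_mul trmxK.
  by rewrite [RHS]mxE [RHS]mxE.
apply/imM2; exists (row (enum_rank t1) (M1^T *m tunvec v)).
apply/ffunP => t2; rewrite !ffunE /ev p1K p2K /W.
by rewrite -row_mul [RHS]mxE.
Qed.
End Models.

(** * Homology sums without boundaries *)

Section HomSumModel.
Local Open Scope ring_scope.
Variables (F : fieldType) (d : Order.disp_t) (P : finPOrderType d).
Variables (gT : finGroupType) (to : {action gT &-> P}).
Hypothesis to_mono : forall g, {mono to^~ g : x y / (x <= y)%O}.
Variables (S : {set P}) (Q : P -> {set P}) (i : nat).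
Hypothesis S_act : forall g, {in S, forall x, to x g \in S}.
Hypothesis Q_act : forall g,
  {in S, forall x, {in Q x, forall y, to y g \in Q (to x g)}}.
Hypothesis bound0 : {in S, forall x, boundaries F i (Q x) = 0}.

Notation point := (P * i.-1.-tuple P)%type.

Definition chain_act (g : gT) (c : point) : point :=
  (to c.1 g, tuple_action to i.-1 c.2 g).

Lemma chain_act_bij g : bijective (chain_act g).
Proof.
exists (chain_act g^-1%g) => -[x t]; rewrite /chain_act ![(_, _).1]/= ![(_, _).2]/=.
  by rewrite !actK.
by rewrite !actKV.
Qed.

Definition slice (z : {ffun point -> F}) x : 'rV[F]_#|{: i.-1.-tuple P}| :=
  funrv [ffun t => z (x, t)].

Definition cycle_fun (z : {ffun point -> F}) :=
  (forall x, x \notin S -> slice z x = 0) /\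
  {in S, forall x, (slice z x <= cycles F i (Q x))%MS}.

Lemma rvfun_perm_module (T : finType) (toT : {action gT &-> T}) (u : 'rV_#|T|) g t :
  rvfun (u *m perm_module F toT g) (toT t g) = rvfun u t.
Proof.
rewrite !ffunE mxE (bigD1 (enum_rank t)) //= big1 ?addr0 => [|j ne].
  by rewrite mxE enum_rankK /basis_vec mxE !eqxx mulr1.
rewrite mxE /basis_vec mxE eqxx (inj_eq enum_rank_inj) (inj_eq (act_inj toT g)).
have [e|_] := eqVneq t (enum_val j); last by rewrite mulr0.
by rewrite e enum_valK eqxx in ne.
Qed.

(** Since there are no boundaries, each class has a unique representing cycle, and the cycles over
    all [x] in [S] are glued into one function of the pairs [(x, t)]. *)
Lemma hom_sum_model :
  model chain_act (hom_sum F to_mono i S_act Q_act) cycle_fun.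
Proof.
pose lift (j : 'I_#|S|) (w : 'rV_(hom_dim F i (Q (enum_val j)))) := hom_lift w.
have liftK (j : 'I_#|S|) (u : 'rV_#|{: i.-1.-tuple P}|) :
    (u <= cycles F i (Q (enum_val j)))%MS -> lift j (hom_class _ u) = u.
  move=> su; apply/eqP; rewrite eq_sym -subr_eq0 -submx0.
  rewrite -(bound0 (enum_valP j)); apply: hom_classK.
  by apply: submx_trans su (addsmxSr _ _).
have lift_cyc (j : 'I_#|S|) w : (lift j w <= cycles F i (Q (enum_val j)))%MS.
  apply: submx_trans (hom_lift_sub w) _.
  by rewrite (bound0 (enum_valP j)) adds0mx_id.
pose f (v : 'rV_(\sum_(j < #|S|) hom_dim F i (Q (enum_val j)))) : {ffun point -> F} :=
  [ffun c : point => \sum_(j < #|S|)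
     if c.1 == enum_val j then rvfun (lift j (submxrow v j)) c.2 else 0].
have fE v j t : f v (enum_val j, t) = rvfun (lift j (submxrow v j)) t.
  rewrite ffunE (bigD1 j) //= eqxx big1 ?addr0 // => l ne.
  by rewrite (inj_eq enum_val_inj) eq_sym (negbTE ne).
have fN v x t : x \notin S -> f v (x, t) = 0.
  move=> nS; rewrite ffunE big1 // => j _; case: eqP => //= e.
  by rewrite e enum_valP in nS.
have slice_f v j : slice (f v) (enum_val j) = lift j (submxrow v j).
  apply: (can_inj (@rvfunK F _)); rewrite funrvK; apply/ffunP => t.
  by rewrite ffunE fE.
apply: (@model_lin _ _ _ _ (hom_sum F to_mono i S_act Q_act) _ f).
- move=> a u v [x t]; have [Sx|nS] := boolP (x \in S); last by rewrite !fN // mulr0 addr0.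
  rewrite -(enum_rankK_in Sx Sx) !fE /lift.
  have -> j : submxrow (a *: u + v) j = a *: submxrow u j + submxrow v j.
    by apply/matrixP => k l; rewrite !mxE.
  rewrite hom_liftE mulmxDl -scalemxAl -!hom_liftE rvfunD ffunE rvfunZ.
  by [].
- move=> v v0; apply/mxrowP => j; rewrite submxrow0.
  rewrite -[LHS]hom_liftK -/(lift j _) -slice_f v0.
  rewrite [slice _ _](_ : _ = 0) ?hom_class0 ?sub0mx //.
  by apply/rowP => l; rewrite !mxE !ffunE.
- move=> g v [x t]; have [Sx|nS] := boolP (x \in S); last first.
    rewrite !fN //; apply: contra nS => /(S_act g^-1%g); by rewrite actK.
  have Sxg := S_act g Sx; rewrite /chain_act /=.
  set j := enum_rank_in Sx x; set l := enum_rank_in Sxg (to x g).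
  have ej : enum_val j = x by rewrite enum_rankK_in.
  have el : enum_val l = to x g by rewrite enum_rankK_in.
  have el' : enum_val l = to (enum_val j) g by rewrite ej.
  rewrite -el -[in RHS]ej !fE.
  have -> : submxrow (v *m hom_sum_mx F to S Q i g) l =
      submxrow v j *m hom_map F to i (Q (enum_val j)) (Q (enum_val l)) g.
    rewrite -{1}(submxrowK v) mul_mxrow_mxblock mxrowK (bigD1 j) //= el' eqxx.
    rewrite big1 ?addr0 // => j' ne; case: eqP => [e|]; last by rewrite mulmx0.
    by case/eqP: ne; apply/enum_val_inj/(act_inj to g); rewrite -e.
  rewrite /hom_map -hom_classM mulmxA -hom_liftE liftK; last first.
    apply: submx_trans (submxMr _ (lift_cyc j _)) _.
    by apply: cycles_act => //; rewrite el'; apply: Q_act; apply: enum_valP.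
  by rewrite rvfun_perm_module.
move=> z; split=> [[z0 zc]|[v ->]].
  exists (\mxrow_j hom_class (Q (enum_val j)) (slice z (enum_val j))).
  apply/ffunP => -[x t]; have [Sx|nS] := boolP (x \in S); last first.
    rewrite fN //; have /rowP/(_ (enum_rank t)) := z0 x nS.
    by rewrite !mxE ffunE enum_rankK.
  rewrite -(enum_rankK_in Sx Sx) fE mxrowK liftK; last by apply: zc; apply: enum_valP.
  by rewrite funrvK ffunE.
split=> [x nS|x Sx].
  by apply/rowP => j; rewrite !mxE ffunE fN.
by rewrite -(enum_rankK_in Sx Sx) slice_f.
Qed.

End HomSumModel.

(** * Standard and trivial modules *)

Section SpechtModels.
Local Open Scope ring_scope.
Variables (F : fieldType) (A : finType).
Notation rep := (representation F [set: {perm A}]).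

Definition letter_act (g : {perm A}) (a : A) := g a.

Section Standard.
Variable m : nat.
Hypothesis cardA : #|A| = m.+2.
Let la := [:: m.+1; 1%N].
Notation tabloid := {ffun A -> 'I_(size la)}.
Notation filling := {ffun A -> 'I_(size la) * 'I_(head 0%N la)}.

(** The tabloid with [a] alone in the second row: it stands for the letter [a]. *)
Definition tab (a : A) : tabloid := [ffun b => if b == a then 1 else 0].

Lemma tab_inj : injective tab.
Proof.
move=> a b /ffunP/(_ a); rewrite !ffunE eqxx; case: eqP => // _ /eqP.
Qed.

(** Only the first column has two cells, so the column stabiliser consists of the identity and the
    transposition of their entries. *)
Lemma polytabloid_std (t : filling) a0 b :
  is_tableau t -> t a0 = (0, 0) -> t b = (1, 0) ->
  polytabloid F t = basis_vec F (tab b) - basis_vec F (tab a0).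
Proof.
move=> /andP[/injectiveP injt /forallP imt] ta0 tb.
have row0 a : a != b -> (t a).1 = 0.
  move=> ne; have := imt (t a); rewrite codom_f => /esym.
  case et: (t a) => [[[|[|r]] lr] [c lc]] //= ltc; first by apply: val_inj.
  case/eqP: ne; apply: injt; rewrite tb et.
  by congr (_, _); apply: val_inj => //=; case: c lc et ltc.
have ab : a0 != b by apply: contra_eqN ta0 => /eqP->; rewrite tb.
rewrite /polytabloid (bigD1 1%g) /=; last by apply/forallP => a; rewrite perm1.
rewrite (bigD1 (tperm a0 b)) /=; last first.
  apply/andP; split; last first.
    by apply: contra_neq ab => e; rewrite -[RHS](tpermL a0 b) e perm1.
  apply/forallP => a; case: tpermP => [->|->|//]; by rewrite ta0 tb.
rewrite big1 ?addr0 => [|s /andP[/andP[/forallP hs s1] sT]].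
  rewrite odd_perm1 odd_tperm ab expr0 expr1 scale1r scaleN1r.
  congr (basis_vec F _ - basis_vec F _); apply/ffunP => a; rewrite !ffunE.
    rewrite perm1; have [->|/row0->//] := eqVneq a b; by rewrite tb.
  case: tpermP => [->|->|/eqP na0 /eqP nb]; first by rewrite eqxx tb.
    by rewrite ta0 eq_sym (negbTE ab).
  by rewrite (negbTE na0) row0.
exfalso.
(* Outside the first column a letter is determined by its column, which [s] preserves. *)
have fix_other a : a != a0 -> a != b -> s a = a.
  move=> na0 nb; have /eqP e := hs a.
  have nsb : s a != b.
    apply: contra_neq na0 => sab; apply: injt; rewrite ta0.
    by rewrite [t a]surjective_pairing row0 // -e sab tb.
  apply: injt; rewrite [LHS]surjective_pairing [RHS]surjective_pairing e.
  by rewrite !row0.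
have sa0 : s a0 \in [:: a0; b].
  apply: contraT; rewrite !inE negb_or => /andP[n1 n2].
  by have /perm_inj e := fix_other _ n1 n2; rewrite e eqxx in n1.
have sb : s b \in [:: a0; b].
  apply: contraT; rewrite !inE negb_or => /andP[n1 n2].
  by have /perm_inj e := fix_other _ n1 n2; rewrite e eqxx in n2.
move: sa0; rewrite !inE => /orP[]/eqP sa0.
  move: sb; rewrite !inE => /orP[]/eqP sb.
    by move: ab; rewrite -(inj_eq (@perm_inj _ s)) sa0 sb eqxx.
  case/eqP: s1; apply/permP => a; rewrite perm1.
  have [->//|n1] := eqVneq a a0; have [->//|n2] := eqVneq a b.
  exact: fix_other.
move: sb; rewrite !inE => /orP[]/eqP sb; last first.
  by move: ab; rewrite -(inj_eq (@perm_inj _ s)) sa0 sb eqxx.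
case/eqP: sT; apply/permP => a.
case: tpermP => [->|->|/eqP n1 /eqP n2] //; exact: fix_other.
Qed.

Lemma tableau_cells (t : filling) : is_tableau t ->
  exists a0 b, t a0 = (0, 0) /\ t b = (1, 0).
Proof.
move=> /andP[_ /forallP imt].
have /codomP[a0 e0] : ((0, 0) : 'I_(size la) * 'I_(head 0%N la)) \in codom t.
  by rewrite (eqP (imt _)).
have /codomP[b e1] : ((1, 0) : 'I_(size la) * 'I_(head 0%N la)) \in codom t.
  by rewrite (eqP (imt _)).
by exists a0, b.
Qed.

Lemma exists_tableau a0 b : a0 != b ->
  exists t : filling, [/\ is_tableau t, t a0 = (0, 0) & t b = (1, 0)].
Proof.
move=> ab; pose s := a0 :: [seq a <- enum A | (a != b) && (a != a0)].
have us : uniq s.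
  by rewrite /= mem_filter eqxx andbF filter_uniq // enum_uniq.
have mem_s a : (a \in s) = (a != b).
  rewrite inE mem_filter mem_enum andbT.
  by have [->|] := eqVneq a a0; rewrite ?ab ?andbT.
have sz : size s = m.+1.
  rewrite -(card_uniqP us) (eq_card (B := predC1 b)) //.
  by rewrite cardC1 cardA.
pose t : filling := [ffun a => if a == b then (1, 0) else (0, inord (index a s))].
have idx a : a != b -> (index a s < m.+1)%N by rewrite -mem_s -index_mem sz.
exists t; split; last 2 first.
- by rewrite ffunE (negbTE ab) /= eqxx; congr (_, _); apply: val_inj; rewrite /= inordK.
- by rewrite ffunE eqxx.
apply/andP; split.
  apply/injectiveP => x y; rewrite !ffunE.
  have [->|nx] := eqVneq x b; have [->|ny] := eqVneq y b => //.
  case=> /(congr1 (@nat_of_ord _)); rewrite !inordK ?idx // => e.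
  by apply: (@index_inj A a0 s x y _ _ e); rewrite mem_s.
apply/forallP => -[r c] /=; apply/eqP; apply/codomP/idP => [[a]|].
  rewrite ffunE; case: eqP => _ [-> ->] //=.
case: r => [[|[|r]] lr] //= ltc.
  have lts : (c < size s)%N by rewrite sz.
  exists (nth a0 s c); rewrite ffunE.
  have -> : (nth a0 s c == b) = false by apply/negbTE; rewrite -mem_s mem_nth.
  congr (_, _); apply: val_inj; first by [].
  by rewrite -[RHS]/(nat_of_ord _) index_uniq // inordK // -sz.
exists b; rewrite ffunE eqxx; congr (_, _); apply: val_inj => //=.
by case: (nat_of_ord c) ltc.
Qed.

Definition total_sum0 (z : {ffun A -> F}) := \sum_a z a = 0.

Let L : 'M[F]_(#|A|, #|{: tabloid}|) := \matrix_i basis_vec F (tab (enum_val i)).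

(** Polytabloids are differences of two letters, and the differences with a fixed letter already
    span the zero-sum functions. *)
Lemma Specht_std_sub (u : 'rV_#|{: tabloid}|) :
  (u <= Specht_space F A la)%MS <-> exists z, total_sum0 z /\ u = funrv z *m L.
Proof.
have LE a : basis_vec F a *m L = basis_vec F (tab a).
  exact: (row_matrix_basis (fun a => basis_vec F (tab a))).
pose K : 'M[F]_#|A| := kermx (const_mx 1 : 'M_(#|A|, 1)).
have KE (v : 'rV_#|A|) : (v <= K)%MS <-> total_sum0 (rvfun v).
  have e : v *m (const_mx 1 : 'M_(#|A|, 1)) = const_mx (\sum_a rvfun v a).
    apply/matrixP => i j; rewrite !mxE ord1 (reindex (@enum_val A A)) /=.
      by apply: eq_bigr => l _; rewrite mxE mulr1 ffunE enum_valK.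
    by apply: onW_bij; exists (@enum_rank A); [apply: enum_valK|apply: enum_rankK].
  split=> [/sub_kermxP|s0]; last by apply/sub_kermxP; rewrite e s0.
  by rewrite e => /matrixP/(_ 0 0); rewrite !mxE.
have sumv a b : total_sum0 (rvfun (basis_vec F b - basis_vec F a)).
  rewrite /total_sum0 /basis_vec; under eq_bigr do rewrite ffunE !mxE eqxx /=.
  rewrite sumrB (bigD1 b) //= eqxx big1 => [|i ne]; last first.
    by rewrite (inj_eq enum_rank_inj) (negbTE ne).
  rewrite (bigD1 a) //= eqxx big1 => [|i ne]; last first.
    by rewrite (inj_eq enum_rank_inj) (negbTE ne).
  by rewrite !addr0 subrr.
have eqS : (Specht_space F A la :=: K *m L)%MS.
  apply/eqmxP/andP; split.
    apply/sumsmx_subP => t tt; rewrite genmxE.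
    have [a0 [b [e0 e1]]] := tableau_cells tt.
    by rewrite (polytabloid_std tt e0 e1) -!LE -mulmxBl submxMr //; apply/KE.
  apply/rV_subP => w /submxP[D ->]; rewrite mulmxA.
  set v := D *m K; have : total_sum0 (rvfun v) by apply/KE; rewrite submxMl.
  have [a0 _] : exists a0 : A, True.
    have : (0 < #|A|)%N by rewrite cardA.
    by case/card_gt0P => a _; exists a.
  move=> s0; have -> : v = \sum_a rvfun v a *: (basis_vec F a - basis_vec F a0).
    under eq_bigr do rewrite scalerBr.
    rewrite sumrB -scaler_suml s0 scale0r subr0.
    rewrite {1}[v]row_sum_delta (reindex (@enum_rank A)) /=.
      by apply: eq_bigr => a _; rewrite ffunE.
    by apply: onW_bij; exists (@enum_val A A); [apply: enum_rankK|apply: enum_valK].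
  rewrite mulmx_suml summx_sub // => a _; rewrite -scalemxAl scalemx_sub //.
  have [->|ne] := eqVneq a0 a; first by rewrite subrr mul0mx sub0mx.
  have [t [tt e0 e1]] := exists_tableau ne.
  by rewrite (sumsmx_sup t) // genmxE (polytabloid_std tt e0 e1) mulmxBl !LE.
rewrite eqS; split=> [/submxP[D ->]|[z [s0 ->]]].
  exists (rvfun (D *m K)); rewrite rvfunK mulmxA; split=> //.
  by apply/KE; rewrite submxMl.
by rewrite submxMr //; apply/KE; rewrite funrvK.
Qed.

Lemma Specht_std_model : model letter_act (Specht F A la) total_sum0.
Proof.
have evL z a : rvfun (funrv z *m L) (tab a) = z a.
  rewrite ffunE mxE (bigD1 (enum_rank a)) //= big1 ?addr0 => [|j ne].
    by rewrite mxE enum_rankK mxE enum_rankK /basis_vec mxE !eqxx mulr1.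
  rewrite [X in _ * X]mxE /basis_vec [X in _ * X]mxE eqxx.
  rewrite (inj_eq enum_rank_inj) (inj_eq tab_inj) /=.
  have [e|_] := eqVneq a (enum_val j); last by rewrite mulr0.
  by rewrite e enum_valK eqxx in ne.
pose f (v : 'rV_(rdegree (Specht F A la))) : {ffun A -> F} :=
  [ffun a => rvfun (val_submod v) (tab a)].
have fP v : total_sum0 (f v) /\ val_submod v = funrv (f v) *m L.
  have /Specht_std_sub[z [s0 e]] := val_submodP v.
  have -> : f v = z by apply/ffunP => a; rewrite ffunE e evL.
  by [].
apply: (@model_lin _ _ _ _ (Specht F A la) _ f).
- by move=> a u v t; rewrite !ffunE linearP /= mxE [in LHS]mxE.
- move=> v v0; have [_] := fP v; rewrite v0.
  have -> : funrv (0 : {ffun A -> F}) = 0 by apply/rowP => j; rewrite !mxE ffunE.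
  by rewrite mul0mx => /eqP; rewrite val_submod_eq0 => /eqP.
- move=> g v a; rewrite [LHS]ffunE [RHS]ffunE /=.
  rewrite val_submodJ ?inE // -[RHS](rvfun_perm_module (tabloid_action A la) _ g).
  suff -> : tabloid_action A la (tab a) g = tab (letter_act g a) by [].
  apply/ffunP => b; rewrite !ffunE /letter_act.
  by rewrite -{2}(permKV g b) (inj_eq (@perm_inj _ g)).
move=> z; split=> [s0|[v ->]]; last by case: (fP v).
have su : (funrv z *m L <= Specht_space F A la)%MS by apply/Specht_std_sub; exists z.
exists (in_submod _ (funrv z *m L)); apply/ffunP => a.
by rewrite ffunE in_submodK // evL.
Qed.

End Standard.
End SpechtModels.

Section Trivial.
Local Open Scope ring_scope.
Variables (F : fieldType) (gT : finGroupType).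
Notation rep := (representation F [set: gT]).

Definition is_triv (r : rep) := rdegree r = 1%N /\ forall g, r g = 1%:M.

Lemma row1_sum0 n (v : 'rV[F]_n) : n = 1%N -> \sum_i v 0 i = 0 -> v = 0.
Proof.
move=> n1; subst n; rewrite big_ord1 => v0; apply/rowP => i.
by rewrite ord1 v0 mxE.
Qed.

Lemma row1_sum n (a : F) : n = 1%N -> \sum_(i < n) (const_mx a : 'rV_n) 0 i = a.
Proof. by move=> ->; rewrite big_ord1 mxE. Qed.

Lemma model_triv (T : finType) (s : gT -> T -> T) (r : rep) (c : {ffun T -> F}) :
  is_triv r -> (exists t, c t != 0) -> (forall g t, c (s g t) = c t) ->
  model s r (fun z => exists a, z = [ffun t => a * c t]).
Proof.
move=> [deg1 r1] [t0 ct0] cs.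
apply: (@model_lin _ _ _ _ r _ (fun v => [ffun t => (\sum_i v 0 i) * c t])).
- move=> a u v t; rewrite !ffunE; under eq_bigr do rewrite !mxE.
  by rewrite big_split /= -mulr_sumr mulrDl mulrA.
- move=> v /ffunP/(_ t0); rewrite !ffunE => /eqP; rewrite mulf_eq0 (negbTE ct0) orbF.
  by move/eqP; apply: row1_sum0.
- by move=> g v t; rewrite !ffunE r1 mulmx1 cs.
move=> z; split=> [[a ->]|[v ->]]; last by exists (\sum_i v 0 i).
by exists (const_mx a); apply/ffunP => t; rewrite !ffunE row1_sum.
Qed.

Lemma tensor_power0_triv (r : rep) : is_triv (tensor_power r 0).
Proof. by []. Qed.

End Trivial.

(** * Tensor products as functions on words *)

Section WordModels.
Local Open Scope ring_scope.
Variables (F : fieldType) (A : finType).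
Notation rep := (representation F [set: {perm A}]).

(** With a single row there is only one tabloid, so it suffices to exhibit a nonzero polytabloid. *)
Lemma Specht_triv n : #|A| = n -> is_triv (Specht F A [:: n]).
Proof.
move=> cardA; pose la := [:: n].
have tab1 (f f' : {ffun A -> 'I_(size la)}) : f = f'.
  by apply/ffunP => a; rewrite [f a]ord1 [f' a]ord1.
have card1 : #|{: {ffun A -> 'I_(size la)}}| = 1%N.
  by rewrite card_ffun card_ord exp1n.
have rank1 : \rank (Specht_space F A la) = 1%N.
  apply/eqP; rewrite eqn_leq -{1}card1 rank_leq_row lt0n mxrank_eq0.
  pose t : {ffun A -> 'I_(size la) * 'I_(head 0%N la)} :=
    [ffun a => (0, cast_ord cardA (enum_rank a))].
  have tt : is_tableau t.
    apply/andP; split.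
      by apply/injectiveP => a b; rewrite !ffunE => /(congr1 snd)/cast_ord_inj/enum_rank_inj.
    apply/forallP => -[r c] /=; rewrite [r]ord1 /= ltn_ord eqb_id.
    apply/codomP; exists (enum_val (cast_ord (esym cardA) c)).
    by rewrite ffunE enum_valK cast_ordKV.
  have pt : polytabloid F t = basis_vec F [ffun a => (t a).1].
    rewrite /polytabloid (bigD1 1%g) /=; last by apply/forallP => a; rewrite perm1.
    rewrite odd_perm1 expr0 scale1r big1 ?addr0 => [|s /andP[/forallP hs s1]].
      by congr (basis_vec F _); apply: tab1.
    case/eqP: s1; apply/permP => a; rewrite perm1.
    by have := eqP (hs a); rewrite !ffunE /= => /cast_ord_inj/enum_rank_inj.
  apply/negP => /eqP S0.
  have : (polytabloid F t <= Specht_space F A la)%MS.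
    by rewrite (sumsmx_sup t) // genmxE.
  rewrite S0 submx0 pt => /eqP/rowP/(_ (enum_rank [ffun a => (t a).1])).
  by rewrite !mxE !eqxx => /eqP; rewrite oner_eq0.
split=> // g; have act1 : perm_module F (tabloid_action A la) g = 1%:M.
  apply: eq_on_basis => f; rewrite perm_moduleE mulmx1.
  by congr (basis_vec F _); apply: tab1.
apply/row_matrixP => i; rewrite !rowE mulmx1.
apply: (can_inj (@val_submodK _ _ _ _)); rewrite /= val_submodJ ?inE //.
by rewrite act1 mulmx1.
Qed.

Section TensorWords.
Variable m : nat.
Hypothesis cardA : #|A| = m.+2.
Hypothesis card0 : m.+2%:R != 0 :> F.
Notation S := (Specht F A [:: m.+1; 1%N]).
Notation T := (Specht F A [:: m.+2]).

(** A function is split into its mean and a zero-sum part, which uses that the number of letters is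
    invertible in [F]. *)
Lemma perm_model : model (@letter_act A) (dadd_grepr S T) (fun=> True).
Proof.
have [a0 _] : exists a0 : A, True.
  have : (0 < #|A|)%N by rewrite cardA.
  by case/card_gt0P => a _; exists a.
apply: (model_dadd (Specht_std_model F cardA)
  (model_triv (c := [ffun=> 1]) (Specht_triv cardA) _ _)).
- by exists a0; rewrite ffunE oner_eq0.
- by move=> g t; rewrite !ffunE.
- move=> z; split=> // _; pose c := (\sum_a z a) / m.+2%:R.
  exists (z - [ffun=> c]), [ffun t => c * ([ffun=> 1] : {ffun A -> F}) t].
  split; last 2 [by exists c].
    rewrite /total_sum0; under eq_bigr do rewrite !ffunE.
    by rewrite sumrB sumr_const cardA -mulr_natr divfK ?subrr.
  by apply/ffunP => t; rewrite !ffunE mulr1 subrK.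
move=> z s0 [a /ffunP ea]; have za t : z t = - a.
  by have := ea t; rewrite !ffunE mulr1 => /(canRL (@opprK _)).
move: s0; rewrite /total_sum0; under eq_bigr do rewrite za.
rewrite sumr_const cardA -mulr_natr => /eqP; rewrite mulf_eq0 (negbTE card0) orbF.
by move=> /eqP a0'; apply/ffunP => t; rewrite za a0' ffunE.
Qed.

Fixpoint Wrep (b : seq bool) : rep :=
  if b is x :: b' then tensor (if x then S else dadd_grepr S T) (Wrep b')
  else tensor_power S 0.

Definition word_act k (g : {perm A}) (w : k.-tuple A) : k.-tuple A :=
  [tuple of map g w].


(** Extension by zero to words of any length, so that words can be cut and concatenated without
    casts between tuple types. *)
Definition on_seq (X : finType) k (z : {ffun k.-tuple X -> F}) (w : seq X) : F :=
  oapp z 0 (insub w).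

Lemma on_seqE (X : finType) k (z : {ffun k.-tuple X -> F}) (w : k.-tuple X) :
  on_seq z w = z w.
Proof. by rewrite /on_seq valK. Qed.

Lemma on_seq_cons (X : finType) k (z : {ffun k.+1.-tuple X -> F}) x w :
  on_seq [ffun w : k.-tuple X => z [tuple of x :: w]] w = on_seq z (x :: w).
Proof.
have [sz|ne] := boolP (size w == k).
  rewrite -[w]/(val (Tuple sz)) on_seqE ffunE.
  by rewrite -[x :: _]/(val [tuple of x :: Tuple sz]) on_seqE.
by rewrite /on_seq !insubN.
Qed.

Definition mask_sum0 k (b : seq bool) (z : {ffun k.-tuple A -> F}) :=
  forall w0 w1, (size w0 + size w1).+1 = k -> nth false b (size w0) ->
  \sum_a on_seq z (w0 ++ a :: w1) = 0.

Lemma Wrep_model k b : size b = k -> model (@word_act k) (Wrep b) (@mask_sum0 k b).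
Proof.
elim: b k => [|x b IH] [|k] // => [_|[szb]].
  apply: (model_ext (model_triv (c := [ffun=> 1]) (tensor_power0_triv S) _ _)).
  - by exists [tuple]; rewrite ffunE oner_eq0.
  - by move=> g t; rewrite !ffunE.
  move=> z; split=> // _; exists (z [tuple]); apply/ffunP => t.
  by rewrite !ffunE mulr1 tuple0.
have mx : model (@letter_act A) (if x then S else dadd_grepr S T)
    (fun z => x -> total_sum0 z).
  case: x; first by apply: (model_ext (Specht_std_model F cardA)) => z; split=> //; apply.
  exact: (model_ext perm_model).
apply: (@model_tensor _ _ _ _ _ _ _ _ _ _ _ _ _ (fun a (w : k.-tuple A) => [tuple of a :: w])
    (fun w : k.+1.-tuple A => thead w) (fun w => [tuple of behead w]) _ _ _ _ mx (IH k szb)).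
- by move=> a w; rewrite theadE.
- by move=> a w; apply: val_inj.
- by move=> w; rewrite [RHS]tuple_eta; apply: val_inj.
- by move=> g a w; apply: val_inj.
move=> z; split=> [zs|[z1 z2] [|a w0] w1 /= [sz] hx].
  split=> [w hx|a w0 w1 sz nb].
    rewrite /total_sum0 -[RHS](zs [::] w (congr1 succn (size_tuple w)) hx).
    by apply: eq_bigr => a _; rewrite ffunE -on_seqE.
  rewrite -[RHS](zs (a :: w0) w1 (congr1 succn sz) nb).
  by apply: eq_bigr => a' _; rewrite on_seq_cons.
  have szw : size w1 == k by apply/eqP.
  have := z1 (Tuple szw) hx; rewrite /total_sum0 => e; rewrite -[RHS]e.
  by apply: eq_bigr => a _; rewrite ffunE -on_seqE.
have := z2 a w0 w1 sz hx => e; rewrite -[RHS]e.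
by apply: eq_bigr => a' _; rewrite on_seq_cons.
Qed.

Notation mword k := (k.-tuple (bool * A)).

Definition mword_act k (g : {perm A}) (u : mword k) : mword k :=
  [tuple of [seq (x.1, g x.2) | x <- u]].

(** For [d = false] a mark on the first letter imposes no condition, so that letter contributes a
    permutation module. *)
Definition free_head d (b : seq bool) :=
  if b is x :: b' then (d && x) :: b' else [::].

Lemma mword_act_bij k g : bijective (@mword_act k g).
Proof.
exists (@mword_act k g^-1%g) => u; apply: val_inj; rewrite /= -map_comp;
  by rewrite -[RHS]map_id; apply: eq_map => -[x a] /=; rewrite ?permK ?permKV.
Qed.

Lemma word_act_bij k g : bijective (@word_act k g).
Proof.
exists (@word_act k g^-1%g) => u; apply: val_inj; rewrite /= -map_comp;
  by rewrite -[RHS]map_id; apply: eq_map => a /=; rewrite ?permK ?permKV.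
Qed.

Definition marked_in d k (bs : seq (seq bool)) (z : {ffun mword k -> F}) :=
  (forall u : mword k, marks u \notin bs -> z u = 0) /\ marked_sum0 d k (on_seq z).

Lemma nth_free_head d b i :
  nth false (free_head d b) i = nth false b i && (d || (i != 0%N)).
Proof. by case: b i => [|x b] [|i] //=; rewrite ?andbT ?orbF ?orbT ?andbT // andbC. Qed.

Lemma on_seq_eq0 (X : finType) k (z : {ffun k.-tuple X -> F}) w :
  (forall w' : k.-tuple X, val w' = w -> z w' = 0) -> on_seq z w = 0.
Proof.
by move=> z0; rewrite /on_seq; case: insubP => //= w' _ /z0.
Qed.

(** For a fixed mask a marked word amounts to a word; the kernel [K] extends functions by zero to
    the other masks. *)
Lemma Wrep_marked_model d k b : size b = k ->
  model (@mword_act k) (Wrep (free_head d b)) (@marked_in d k [:: b]).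
Proof.
move=> szb.
have szf : size (free_head d b) = k by rewrite -szb; case: (b).
pose letk (u : mword k) : k.-tuple A := [tuple of letters u].
pose K (w : k.-tuple A) (u : mword k) : F := ((marks u == b) && (letk u == w))%:R.
have pushE z u : push K z u = if marks u == b then z (letk u) else 0.
  rewrite ffunE /K; case: eqP => _ /=; last by rewrite big1 // => w _; rewrite mulr0.
  rewrite (bigD1 (letk u)) //= eqxx mulr1 big1 ?addr0 // => w.
  by rewrite eq_sym => /negbTE->; rewrite mulr0.
have zipk (w : k.-tuple A) : size (zip b w) == k by rewrite size_zip size_tuple szb minnn.
have mzip (w : k.-tuple A) : marks (zip b w) = b.
  by rewrite /marks -/(unzip1 _) unzip1_zip // size_tuple szb.
have lzip (w : k.-tuple A) : letk (Tuple (zipk w)) = w.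
  by apply: val_inj; rewrite /= /letters -/(unzip2 _) unzip2_zip // size_tuple szb.
apply: (model_push (s := @word_act k) (K := K) _ (Wrep_model szf)).
- exact: word_act_bij.
- move=> g w u; rewrite /K; congr ((_ && _)%:R).
    by rewrite /marks -map_comp.
  have -> : letk (mword_act g u) = word_act g (letk u).
    by apply: val_inj; rewrite /= /letters -!map_comp.
  by rewrite (bij_eq (word_act_bij k g)).
- move=> z _ /ffunP z0; apply/ffunP => w; have := z0 (Tuple (zipk w)).
  by rewrite pushE /= mzip eqxx lzip !ffunE.
have onE z u0 a u1 : marks (u0 ++ (true, a) :: u1) = b ->
    on_seq (push K z) (u0 ++ (true, a) :: u1) = on_seq z (letters u0 ++ a :: letters u1).
  move=> mu; have szu : size (u0 ++ (true, a) :: u1) == k.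
    by rewrite -szb -mu size_map.
  rewrite -[u0 ++ _]/(val (Tuple szu)) on_seqE pushE mu eqxx -on_seqE.
  by rewrite /= /letters map_cat.
move=> z'; split=> [[z'0 zs]|[z [zs ->]]].
  pose z : {ffun k.-tuple A -> F} := [ffun w => z' (Tuple (zipk w))].
  have ez : z' = push K z.
    apply/ffunP => u; rewrite pushE; case: eqP => [mu|/eqP ne]; last first.
      by apply: z'0; rewrite inE.
    rewrite ffunE; congr (z' _); apply: val_inj => /=.
    by rewrite -[LHS](zip_marks u) mu.
  exists z; split=> // w0 w1 sz; rewrite nth_free_head => /andP[nb dn].
  have lt0 : (size w0 < size b)%N by lia.
  have e1 : b = take (size w0) b ++ true :: drop (size w0).+1 b.
    by rewrite -[in LHS](cat_take_drop (size w0) b) (drop_nth false lt0) nb.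
  have s0 : size (take (size w0) b) = size w0 by rewrite size_takel // ltnW.
  have s1 : size (drop (size w0).+1 b) = size w1 by rewrite size_drop; lia.
  have := zs (zip (take (size w0) b) w0) (zip (drop (size w0).+1 b) w1).
  rewrite !size_zip s0 s1 !minnn sz => /(_ erefl) e; rewrite -[RHS]e; last first.
    case: (d) dn => //= ne; apply: contra_neq ne => /(congr1 size).
    by rewrite size_zip s0 minnn.
  apply: eq_bigr => a _; rewrite ez onE.
    by rewrite /letters -!/(unzip2 _) !unzip2_zip ?s0 ?s1.
  by rewrite /marks map_cat /= -!/(unzip1 _) !unzip1_zip ?s0 ?s1 // -e1.
split=> [u|u0 u1 sz dn].
  by rewrite inE pushE => /negbTE->.
have [mb|ne] := eqVneq (marks u0 ++ true :: marks u1) b; last first.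
  rewrite big1 // => a _; apply: on_seq_eq0 => u' eu'; rewrite pushE eu'.
  by rewrite /marks map_cat /= -!/(marks _) (negbTE ne).
have := zs (letters u0) (letters u1); rewrite !size_letters => /(_ sz) e; rewrite -[RHS]e.
  by apply: eq_bigr => a _; rewrite onE // /marks map_cat.
rewrite nth_free_head -mb nth_cat size_map ltnn subnn /=.
by case: (d) dn => //=; case: (u0).
Qed.

(** Changing a marked letter keeps the mask, so no zero-sum condition involves two masks and the
    space splits along them. *)
Lemma Wrep_sum_model d k bs : uniq bs -> all (fun b => size b == k) bs ->
  model (@mword_act k) (\big[dadd_grepr/grepr0]_(b <- bs) Wrep (free_head d b))
    (@marked_in d k bs).
Proof.
elim: bs => [|b bs IH] /= => [_ _|/andP[nb ubs] /andP[/eqP szb szbs]].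
  rewrite big_nil; apply: model_grepr0 => z; split=> [[z0 _]|->].
    by apply/ffunP => u; rewrite z0 // ffunE.
  split=> [u _|u0 u1 _ _]; first by rewrite ffunE.
  by rewrite big1 // => a _; apply: on_seq_eq0 => u' _; rewrite ffunE.
rewrite big_cons; apply: (model_dadd (Wrep_marked_model d szb) (IH ubs szbs)).
  move=> z; split=> [[z0 zs]|[z1 [z2 [[z10 z1s] [z20 z2s] ->]]]].
    pose r (c : seq bool -> bool) : {ffun mword k -> F} :=
      [ffun u : mword k => if c (marks u) then z u else 0].
    have rs c : marked_sum0 d k (on_seq (r c)).
      move=> u0 u1 sz dn; have [cm|ncm] := boolP (c (marks u0 ++ true :: marks u1)).
        rewrite -[RHS](zs u0 u1 sz dn); apply: eq_bigr => a _.
        have szu : size (u0 ++ (true, a) :: u1) == k by rewrite size_cat /= addnS sz.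
        rewrite -[u0 ++ _]/(val (Tuple szu)) !on_seqE ffunE /=.
        by rewrite {1}/marks map_cat /= -!/(marks _) cm.
      rewrite big1 // => a _; apply: on_seq_eq0 => u' eu'; rewrite ffunE eu'.
      by rewrite /marks map_cat /= -!/(marks _) (negbTE ncm).
    exists (r (pred1 b)), (r (predC1 b)); split.
    - by split=> // u; rewrite inE ffunE /= => /negbTE->.
    - split=> // u nbs; rewrite ffunE /=; case: eqP => //= /eqP ne.
      by apply: z0; rewrite inE negb_or ne.
    apply/ffunP => u; rewrite !ffunE /=.
    by case: eqP => _; rewrite ?addr0 ?add0r.
  split=> [u|u0 u1 sz dn].
    by rewrite inE negb_or !ffunE => /andP[n1 n2]; rewrite z10 ?inE // z20 // addr0.
  have onD w : on_seq (z1 + z2) w = on_seq z1 w + on_seq z2 w.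
    by rewrite /on_seq; case: insubP => /= [u _ _|_]; rewrite ?ffunE ?addr0.
  by under eq_bigr do rewrite onD; rewrite big_split /= z1s // z2s // addr0.
move=> z [z10 _] [z20 _]; apply/ffunP => u; rewrite [RHS]ffunE.
have [e|ne] := eqVneq (marks u) b; last by rewrite z10 // inE.
have := z20 u; rewrite e ffunE => /(_ nb) /eqP.
by rewrite oppr_eq0 => /eqP.
Qed.

End TensorWords.
End WordModels.

(** * Maximal chains of subword order *)

Fixpoint masks k m : seq (seq bool) :=
  match k, m with
  | 0, 0 => [:: [::]]
  | 0, _ => [::]
  | k'.+1, 0 => map (cons false) (masks k' 0)
  | k'.+1, m'.+1 => map (cons true) (masks k' m') ++ map (cons false) (masks k' m)
  end.

Lemma size_masks k m : size (masks k m) = 'C(k, m).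
Proof.
elim: k m => [|k IH] [|m] //=; first by rewrite size_map IH !bin0.
by rewrite size_cat !size_map !IH binS addnC.
Qed.

Lemma mem_masks k m b : (b \in masks k m) = (size b == k) && (count id b == m).
Proof.
have consP x y (s : seq (seq bool)) (b' : seq bool) :
    (y :: b' \in map (cons x) s) = (x == y) && (b' \in s).
  apply/mapP/andP => [[b1 sb1 [-> ->]]|[/eqP-> sb]]; first by rewrite eqxx.
  by exists b'.
have nilP x (s : seq (seq bool)) : ([::] \in map (cons x) s) = false.
  by apply/negbTE/mapP => -[].
elim: k m b => [|k IH] [|m] [|x b] //=; rewrite ?mem_cat ?consP ?nilP ?IH //.
  by case: x; rewrite eqSS ?andbF.
by case: x; rewrite /= eqSS ?orbF.
Qed.

Lemma uniq_masks k m : uniq (masks k m).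
Proof.
have inj x : injective (cons x : seq bool -> _) by move=> b b' [].
elim: k m => [|k IH] [|m] //=; first by rewrite map_inj_uniq.
rewrite cat_uniq !map_inj_uniq // !IH /= andbT; apply/hasPn => b /mapP[b' _ ->].
by apply/mapP => -[].
Qed.

Lemma head_rev (T : Type) (x : T) (s : seq T) : head x (rev s) = last x s.
Proof. by case/lastP: s => // s y; rewrite rev_rcons last_rcons. Qed.

Section Chains.
Local Open Scope ring_scope.
Variables (F : fieldType).

Lemma boundaryP (d : Order.disp_t) (P : finPOrderType d) m
    (v : 'rV_#|{: m.+1.-tuple P}|) (r : m.-tuple P) :
  rvfun (v *m boundary F P m) r =
    \sum_(j < m.+1) (-1) ^+ j * \sum_(t | face t j == r) rvfun v t.
Proof.
rewrite ffunE mxE (reindex (@enum_rank (m.+1.-tuple P))) /=; last first.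
  by apply: onW_bij; exists enum_val; [apply: enum_rankK|apply: enum_valK].
under eq_bigr do rewrite mxE enum_rankK summxE mulr_sumr.
rewrite exchange_big /=; apply: eq_bigr => j _; rewrite [in RHS]big_mkcond mulr_sumr.
apply: eq_bigr => t _; rewrite mxE /basis_vec mxE eqxx (inj_eq enum_rank_inj) /=.
rewrite mulrCA [r == _]eq_sym ffunE; case: eqP => _; by rewrite ?mulr1 ?mulr0.
Qed.

Lemma chains_subE (d : Order.disp_t) (P : finPOrderType d) m (Q : {set P})
    (v : 'rV_#|{: m.-tuple P}|) :
  (v <= chains F m Q)%MS <->
  forall t : m.-tuple P, rvfun v t != 0 -> sorted <%O t && all (mem Q) t.
Proof.
split=> [sv t|v0].
  apply: contraNT => nt.
  pose M : 'M[F]_(#|{: m.-tuple P}|, 1) := delta_mx (enum_rank t) 0.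
  have : (v *m M <= (0 : 'M_1))%MS.
    apply: submx_trans (submxMr _ sv) _; apply: chains_subP => t' st' Qt'.
    rewrite mul_delta_mx_cond (inj_eq enum_rank_inj); case: eqP => [e|]; last by rewrite sub0mx.
    by rewrite -e st' Qt' in nt.
  by rewrite submx0 -colE => /eqP/matrixP/(_ 0 0); rewrite !mxE ffunE => ->.
rewrite [v]row_sum_delta summx_sub // => j _.
have [->|vj] := eqVneq (v 0 j) 0; first by rewrite scale0r sub0mx.
rewrite scalemx_sub //; have := v0 (enum_val j); rewrite ffunE enum_valK => /(_ vj) /andP[st Qt].
by have := basis_vec_chains F st Qt; rewrite /basis_vec enum_valK.
Qed.

End Chains.

(** * From chains of the poset to chains of words *)

Section Bridge.
Local Open Scope ring_scope.
Variables (F : fieldType) (A : finType) (k : nat).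
Notation P := (subword_poset A k).
Implicit Types (s : seq P).

(** The value at the artificial top is a dummy, excluded by [isSome] wherever it matters. *)
Definition word (x : P) : seq A := if x is Some w then val w else [::].

(** Chains of the poset are listed upwards, chains of words downwards. *)
Definition words s := rev (map word s).

Lemma word_lt (x y : P) : x -> y -> (x < y)%O = subseq (word x) (word y) && (word x != word y).
Proof.
case: x y => [x|] [y|] // _ _; rewrite lt_neqAle andbC; congr (_ && _).
Qed.

Lemma word_inj s s' : all isSome s -> all isSome s' -> map word s = map word s' -> s = s'.
Proof.
elim: s s' => [|x s IH] [|y s'] //= /andP[sx ss] /andP[sy ss'] [e /(IH _ ss ss') ->].
by case: x y sx sy e => [x|] [y|] //= _ _ /val_inj ->.
Qed.

Lemma chainE K m (c : seq (seq A)) :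
  chain K m c = [&& size c == m.+1, size (head [::] c) == K & sorted (@covers A) c].
Proof. by case: c => //= w ys; rewrite eqSS andbCA. Qed.

Lemma sorted_covers_sizes (x : seq A) (s : seq (seq A)) :
  path (fun y z => covers z y) x s -> size (last x s) = (size x + size s)%N.
Proof.
elim: s x => [|y s IH] x /=; first by rewrite addn0.
by move=> /andP[/andP[_ /eqP sy] /IH ->]; rewrite sy addSnnS.
Qed.

Lemma word_lt_size (x y : P) : x -> y -> (x < y)%O ->
  (size (word x) < size (word y))%N.
Proof.
move=> sx sy; rewrite word_lt // => /andP[sub ne].
by rewrite ltn_neqAle (size_subseq sub) andbT (size_subseq_leqif sub).
Qed.

Lemma path_lt_size (x : P) s : all isSome (x :: s) -> path <%O x s ->
  (size (word x) + size s <= size (word (last x s)))%N.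
Proof.
elim: s x => [|y s IH] x; first by rewrite addn0.
move=> /and3P[sx sy ss] /andP[lt /IH le].
have /le : all isSome (y :: s) by rewrite /= sy.
by have := word_lt_size sx sy lt; rewrite /=; lia.
Qed.

(** Lengths grow strictly, so a chain with as many steps as its ends allow gains one letter at each
    step. *)
Lemma path_lt_covers (x : P) s : all isSome (x :: s) -> path <%O x s ->
  (size (word (last x s)) <= size (word x) + size s)%N ->
  path (fun y z => covers z y) (word x) (map word s).
Proof.
elim: s x => //= y s IH x /and3P[sx sy ss] /andP[lt pys] le.
have al : all isSome (y :: s) by rewrite /= sy.
have := word_lt_size sx sy lt; have := path_lt_size al pys => le1 lt1.
rewrite IH // ?andbT; last by lia.
move: lt; rewrite word_lt // => /andP[sub _]; rewrite /covers sub /=.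
by apply/eqP; lia.
Qed.

Lemma covers_lt (x y : P) : x -> y -> covers (word y) (word x) -> (x < y)%O.
Proof.
move=> sx sy /andP[sub /eqP e]; rewrite word_lt // sub /=.
by apply: contra_eqN e => /eqP ->; rewrite neq_ltn ltnSn.
Qed.

Lemma path_covers_lt (x : P) s : all isSome (x :: s) ->
  path (fun y z => covers z y) (word x) (map word s) -> path <%O x s.
Proof.
elim: s x => //= y s IH x /and3P[sx sy ss] /andP[cv pys].
by rewrite covers_lt //=; apply: IH; rewrite //= sy.
Qed.

Lemma word_size (x : P) : (size (word x) <= k)%N.
Proof. by case: x => //= w; apply: size_bseq. Qed.

Lemma rank_word (x : P) : isSome x -> subword_rank x = size (word x).
Proof. by case: x. Qed.

(* The intervals are [(x, 1)] for [d = true] and [(0, x)] for [d = false], with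
   [x] of rank [r]; their maximal chains have [n] elements. *)
Variables (d : bool) (r n : nat).
Hypothesis rk : (0 < r <= k)%N.
Let K := if d then k else r.
Hypothesis nE : (n.+1 + (if d then r else 0) = K + (d : nat))%N.
(** Number of deletions along a full chain: the interior elements are completed by [x] alone for
    [d = true], and by both the empty word and [x] for [d = false]. *)
Let m := (n + ~~ d)%N.
Notation point := (P * n.-tuple P)%type.
Implicit Types p : point.

Definition full p : seq P :=
  if d then p.1 :: p.2 else (Some [bseq] : P) :: rcons p.2 p.1.

Definition half_interval x : {set P} :=
  if d then open_interval x \top%O else open_interval \bot%O x.

Definition valid p :=
  [&& p.1 \in rank_set (@subword_rank A k) r, sorted <%O p.2
    & all (mem (half_interval p.1)) p.2].

Definition full_chain p := all isSome (full p) && chain K m (words (full p)).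

Lemma size_full p : size (full p) = m.+1.
Proof.
rewrite /full /m; case: d => /=; first by rewrite size_tuple addn0.
by rewrite size_rcons size_tuple addn1.
Qed.

Lemma lt_some (x y : P) : (x < y)%O -> x.
Proof. by case: x => // /lt_geF; rewrite lex1. Qed.

Lemma lt_topE (x : P) : (x < \top)%O = isSome x.
Proof. by rewrite ltx1; case: x. Qed.

Lemma lt_botE (x : P) : (\bot < x)%O = (x != Some [bseq]).
Proof. by rewrite lt0x. Qed.

Lemma valid_sorted p : valid p =
  [&& subword_rank p.1 == r, all isSome (full p) & sorted <%O (full p)].
Proof.
case: p => x t; rewrite /valid /full /half_interval inE /=.
have [rx|//] := eqVneq (subword_rank x) r.
have sx : isSome x by case: x rx => //= rx; move: rk; rewrite -rx /= ltnn.
have x0 : x != Some [bseq].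
  by apply: contraL rk => /eqP ex; rewrite -rx ex.
case: d => /=.
  rewrite sx /= lt_path_sortedE [RHS]andbA [RHS]andbC; congr (_ && _).
  rewrite -all_predI; apply: eq_all => y /=.
  by rewrite !inE lt_topE andbC.
rewrite all_rcons sx /= lt_path_sortedE all_rcons lt_botE x0 /=.
rewrite !(sorted_pairwise lt_trans) pairwise_rcons.
have -> : all (mem (open_interval \bot%O x)) t =
    all (> (Some [bseq] : P))%O t && all (< x)%O t.
  by rewrite -all_predI; apply: eq_all => y /=; rewrite !inE.
case: (all (< x)%O t) (@allP P (< x)%O t) => [allx|_]; last by rewrite !andbF.
suff -> : all isSome t by rewrite andbT andbC.
by apply/allP => y /(elimT allx isT) /lt_some.
Qed.

(** By [nE], the [n] interior elements are as many as the lengths allow, so the chain is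
    saturated. *)
Lemma validE p : valid p = full_chain p.
Proof.
rewrite valid_sorted /full_chain /words chainE size_rev size_map size_full eqxx /=.
rewrite rev_sorted.
have [h [s [ef sz]]] : exists h s, full p = h :: s /\ size s = m.
  by case: (full p) (size_full p) => // h s [sz]; exists h, s.
rewrite head_rev ef [last _ _]/= last_map.
case sall: (all isSome (h :: s)); last by rewrite andbF.
have eh : isSome p.1 -> size (word h) = (if d then subword_rank p.1 else 0)%N.
  by move: ef; rewrite /full; case: d => -[<- _] // sp; rewrite rank_word.
have sp : isSome p.1.
  move: sall; rewrite -ef /full; case: d => /=; first by case/andP.
  by rewrite all_rcons => /andP[].
have el : ~~ d -> size (word (last h s)) = subword_rank p.1.
  by move: ef; rewrite /full; case: d => // -[<- <-] _; rewrite last_rcons rank_word.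
have {eh} := eh sp; rewrite /= => eh.
have szK : size (word (last h s)) = (size (word h) + size s)%N ->
    (size (word (last h s)) == K) = (subword_rank p.1 == r).
  rewrite sz /m eh => e; move: e el nE; rewrite /K; case: d => /= e el nE'.
    by rewrite e; apply/eqP/eqP; lia.
  by rewrite el.
have lastE : last (word h) (map word s) = word (last h s) by rewrite last_map.
apply/andP/andP => [[/eqP rp lt]|[szl cv]].
  have cv : path (fun y z => covers z y) (word h) (map word s).
    apply: path_lt_covers => //; have := word_size (last h s).
    rewrite eh sz /m rp; move: el nE; rewrite /K; case: d => /= el nE'; first by lia.
    by rewrite el // rp; lia.
  split=> //; rewrite szK ?rp //.
  by have := sorted_covers_sizes cv; rewrite lastE size_map.
split; last exact: path_covers_lt.
by rewrite -szK //; have := sorted_covers_sizes cv; rewrite lastE size_map.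
Qed.

Definition before p (j : 'I_n) : seq P :=
  if d then p.1 :: take j p.2 else (Some [bseq] : P) :: take j p.2.

Definition after p (j : 'I_n) : seq P :=
  if d then drop j.+1 p.2 else rcons (drop j.+1 p.2) p.1.

Lemma full_split p j : full p = before p j ++ tnth p.2 j :: after p j.
Proof.
case: p => x t; rewrite /full /before /after /=.
have e : t = take j t ++ tnth t j :: drop j.+1 t :> seq P.
  by rewrite (tnth_nth x) -drop_nth ?size_tuple // cat_take_drop.
by case: d; rewrite {1}e //= rcons_cat.
Qed.

Lemma size_before p j : size (before p j) = j.+1.
Proof.
by rewrite /before; case: d; rewrite /= size_takel ?size_tuple // ltnW.
Qed.

Lemma full_chain_inj p p' : full_chain p -> full_chain p' ->
  words (full p) = words (full p') -> p = p'.
Proof.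
move=> /andP[sp _] /andP[sp' _] /(can_inj revK)/(word_inj sp sp').
rewrite /full; case: p p' {sp sp'} => x t [x' t'] /=; case: d => -[].
  by move=> -> /val_inj->.
by move/rcons_inj => -[/val_inj-> ->].
Qed.

Definition to_poset (w : seq A) : P := Some (insubd [bseq] w).

Lemma word_to_poset w : (size w <= k)%N -> word (to_poset w) = w.
Proof. by move=> sw; rewrite /= val_insubd sw. Qed.

Lemma Kk : (K <= k)%N.
Proof. by rewrite /K; case: d => //; case/andP: rk. Qed.

Lemma full_chain_exists c : chain K m c -> exists p, full_chain p /\ words (full p) = c.
Proof.
move=> cc; have szc : all (fun w => (size w <= k)%N) c.
  case: c cc => //= w ys /and3P[/eqP szw _ pw].
  have {pw} : all (fun y => (size y <= size w)%N) ys.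
    elim: ys w {szw} pw => //= y ys IH w /andP[/andP[_ /eqP ew] /IH al].
    by rewrite ew leqnSn; apply: sub_all al => z /leq_trans; apply.
  rewrite szw Kk; apply: sub_all => y /leq_trans; apply; exact: Kk.
suff [p [sp wp]] : exists p, all isSome (full p) /\ words (full p) = c.
  by exists p; rewrite /full_chain sp wp cc.
have wordsE (s : seq (seq A)) : all (fun w => (size w <= k)%N) s -> map word (map to_poset s) = s.
  move=> al; rewrite -map_comp map_id_in // => w /(allP al); exact: word_to_poset.
have someE (s : seq (seq A)) : all isSome (map to_poset s) by rewrite all_map; apply/allP.
have [h [s [ec szs]]] : exists (h : seq A) (s : seq (seq A)), rev c = h :: s /\ size s = m.
  move: cc; rewrite chainE -size_rev => /and3P[/eqP + _ _].
  by case: (rev c) => // h s [sz]; exists h, s.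
move: szc; rewrite -(revK c) all_rev ec => al.
have : size (last h s) = K /\ sorted (fun x y => covers y x) (h :: s).
  move: cc; rewrite chainE -[c]revK ec rev_sorted => /and3P[_ /eqP + ->].
  by rewrite head_rev.
move=> [lK sh]; have := sorted_covers_sizes sh; rewrite lK szs => eK.
case ed: d; last first.
  have h0 : h = [::].
    by apply: size0nil; move: nE eK; rewrite /m ed; lia.
  case/lastP: s szs ec al lK sh => [|s x]; first by rewrite /m ed addn1.
  rewrite size_rcons /m ed addn1 => -[szs] ec al lK sh.
  have szs' : size (map to_poset s) == n by rewrite size_map szs.
  exists (to_poset x, Tuple szs').
  rewrite /full ed /= -map_rcons someE /words /= wordsE ?h0 //.
  by case/andP: al.
have szs' : size (map to_poset s) == n by rewrite size_map szs /m ed addn0.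
exists (to_poset h, Tuple szs').
by rewrite /full ed -[_ :: _]/(map to_poset (h :: s)) someE /words wordsE.
Qed.

Lemma size_after p j : size (after p j) = (n - j.+1 + ~~ d)%N.
Proof.
by rewrite /after; case: d; rewrite /= ?size_rcons size_drop size_tuple ?addn0 ?addn1.
Qed.

Lemma words_split p j : words (full p) =
  rev (map word (after p j)) ++ word (tnth p.2 j) :: rev (map word (before p j)).
Proof. by rewrite /words (full_split p j) map_cat /= rev_cat rev_cons cat_rcons. Qed.

Lemma full_chain_size p j : full_chain p ->
  size (word (tnth p.2 j)) = ((if d then r else 0) + j.+1)%N.
Proof.
move=> gp; have := gp; rewrite -validE valid_sorted => /and3P[/eqP rp sp _].
have /andP[_] := gp; rewrite /words chainE rev_sorted => /and3P[_ _].
have [h [s1 [eb sz1]]] : exists h s1, before p j = h :: s1 /\ size s1 = j.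
  by case: (before p j) (size_before p j) => // h s1 [sz]; exists h, s1.
have eh : size (word h) = (if d then r else 0)%N.
  move: eb sp; rewrite /before /full; case: d => -[<- _] //= /andP[sx _].
  by rewrite -rp rank_word.
rewrite (full_split p j) eb map_cat /= cat_path /= => /and3P[p1 c1 _].
have /sorted_covers_sizes :
    path (fun y z => covers z y) (word h) (rcons (map word s1) (word (tnth p.2 j))).
  by rewrite rcons_path p1.
by rewrite last_rcons size_rcons size_map sz1 eh.
Qed.

Lemma chain_nth_size (pre post : seq (seq A)) (y : seq A) : chain K m (pre ++ y :: post) ->
  size y = (K - size pre)%N.
Proof.
case: pre => [|w pre] /=; first by move=> /and3P[/eqP-> _ _]; rewrite subn0.
move=> /and3P[/eqP sw _]; rewrite cat_path /= => /and3P[p1 /andP[_ /eqP c1] _].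
by rewrite -sw -(path_covers_size p1) c1 addnS subSS addKn.
Qed.

Definition same_but j p p' :=
  (before p' j == before p j) && (after p' j == after p j).

(** A chain that differs from [p] in its element [j] amounts to a word for that gap; words that do
    not complete a chain contribute zero because of the support of [f]. *)
Lemma sum_fillers (f : seq (seq A) -> F) p j : full_chain p ->
  (forall c, f c != 0 -> chain K m c) ->
  \sum_(p' | same_but j p p' && full_chain p') f (words (full p')) =
  \sum_(y : (K - size (rev (map word (after p j)))).-tuple A)
     f (rev (map word (after p j)) ++ val y :: rev (map word (before p j))).
Proof.
move=> gp fs; set pre := rev _; set post := rev _.
have fE c : f c = \sum_(p' | full_chain p') (words (full p') == c)%:R * f (words (full p')).
  have [f0|nf] := eqVneq (f c) 0.
    by rewrite f0 big1 // => p' _; case: eqP => [->|]; rewrite ?f0 ?mulr0 ?mul0r.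
  have [p' [gp' ep']] := full_chain_exists (fs _ nf).
  rewrite (bigD1 p') //= ep' eqxx mul1r big1 ?addr0 // => p'' /andP[gp'' ne].
  case: eqP => [e|]; rewrite ?mul0r //.
  by case/eqP: ne; apply: full_chain_inj => //; rewrite ep'.
under [RHS]eq_bigr do rewrite fE.
rewrite [RHS]exchange_big /= big_mkcondl /=; apply: eq_bigr => p' gp'.
rewrite -mulr_suml.
have [/andP[/eqP eb /eqP ea]|ns] := boolP (same_but j p p'); last first.
  rewrite big1 ?mul0r // => y _; case: eqP => // e; case/negP: ns.
  have := congr1 rev e; rewrite /words revK rev_cat rev_cons !revK cat_rcons.
  rewrite (full_split p' j) map_cat /= => /eqP.
  rewrite eqseq_cat ?size_map ?size_before // eqseq_cons => /and3P[/eqP e1 _ /eqP e2].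
  have all_split q : full_chain q -> all isSome (before q j) && all isSome (after q j).
    by move=> /andP[+ _]; rewrite (full_split q j) all_cat /= => /and3P[-> _ ->].
  have /andP[s1 s2] := all_split _ gp; have /andP[s1' s2'] := all_split _ gp'.
  by rewrite /same_but (word_inj s1' s1 e1) (word_inj s2' s2 e2) !eqxx.
have szy : size (word (tnth p'.2 j)) == (K - size pre)%N.
  have /andP[_] := gp'; rewrite (words_split p' j) => /chain_nth_size ->.
  by rewrite ea.
rewrite (bigD1 (Tuple szy)) //= big1 ?addr0 => [|y ne].
  by rewrite (words_split p' j) ea eb eqxx mul1r.
case: eqP => //; rewrite (words_split p' j) ea eb => /eqP.
rewrite eqseq_cat // eqseq_cons !eqxx andbT => /eqP e.
by case/eqP: ne; apply: val_inj; rewrite /= e.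
Qed.

Notation mword := (K.-tuple (bool * A)).

(** The first factor rejects the lists that contain the artificial top, which [word] would confuse
    with the empty word. *)
Definition coef (u : mword) (p : point) : F :=
  (all isSome (full p))%:R * cycle_coef F (words (full p)) u.

Lemma push_coefE (z : {ffun mword -> F}) p :
  push coef z p = (all isSome (full p))%:R * cycle_of K (on_seq z) (words (full p)).
Proof.
rewrite ffunE /cycle_of mulr_sumr; apply: eq_bigr => u _.
by rewrite /coef mulrCA on_seqE.
Qed.

(** The vanishing of the boundary, split into one condition per gap; see [cycle_fun_facewise]. *)
Definition facewise (z : {ffun point -> F}) :=
  (forall p, z p != 0 -> full_chain p) /\
  (forall p j, full_chain p -> \sum_(p' | same_but j p p') z p' = 0).

Lemma marks_supp_on_seq (z : {ffun mword -> F}) :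
  marked_in d (masks K m) z -> marks_supp m (on_seq z).
Proof.
move=> [z0 _] u nu; apply: on_seq_eq0 => u' eu'; apply: z0.
by rewrite mem_masks eu' negb_and nu orbT.
Qed.

Lemma push_facewise (z : {ffun mword -> F}) :
  marked_in d (masks K m) z -> facewise (push coef z).
Proof.
move=> mz; have cz : chain_cycle d K m (cycle_of K (on_seq z)).
  by apply: cycle_of_chain_cycle (marks_supp_on_seq mz) _; case: mz.
have gE p : push coef z p != 0 -> full_chain p.
  rewrite push_coefE /full_chain; case: (all _ _); last by rewrite mul0r eqxx.
  by rewrite mul1r => /(cycle_supp cz).
split=> // p j gp.
transitivity (\sum_(p' | same_but j p p' && full_chain p') cycle_of K (on_seq z) (words (full p'))).
  rewrite [RHS]big_mkcondr; apply: eq_bigr => p' _.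
  have [gp'|ng] := boolP (full_chain p').
    by rewrite push_coefE; case/andP: gp' => -> _; rewrite mul1r.
  by apply/eqP; apply: contraNT ng => /gE.
rewrite sum_fillers //; last exact: (cycle_supp cz).
have [y [post ->]] : exists y post, rev (map word (before p j)) = y :: post.
  have : size (rev (map word (before p j))) = j.+1.
    by rewrite size_rev size_map size_before.
  by case: (rev _) => // y post _; exists y, post.
apply: (cycle_fill cz).
rewrite -size_eq0 size_rev size_map size_after.
by case: d => //=; rewrite addn1.
Qed.

Lemma facewise_push (z' : {ffun point -> F}) : facewise z' ->
  exists z, marked_in d (masks K m) z /\ z' = push coef z.
Proof.
move=> [gz fz].
pose f c := \sum_(p | full_chain p && (words (full p) == c)) z' p.
have fE p : full_chain p -> f (words (full p)) = z' p.
  move=> gp; rewrite /f (bigD1 p) ?gp ?eqxx //= big1 ?addr0 // => p'.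
  move=> /andP[/andP[gp' /eqP e] ne]; case/eqP: ne; exact: full_chain_inj.
have fN c : f c != 0 -> exists2 p, full_chain p & words (full p) = c.
  move=> nf; have [p /andP[gp /eqP e]|n0] := pickP (fun p => full_chain p && (words (full p) == c)).
    by exists p.
  by rewrite /f big_pred0 // eqxx in nf.
have fs c : f c != 0 -> chain K m c.
  by move=> /fN[p /andP[_ cp] <-].
have cf : chain_cycle d K m f.
  split=> // pre y post dn.
  (* A nonzero term comes from an actual chain, which tells which interior element the gap
     corresponds to. *)
  have [/forallP all0|] := boolP [forall y' : (K - size pre).-tuple A,
      f (pre ++ val y' :: y :: post) == 0].
    by apply: big1 => y' _; exact/eqP/all0.
  rewrite negb_forall => /existsP[y0 /fN[p gp ep]].
  have szp : (size pre + size post + 2 = m.+1)%N.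
    have := congr1 size ep; rewrite size_rev size_map size_full size_cat /=; lia.
  (* The index for which [after p j] has as many elements as [pre]. *)
  have ltj : (n - 1 + ~~ d - size pre < n)%N.
    by move: szp dn; rewrite /m; case: d; case: pre {ep y0} => //=; lia.
  pose j := Ordinal ltj.
  have spre : size (rev (map word (after p j))) = size pre.
    rewrite size_rev size_map size_after /=.
    by move: szp dn (ltj); rewrite /m; case: d; case: (pre) => //=; lia.
  move: (ep); rewrite (words_split p j) => /eqP.
  rewrite eqseq_cat // eqseq_cons => /and3P[/eqP epre _ /eqP epost].
  rewrite -epre -epost -sum_fillers //.
  rewrite -[RHS](fz p j gp) [LHS]big_mkcondr; apply: eq_bigr => p' _.
  have [gp'|ng] := boolP (full_chain p'); first by rewrite fE.
  by apply/esym/eqP; apply: contraNT ng => /gz.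
have [t [zt st ft]] := cycle_of_surj_sum0 cf.
pose z : {ffun mword -> F} := [ffun u : mword => t u].
have onz w : size w = K -> on_seq z w = t w.
  move=> /eqP sw; rewrite -[w]/(val (Tuple sw)) on_seqE ffunE //.
exists z; split.
  split=> [u|u0 u1 sz dn].
    by rewrite mem_masks size_map size_tuple eqxx /= ffunE => /st.
  rewrite -[RHS](zt u0 u1 sz dn); apply: eq_bigr => a _; apply: onz.
  by rewrite size_cat /= addnS.
apply/ffunP => p; rewrite push_coefE.
have -> : cycle_of K (on_seq z) (words (full p)) = f (words (full p)).
  by rewrite ft; apply: eq_bigr => u _; rewrite onz ?size_tuple.
have [gp|ng] := boolP (full_chain p).
  by rewrite fE //; case/andP: gp => -> _; rewrite mul1r.
have -> : z' p = 0 by apply/eqP; apply: contraNT ng => /gz.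
case sp: (all _ _); last by rewrite mul0r.
rewrite mul1r; apply/esym/eqP; apply: contraNT ng => /fs.
by rewrite /full_chain sp.
Qed.

Lemma push_inj (z : {ffun mword -> F}) :
  marked_in d (masks K m) z -> push coef z = 0 -> z = 0.
Proof.
move=> mz z0; have [_ zs] := mz.
have cz : chain_cycle d K m (cycle_of K (on_seq z)).
  exact: cycle_of_chain_cycle (marks_supp_on_seq mz) zs.
apply/ffunP => u; rewrite ffunE -on_seqE; apply: (@cycle_of_inj F A K) => [|v sv gv|].
- by move=> u0 u1 sz /= n0; apply: zs => //; rewrite n0 orbT.
- apply/eqP/negPn/negP => nz; have [p [gp ep]] := full_chain_exists (cycle_supp cz nz).
  have /ffunP/(_ p) := z0; rewrite push_coefE ep ffunE.
  by case/andP: gp => -> _; rewrite mul1r => /eqP; rewrite (negbTE nz).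
exact: size_tuple.
Qed.

End Bridge.

Section Faces.
Local Open Scope ring_scope.
Variables (d : Order.disp_t) (P : finPOrderType d) (m : nat).

Lemma val_face (t : m.+1.-tuple P) j : face t j = take j t ++ drop j.+1 t :> seq P.
Proof.
pose x0 := thead t.
apply: (@eq_from_nth _ x0) => [|l].
  by rewrite size_tuple size_cat size_takel ?size_drop size_tuple; have := ltn_ord j; lia.
rewrite size_tuple => ltl; rewrite -[l]/(nat_of_ord (Ordinal ltl)) -tnth_nth.
rewrite tnth_mktuple (tnth_nth x0) /= nth_cat size_takel; last first.
  by rewrite size_tuple ltnW.
rewrite /bump; case: ltnP => lj.
  by rewrite nth_take // add0n.
by rewrite nth_drop add1n; congr nth; lia.
Qed.

Lemma face_eqP (t t' : m.+1.-tuple P) j :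
  (face t j == face t' j) = (take j t == take j t') && (drop j.+1 t == drop j.+1 t').
Proof.
rewrite -val_eqE /= !val_face eqseq_cat // !size_takel ?size_tuple //; exact: ltnW.
Qed.

End Faces.

(** * The cycle condition face by face *)

Section CycleFaces.
Local Open Scope ring_scope.
Variables (F : fieldType) (A : finType) (k : nat).
Notation P := (subword_poset A k).
Variables (d : bool) (r : nat).
Hypothesis rk : (0 < r <= k)%N.
Let K := if d then k else r.
Notation S := (rank_set (@subword_rank A k) r).

Lemma slice_supp n (z : {ffun P * n.-tuple P -> F}) :
  (n.+1 + (if d then r else 0) = K + (d : nat))%N ->
  ((forall x, x \notin S -> funrv [ffun t => z (x, t)] = 0) /\
   {in S, forall x, (funrv [ffun t => z (x, t)] <= chains F n (half_interval d x))%MS}) <->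
  (forall p, z p != 0 -> full_chain d r p).
Proof.
move=> nE; split=> [[z0 zc] [x t] nz|zg].
  rewrite -validE // /valid; have [Sx|nS] := boolP (x \in S); last first.
    have /rowP/(_ (enum_rank t)) := z0 x nS; rewrite !mxE ffunE enum_rankK => e.
    by rewrite e eqxx in nz.
  by apply: (proj1 (chains_subE _ _) (zc x Sx)); rewrite funrvK ffunE.
split=> [x nS|x Sx]; last first.
  apply/chains_subE => t; rewrite funrvK ffunE => /zg.
  by rewrite -validE // => /and3P[_ -> ->].
apply/rowP => j; rewrite !mxE ffunE; apply/eqP; apply: contraNT nS => /zg.
by rewrite -validE // => /and3P[Sx _ _].
Qed.

Lemma same_but_face m (p p' : P * m.+1.-tuple P) j :
  same_but d j p p' = (p'.1 == p.1) && (face p'.2 j == face p.2 j).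
Proof.
rewrite face_eqP /same_but /before /after; case: d; rewrite eqseq_cons ?eqxx /= -?andbA //.
by rewrite eqseq_rcons andbA andbC.
Qed.

Lemma sum_same_but m (z : {ffun P * m.+1.-tuple P -> F}) p j :
  \sum_(p' | same_but d j p p') z p' = \sum_(t | face t j == face p.2 j) z (p.1, t).
Proof.
transitivity (\sum_(p' : P * m.+1.-tuple P |
    (p'.1 == p.1) && (face p'.2 j == face p.2 j)) z (p'.1, p'.2)).
  by apply: eq_big => [p'|[]//]; rewrite same_but_face.
rewrite -(pair_big_dep (fun x => x == p.1)
  (fun x t => face t j == face p.2 j) (fun x t => z (x, t))) /=.
by rewrite big_pred1_eq.
Qed.

(** Lengths increase by one along a full chain, so a face reveals which length has been removed. *)
Lemma face_full_chain_inj m (p p' : P * m.+1.-tuple P) j j' :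
  (m.+2 + (if d then r else 0) = K + (d : nat))%N ->
  full_chain d r p -> full_chain d r p' -> face p.2 j = face p'.2 j' -> j = j'.
Proof.
move=> nE; wlog lejj : p p' j j' / (j <= j')%N => [H|].
  case/orP: (leq_total j j') => le gp gp' e; first exact: (H p p').
  by apply/esym/(H p' p).
move=> gp gp' e; apply: val_inj; apply/eqP; rewrite eqn_leq lejj leqNgt.
apply/negP => ltjj; have ltm : (j < m)%N.
  by apply: leq_trans ltjj _; rewrite -ltnS; exact: (ltn_ord j').
have /(congr1 (fun t : m.-tuple P => tnth t (Ordinal ltm))) := e.
rewrite !tnth_mktuple => /(congr1 (fun x => size (word x))).
rewrite (full_chain_size rk nE _ gp) (full_chain_size rk nE _ gp') /= /bump leqnn.
by rewrite leqNgt ltjj /=; lia.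
Qed.

(** By [face_full_chain_inj] all the full chains with a given face miss the same index. Each
    coefficient of the boundary is therefore, up to sign, a single sum over fillers. *)
Lemma cycle_fun_facewise i (z : {ffun P * i.-1.-tuple P -> F}) :
  (i.-1.+1 + (if d then r else 0) = K + (d : nat))%N ->
  cycle_fun S (@half_interval A k d) z <-> facewise d r z.
Proof.
case: i z => [|[|m]] z nE; rewrite /cycle_fun /facewise -(slice_supp z nE) /slice /=.
(* In degrees -2 and -1 the only tuple is empty, and there is no gap to fill. *)
- by split=> [H|[] //]; split=> // p [].
- by split=> [H|[] //]; split=> // p [].
have nE' : (m.+2 + (if d then r else 0) = K + (d : nat))%N by [].
split=> [[z0 zc]|[/[dup] /(slice_supp z nE') zg [z0 zc] fz]].
  have zg : forall p, z p != 0 -> full_chain d r p.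
    apply/(slice_supp z nE'); split=> // x Sx.
    by apply: submx_trans (zc x Sx) (capmxSl _ _).
  split=> [|[x t0] j gp]; first by apply/(slice_supp z nE').
  have Sx : x \in S by move: gp; rewrite -validE // => /andP[].
  have /sub_kermxP bz := submx_trans (zc x Sx) (capmxSr _ _).
  have := boundaryP (funrv [ffun t => z (x, t)]) (face t0 j); rewrite bz rvfun0 ffunE funrvK.
  rewrite (bigD1 j) //= [X in _ + X]big1 ?addr0 => [|j' ne].
    move/esym/eqP; rewrite mulf_eq0 expf_eq0 oppr_eq0 oner_eq0 andbF /= => /eqP e.
    by rewrite sum_same_but /= -[RHS]e; apply: eq_bigr => t _; rewrite ffunE.
  rewrite big1 ?mulr0 // => t /eqP ft; rewrite ffunE; apply/eqP.
  apply: contraNT ne => /zg gt; apply/eqP.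
  exact: (face_full_chain_inj nE' gt gp ft).
split=> // x Sx; rewrite sub_capmx zc //=; apply/sub_kermxP.
apply: (can_inj (@rvfunK F _)); apply/ffunP => f; rewrite boundaryP funrvK rvfun0 ffunE.
rewrite big1 // => j _.
have [/existsP[t0 /andP[/eqP ft0 nz]]|] :=
    boolP [exists t, (face t j == f) && (z (x, t) != 0)].
  have := fz (x, t0) j (zg _ nz); rewrite sum_same_but /= ft0 => e.
  by under eq_bigr do rewrite ffunE; rewrite e mulr0.
rewrite negb_exists => /forallP nz; rewrite big1 ?mulr0 // => t ft.
by have := nz t; rewrite ft negbK ffunE => /eqP.
Qed.

End CycleFaces.

(** * Homology sums as sums of tensor products *)

Section WhitneyModels.
Local Open Scope ring_scope.
Variables (F : fieldType) (A : finType) (k m0 : nat).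
Hypothesis cardA : #|A| = m0.+2.
Hypothesis card0 : m0.+2%:R != 0 :> F.
Notation P := (subword_poset A k).
Variables (d : bool) (r : nat).
Hypothesis rk : (0 < r <= k)%N.
Let K := if d then k else r.

Lemma delta_rename (g : {perm A}) h (u : seq (bool * A)) :
  delta h [seq (x.1, g x.2) | x <- u] =
  delta (fun u => h [seq (x.1, g x.2) | x <- u] : F) u.
Proof. by elim: u h => //= x u IH h; rewrite IH. Qed.

Lemma letters_rename (g : {perm A}) (u : seq (bool * A)) :
  letters [seq (x.1, g x.2) | x <- u] = map g (letters u).
Proof. by rewrite /letters -!map_comp. Qed.

Lemma chain_coef_rename (g : {perm A}) ys (u : seq (bool * A)) :
  chain_coef F (map (map g) ys) [seq (x.1, g x.2) | x <- u] = chain_coef F ys u.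
Proof.
rewrite /chain_coef; elim: ys u => [|y ys IH] u /=.
  by rewrite /unmark /marks -map_comp.
rewrite delta_rename; apply: eq_delta => u' _.
by rewrite IH letters_rename (inj_eq (inj_map (@perm_inj _ g))).
Qed.

Lemma cycle_coef_rename (g : {perm A}) c (u : seq (bool * A)) :
  cycle_coef F (map (map g) c) [seq (x.1, g x.2) | x <- u] = cycle_coef F c u.
Proof.
case: c => //= w ys.
by rewrite chain_coef_rename letters_rename (inj_eq (inj_map (@perm_inj _ g))).
Qed.

(** The kernel [coef] is equivariant because the coefficients depend only on equalities between
    letters. It carries the functions on marked words with [i.-1 + ~~ d] marks bijectively onto the
    cycles. *)
Lemma hom_sum_facewise_rsim i (S_act : forall g, {in rank_set (@subword_rank A k) r,
      forall x, rename_action A k x g \in rank_set (@subword_rank A k) r})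
    (Q_act : forall g, {in rank_set (@subword_rank A k) r, forall x,
      {in half_interval d x, forall y,
        rename_action A k y g \in half_interval d (rename_action A k x g)}}) :
  (i.-1.+1 + (if d then r else 0) = K + (d : nat))%N ->
  {in rank_set (@subword_rank A k) r, forall x, boundaries F i (half_interval d x) = 0} ->
  mx_rsim (hom_sum F (@rename_mono A k) i S_act Q_act)
    (\big[dadd_grepr/grepr0]_(b <- masks K (i.-1 + ~~ d)) Wrep F A m0 (free_head d b)).
Proof.
move=> nE b0.
have M1 := hom_sum_model (@rename_mono A k) S_act Q_act b0.
have allM : all (fun b => size b == K) (masks K (i.-1 + ~~ d)).
  by apply/allP => b; rewrite mem_masks => /andP[].
have M2 := Wrep_sum_model cardA card0 d (uniq_masks _ _) allM.
apply: model_rsim M1 _.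
  exact: chain_act_bij.
apply: (model_push (s := @mword_act A K) (K := @coef F A k d r i.-1) _ M2).
- exact: mword_act_bij.
- move=> g u [x t]; rewrite /coef.
  have efull : full d (chain_act (rename_action A k) g (x, t)) =
      map (fun y => rename y g) (full d (x, t)).
    by rewrite /full /chain_act; case: d; rewrite //= map_rcons; congr (_ :: _);
      congr Some; apply: val_inj.
  rewrite efull all_map; congr (_ * _).
    by congr (nat_of_bool _)%:R; apply: eq_all => -[].
  rewrite -[RHS](cycle_coef_rename g) /words map_rev -!map_comp; congr cycle_coef; congr rev.
  by apply: eq_map => -[].
- exact: (push_inj rk nE).
move=> z'; rewrite cycle_fun_facewise //; split; first exact: facewise_push.
by move=> [z [mz ->]]; apply: push_facewise.
Qed.

End WhitneyModels.

(** * Direct sums of tensor powers *)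

Section RepSums.
Local Open Scope ring_scope.
Variables (F : fieldType) (gT : finGroupType).
Notation rep := (representation F [set: gT]).
Implicit Types r : rep.
Notation "r1 ~= r2" := (mx_rsim r1 r2) (at level 70).

Lemma rsim_inv r1 r2 (B : 'M_(rdegree r1, rdegree r2)) B' :
  B *m B' = 1%:M -> B' *m B = 1%:M -> (forall g, r1 g *m B = B *m r2 g) -> r1 ~= r2.
Proof.
move=> BB' B'B eqB.
have f1 : row_free B by apply/row_freeP; exists B'.
have f2 : row_free B' by apply/row_freeP; exists B.
exists B => //; apply/eqP; rewrite eqn_leq.
have := rank_leq_col B; rewrite (eqP f1) => ->.
by have := rank_leq_col B'; rewrite (eqP f2) => ->.
Qed.

Lemma rsim_lin r1 r2 (f : 'rV_(rdegree r1) -> 'rV_(rdegree r2)) f' :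
  (forall a u v, f (a *: u + v) = a *: f u + f v) -> cancel f f' -> cancel f' f ->
  (forall g v, f (v *m r1 g) = f v *m r2 g) -> r1 ~= r2.
Proof.
move=> linf fK f'K eqf; have [B fB] := linear_mx linf.
have linf' a u v : f' (a *: u + v) = a *: f' u + f' v.
  by apply: (can_inj fK); rewrite linf !f'K.
have [B' fB'] := linear_mx linf'.
apply: (@rsim_inv _ _ B B'); last move=> g;
  by apply/row_matrixP => i; rewrite !rowE ?mulmxA ?fB ?fB' ?mulmx1 ?fK ?f'K ?eqf.
Qed.

Lemma rsimE r1 r2 : r1 ~= r2 ->
  exists (B : 'M_(rdegree r1, rdegree r2)) B',
  [/\ B *m B' = 1%:M, B' *m B = 1%:M & forall g, r1 g *m B = B *m r2 g].
Proof.
case=> B e fB eB; have [B' BB'] := row_freeP fB.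
exists B, B'; split=> //; last by move=> g; apply: eB; rewrite inE.
by move: B B' {fB eB} BB'; rewrite e => B B' /mulmx1C.
Qed.

Lemma rsim_dadd r1 r1' r2 r2' : r1 ~= r1' -> r2 ~= r2' ->
  dadd_grepr r1 r2 ~= dadd_grepr r1' r2'.
Proof.
move=> /rsimE[B1 [C1 [BC1 CB1 e1]]] /rsimE[B2 [C2 [BC2 CB2 e2]]].
apply: (@rsim_inv (dadd_grepr r1 r2) (dadd_grepr r1' r2')
  (block_mx B1 0 0 B2) (block_mx C1 0 0 C2)) => [||g] /=;
  by rewrite !mulmx_block !(mulmx0, mul0mx, addr0, add0r) ?BC1 ?BC2 ?CB1 ?CB2
     ?e1 ?e2 -?scalar_mx_block.
Qed.

Lemma mul_row_block_diag m1 m2 n1 n2 (v : 'rV[F]_(m1 + m2)) (X : 'M_(m1, n1)) (Y : 'M_(m2, n2)) :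
  v *m block_mx X 0 0 Y = row_mx (lsubmx v *m X) (rsubmx v *m Y).
Proof. by rewrite -{1}(hsubmxK v) mul_row_block !mulmx0 addr0 add0r. Qed.

Lemma rsim_daddC r1 r2 : dadd_grepr r1 r2 ~= dadd_grepr r2 r1.
Proof.
apply: (@rsim_lin (dadd_grepr r1 r2) (dadd_grepr r2 r1)
  (fun v => row_mx (rsubmx v) (lsubmx v)) (fun v => row_mx (rsubmx v) (lsubmx v))).
- by move=> a u v; rewrite !linearP /= scale_row_mx add_row_mx.
- by move=> v; rewrite row_mxKl row_mxKr hsubmxK.
- by move=> v; rewrite row_mxKl row_mxKr hsubmxK.
by move=> g v; rewrite /= !mul_row_block_diag !row_mxKl !row_mxKr.
Qed.

Lemma rsim_daddA r1 r2 r3 :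
  dadd_grepr r1 (dadd_grepr r2 r3) ~= dadd_grepr (dadd_grepr r1 r2) r3.
Proof.
pose D1 := rdegree r1; pose D2 := rdegree r2; pose D3 := rdegree r3.
apply: (@rsim_lin (dadd_grepr r1 (dadd_grepr r2 r3)) (dadd_grepr (dadd_grepr r1 r2) r3)
  (fun v : 'rV_(D1 + (D2 + D3)) => row_mx (row_mx (lsubmx v) (lsubmx (rsubmx v)))
              (rsubmx (rsubmx v)))
  (fun v : 'rV_(D1 + D2 + D3) => row_mx (lsubmx (lsubmx v))
              (row_mx (rsubmx (lsubmx v)) (rsubmx v)))).
- by move=> a u v; rewrite !linearP /= !scale_row_mx !add_row_mx.
- by move=> v; rewrite !(row_mxKl, row_mxKr) !hsubmxK.
- by move=> v; rewrite !(row_mxKl, row_mxKr) !hsubmxK.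
move=> g v; rewrite /=.
by rewrite !(mul_row_block_diag, row_mxKl, row_mxKr).
Qed.

Lemma rsim_dadd0 r : dadd_grepr grepr0 r ~= r.
Proof.
apply: (@rsim_lin (dadd_grepr grepr0 r) r (@rsubmx F 1 0 (rdegree r)) (fun v => row_mx 0 v)).
- by move=> a u v; rewrite linearP.
- by move=> v; rewrite -[RHS](@hsubmxK F 1 0); congr row_mx; rewrite [RHS]thinmx0.
- by move=> v; rewrite (@row_mxKr F 1 0).
by move=> g v; rewrite /= (@mul_row_block_diag 0 _ 0) (@row_mxKr F 1 0).
Qed.

Lemma rsim_deg0 r1 r2 : rdegree r1 = 0%N -> rdegree r2 = 0%N -> r1 ~= r2.
Proof.
move=> e1 e2; apply: (@rsim_inv _ _ 0 0) => [||g]; rewrite ?mul0mx ?mulmx0 //.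
  by apply/matrixP => -[i lti]; exfalso; rewrite e1 in lti.
by apply/matrixP => -[i lti]; exfalso; rewrite e2 in lti.
Qed.

Lemma rsim_tensor r1 r1' r2 r2' : r1 ~= r1' -> r2 ~= r2' ->
  tensor r1 r2 ~= tensor r1' r2'.
Proof.
move=> /rsimE[B1 [C1 [BC1 CB1 e1]]] /rsimE[B2 [C2 [BC2 CB2 e2]]].
by apply: (@rsim_inv (tensor r1 r2) (tensor r1' r2') (tprod B1 B2) (tprod C1 C2)) => [||g] /=;
  rewrite -!tprodE ?BC1 ?BC2 ?CB1 ?CB2 ?e1 ?e2 ?tprod1.
Qed.

Lemma mul_tensor r1 r2 (v : 'rV_(rdegree r1 * rdegree r2)) g :
  v *m tensor r1 r2 g = tvec ((r1 g)^T *m tunvec v *m r2 g).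
Proof. by rewrite -{1}(tunvecK v) tvec_tprod. Qed.

Lemma rsim_tensorDr r r1 r2 :
  tensor r (dadd_grepr r1 r2) ~= dadd_grepr (tensor r r1) (tensor r r2).
Proof.
pose D := rdegree r; pose D1 := rdegree r1; pose D2 := rdegree r2.
apply: (@rsim_lin (tensor r (dadd_grepr r1 r2)) (dadd_grepr (tensor r r1) (tensor r r2))
  (fun v : 'rV_(D * (D1 + D2)) => row_mx (tvec (lsubmx (tunvec v))) (tvec (rsubmx (tunvec v))))
  (fun v : 'rV_(D * D1 + D * D2) =>
     tvec (row_mx (tunvec (lsubmx v)) (tunvec (rsubmx v))))).
- by move=> a u v; rewrite tunvec_lin !linearP /= !tvec_lin scale_row_mx add_row_mx.
- by move=> v; rewrite row_mxKl row_mxKr !tvecK hsubmxK tunvecK.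
- by move=> v; rewrite tvecK row_mxKl row_mxKr !tunvecK hsubmxK.
move=> g v; rewrite mul_tensor tvecK [RHS]mul_row_block_diag row_mxKl row_mxKr.
rewrite -[_ *m tprod _ _]/(_ *m tensor r r1 g) mul_tensor.
rewrite -[_ *m tprod _ _]/(_ *m tensor r r2 g) mul_tensor !tvecK /=.
rewrite -{1 2}(hsubmxK (tunvec v)) mul_mx_row mul_row_block !mulmx0 addr0 add0r.
by rewrite row_mxKl row_mxKr.
Qed.

Lemma rsim_tensorDl r r1 r2 :
  tensor (dadd_grepr r1 r2) r ~= dadd_grepr (tensor r1 r) (tensor r2 r).
Proof.
pose D := rdegree r; pose D1 := rdegree r1; pose D2 := rdegree r2.
apply: (@rsim_lin (tensor (dadd_grepr r1 r2) r) (dadd_grepr (tensor r1 r) (tensor r2 r))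
  (fun v : 'rV_((D1 + D2) * D) => row_mx (tvec (usubmx (tunvec v))) (tvec (dsubmx (tunvec v))))
  (fun v : 'rV_(D1 * D + D2 * D) =>
     tvec (col_mx (tunvec (lsubmx v)) (tunvec (rsubmx v))))).
- by move=> a u v; rewrite tunvec_lin !linearP /= !tvec_lin scale_row_mx add_row_mx.
- by move=> v; rewrite row_mxKl row_mxKr !tvecK vsubmxK tunvecK.
- by move=> v; rewrite tvecK col_mxKu col_mxKd !tunvecK hsubmxK.
move=> g v; rewrite mul_tensor tvecK [RHS]mul_row_block_diag row_mxKl row_mxKr.
rewrite -[_ *m tprod _ _]/(_ *m tensor r1 r g) mul_tensor.
rewrite -[_ *m tprod _ _]/(_ *m tensor r2 r g) mul_tensor !tvecK /=.
rewrite -{1 2}(vsubmxK (tunvec v)) tr_block_mx !trmx0 mul_block_col mul_col_mx.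
by rewrite !mul0mx addr0 add0r col_mxKu col_mxKd.
Qed.

Lemma rsim_tensor1 r1 r : is_triv r1 -> tensor r1 r ~= r.
Proof.
move=> [deg1 act1]; pose D1 := rdegree r1; pose D := rdegree r.
have e1 : (const_mx 1 : 'rV[F]_D1) *m (const_mx 1 : 'cV_D1) = 1%:M.
  apply/matrixP => i j; rewrite !mxE !ord1 eqxx.
  by under eq_bigr do rewrite !mxE mulr1; rewrite sumr_const card_ord /D1 deg1.
have e2 : (const_mx 1 : 'cV[F]_D1) *m (const_mx 1 : 'rV_D1) = 1%:M.
  by move: e1; rewrite /D1 deg1 => /mulmx1C.
apply: (@rsim_lin (tensor r1 r) r
  (fun v : 'rV_(D1 * D) => (const_mx 1 : 'rV_D1) *m tunvec v)
  (fun u : 'rV_D => tvec ((const_mx 1 : 'cV_D1) *m u))).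
- by move=> a u v; rewrite tunvec_lin mulmxDr -scalemxAr.
- by move=> v; rewrite mulmxA e2 mul1mx tunvecK.
- by move=> u; rewrite tvecK mulmxA e1 mul1mx.
by move=> g v; rewrite mul_tensor tvecK act1 trmx1 mul1mx mulmxA.
Qed.

Definition sum_rep (I : Type) (s : seq I) (R : I -> rep) :=
  \big[dadd_grepr/grepr0]_(i <- s) R i.

Lemma sum_rep_cat (I : Type) (s1 s2 : seq I) (R : I -> rep) :
  sum_rep (s1 ++ s2) R ~= dadd_grepr (sum_rep s1 R) (sum_rep s2 R).
Proof.
rewrite /sum_rep; elim: s1 => [|i s1 IH] /=.
  rewrite [\big[_/_]_(i <- [::]) _]big_nil; exact/mx_rsim_sym/rsim_dadd0.
rewrite !big_cons; apply: mx_rsim_trans (rsim_daddA _ _ _).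
exact: rsim_dadd (mx_rsim_refl _) IH.
Qed.

Lemma sum_rep_perm (I : eqType) (s1 s2 : seq I) (R : I -> rep) :
  perm_eq s1 s2 -> sum_rep s1 R ~= sum_rep s2 R.
Proof.
elim: s1 s2 => [|i s1 IH] s2 e.
  by rewrite perm_sym in e; rewrite (perm_nilP e); apply: mx_rsim_refl.
have hi : i \in s2 by rewrite -(perm_mem e) mem_head.
case/splitPr: hi e => p1 p2 e.
have {}e : perm_eq s1 (p1 ++ p2).
  by rewrite -(perm_cons i) (perm_trans e) // perm_catC /= perm_cons perm_catC.
apply: mx_rsim_trans (mx_rsim_sym (sum_rep_cat _ _ _)).
rewrite /sum_rep !big_cons.
have := rsim_dadd (mx_rsim_refl (R i)) (mx_rsim_trans (IH _ e) (sum_rep_cat _ _ _)).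
move/mx_rsim_trans; apply; apply: mx_rsim_trans (rsim_daddA _ _ _) _.
apply: mx_rsim_trans (rsim_dadd (rsim_daddC _ _) (mx_rsim_refl _)) _.
exact: mx_rsim_sym (rsim_daddA _ _ _).
Qed.

Lemma tensor_sum_rep (I : Type) (s : seq I) (R : I -> rep) r :
  tensor r (sum_rep s R) ~= sum_rep s (fun i => tensor r (R i)).
Proof.
rewrite /sum_rep; elim: s => [|i s IH].
  by rewrite !big_nil; apply: rsim_deg0 => //=; rewrite muln0.
rewrite !big_cons; apply: mx_rsim_trans (rsim_tensorDr _ _ _) _.
exact: rsim_dadd (mx_rsim_refl _) IH.
Qed.

Variable S : rep.

(* [r] is a direct sum of tensor powers of [S], with multiplicities given by the
   coefficients of [p]. *)
Definition has_gf r (p : {poly int}) := exists s : seq nat,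
  p = \sum_(j <- s) 'X^j /\ r ~= sum_rep s (tensor_power S).

(** Coefficients are taken in the integers, so that they count the exponents faithfully: equal
    polynomials come from lists that are permutations of each other. *)
Lemma has_gf_rsim r1 r2 p1 p2 : has_gf r1 p1 -> has_gf r2 p2 -> p1 = p2 -> r1 ~= r2.
Proof.
move=> [s1 [-> e1]] [s2 [-> e2]] e12; apply: mx_rsim_trans e1 _.
apply: mx_rsim_trans (mx_rsim_sym e2); apply: sum_rep_perm.
have countE (s : seq nat) i : (\sum_(j <- s) 'X^j : {poly int})`_i = (count_mem i s)%:R.
  rewrite coef_sum; elim: s => [|j s IH]; rewrite ?big_nil // big_cons IH coefXn /=.
  by rewrite natrD eq_sym.
apply/allP => i _ /=; apply/eqP.
by have /polyP/(_ i) := e12; rewrite !countE => /eqP; rewrite Num.Theory.eqr_nat => /eqP.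
Qed.

Lemma has_gf0 : has_gf grepr0 0.
Proof.
exists [::]; rewrite /sum_rep !big_nil; split=> //; exact: mx_rsim_refl.
Qed.

Lemma has_gf_dadd r1 r2 p1 p2 : has_gf r1 p1 -> has_gf r2 p2 ->
  has_gf (dadd_grepr r1 r2) (p1 + p2).
Proof.
move=> [s1 [-> e1]] [s2 [-> e2]]; exists (s1 ++ s2); rewrite big_cat; split=> //.
exact: mx_rsim_trans (rsim_dadd e1 e2) (mx_rsim_sym (sum_rep_cat _ _ _)).
Qed.

Lemma has_gf_sum (I : Type) (s : seq I) (R : I -> rep) (p : I -> {poly int}) :
  (forall i, has_gf (R i) (p i)) ->
  has_gf (\big[dadd_grepr/grepr0]_(i <- s) R i) (\sum_(i <- s) p i).
Proof.
move=> e; elim: s => [|i s IH]; rewrite ?big_nil ?big_cons; first exact: has_gf0.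
exact: has_gf_dadd.
Qed.

Lemma has_gf_muln r p n : has_gf r p -> has_gf (muln_grepr r n) (p *+ n).
Proof.
move=> e; rewrite -[n in p *+ n]card_ord -sumr_const /muln_grepr.
exact: has_gf_sum.
Qed.

Lemma has_gf_ext r1 r2 p : r1 ~= r2 -> has_gf r2 p -> has_gf r1 p.
Proof.
by move=> e [s [ep e']]; exists s; split=> //; apply: mx_rsim_trans e e'.
Qed.

Lemma has_gf_power j : has_gf (tensor_power S j) 'X^j.
Proof.
exists [:: j]; rewrite /sum_rep !big_cons !big_nil addr0; split=> //.
exact: mx_rsim_trans (mx_rsim_sym (rsim_dadd0 _)) (rsim_daddC _ _).
Qed.

Lemma has_gf_tensor r p : has_gf r p -> has_gf (tensor S r) ('X * p).
Proof.
move=> [s [-> e]]; exists (map succn s); rewrite big_map mulr_sumr.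
split; first by apply: eq_bigr => j _; rewrite exprS.
apply: mx_rsim_trans (rsim_tensor (mx_rsim_refl S) e) _.
apply: mx_rsim_trans (tensor_sum_rep _ _ _) _.
by rewrite /sum_rep big_map; apply: mx_rsim_refl.
Qed.

Lemma has_gf_tensorD T r p : is_triv T -> has_gf r p ->
  has_gf (tensor (dadd_grepr S T) r) ((1 + 'X) * p).
Proof.
move=> tT hr; apply: has_gf_ext (rsim_tensorDl _ _ _) _.
rewrite mulrDl mul1r addrC; apply: has_gf_dadd (has_gf_tensor hr) _.
exact: has_gf_ext (rsim_tensor1 _ tT) hr.
Qed.

End RepSums.

(** * Generating polynomials of tensor products *)

Section WordReps.
Local Open Scope ring_scope.
Variables (F : fieldType) (A : finType) (m : nat).
Hypothesis cardA : #|A| = m.+2.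
Hypothesis card0 : m.+2%:R != 0 :> F.
Notation S := (Specht F A [:: m.+1; 1%N]).
Notation T := (Specht F A [:: m.+2]).
Notation Wrep := (Wrep F A m).

Lemma Wrep_gf b : has_gf S (Wrep b) ('X ^+ count id b * (1 + 'X) ^+ count negb b).
Proof.
elim: b => [|[] b IH] /=.
- by rewrite mulr1; apply: (has_gf_power S 0).
- by rewrite add0n exprS -mulrA; apply: has_gf_tensor.
by rewrite add0n exprS mulrCA; apply: (has_gf_tensorD (Specht_triv F cardA)).
Qed.

Lemma Wrep_true n : Wrep (nseq n true) = tensor_power S n.
Proof. by elim: n => //= n ->. Qed.

Lemma Wrep_false n : Wrep (nseq n false) = tensor_power (dadd_grepr S T) n.
Proof. by elim: n => //= n ->. Qed.

Lemma on_seq_cat (X : finType) k k' (z : {ffun (k + k').-tuple X -> F}) (w : k.-tuple X) w' :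
  on_seq [ffun w' : k'.-tuple X => z [tuple of w ++ w']] w' = on_seq z (w ++ w').
Proof.
have [sz|ne] := boolP (size w' == k').
  rewrite -[w']/(val (Tuple sz)) on_seqE ffunE.
  by rewrite -[val w ++ _]/(val [tuple of w ++ Tuple sz]) on_seqE.
by rewrite /on_seq !insubN // size_cat size_tuple eqn_add2l.
Qed.

Lemma on_seq_catl (X : finType) k k' (z : {ffun (k + k').-tuple X -> F}) w (w' : k'.-tuple X) :
  on_seq [ffun w : k.-tuple X => z [tuple of w ++ w']] w = on_seq z (w ++ w').
Proof.
have [sz|ne] := boolP (size w == k).
  rewrite -[w]/(val (Tuple sz)) on_seqE ffunE.
  by rewrite -[val _ ++ _]/(val [tuple of Tuple sz ++ w']) on_seqE.
by rewrite /on_seq !insubN // size_cat size_tuple eqn_add2r.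
Qed.

(** Associativity of the tensor product, read on models: both sides are functions on the
    concatenated words with the same zero sums. *)
Lemma Wrep_cat b b' : mx_rsim (tensor (Wrep b) (Wrep b')) (Wrep (b ++ b')).
Proof.
set k := size b; set k' := size b'.
have szl (w : (k + k').-tuple A) : size (take k w) == k.
  by rewrite size_takel ?size_tuple // leq_addr.
have szr (w : (k + k').-tuple A) : size (drop k w) == k'.
  by rewrite size_drop size_tuple addKn.
apply: (@model_rsim _ _ _ (@word_act A (k + k'))); first exact: word_act_bij.
  apply: (@model_tensor _ _ _ _ _ _ _ _ _ _ _ _ _
    (fun (w : k.-tuple A) (w' : k'.-tuple A) => [tuple of w ++ w'])
    (fun w => Tuple (szl w)) (fun w => Tuple (szr w)) _ _ _ _
    (Wrep_model cardA card0 (erefl k)) (Wrep_model cardA card0 (erefl k'))).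
  - by move=> w w'; apply: val_inj; rewrite /= take_size_cat ?size_tuple.
  - by move=> w w'; apply: val_inj; rewrite /= drop_size_cat ?size_tuple.
  - by move=> w; apply: val_inj; rewrite /= cat_take_drop.
  - by move=> g w w'; apply: val_inj; rewrite /= map_cat.
  exact: (fun z => iff_refl _).
apply: (model_ext (Wrep_model cardA card0 (size_cat b b'))) => z.
split=> [zs|[z1 z2] w0 w1 sz nb].
  split=> [w' w0 w1 sz nb|w w0 w1 sz nb].
    under eq_bigr do rewrite on_seq_catl -catA cat_cons.
    apply: zs; first by rewrite size_cat size_tuple; rewrite /k /k' in sz *; lia.
    by rewrite nth_cat (_ : (size w0 < size b)%N) //; rewrite /k in sz; lia.
  under eq_bigr do rewrite on_seq_cat catA.
  apply: zs; first by rewrite size_cat size_tuple; rewrite /k /k' in sz *; lia.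
  by rewrite nth_cat size_cat size_tuple ltnNge leq_addr /= addKn.
have [lt|ge] := ltnP (size w0) k.
  have s1 : size (take (k - (size w0).+1) w1) = (k - (size w0).+1)%N.
    by rewrite size_takel //; lia.
  have s2 : size (drop (k - (size w0).+1) w1) == k'.
    by rewrite size_drop; apply/eqP; lia.
  have := z1 (Tuple s2) w0 (take (k - (size w0).+1) w1).
  rewrite s1 => H; rewrite -[RHS]H; last 2 first.
  - by lia.
  - by move: nb; rewrite nth_cat lt.
  by apply: eq_bigr => a _; rewrite on_seq_catl /= -catA cat_cons cat_take_drop.
have s1 : size (take k w0) == k by rewrite size_takel.
have := z2 (Tuple s1) (drop k w0) w1; rewrite size_drop => H; rewrite -[RHS]H; last 2 first.
- by lia.
- by move: nb; rewrite nth_cat ltnNge ge.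
by apply: eq_bigr => a _; rewrite on_seq_cat /= catA cat_take_drop.
Qed.

End WordReps.

Section DegreeMinusTwo.
Local Open Scope ring_scope.
Variables (F : fieldType) (d : Order.disp_t) (P : finPOrderType d).
Variables (gT : finGroupType) (to : {action gT &-> P}).
Hypothesis to_mono : forall g, {mono to^~ g : x y / (x <= y)%O}.
Variables (S : {set P}) (Q : P -> {set P}) (x0 : P).
Hypothesis S_act : forall g, {in S, forall x, to x g \in S}.
Hypothesis Q_act : forall g,
  {in S, forall x, {in Q x, forall y, to y g \in Q (to x g)}}.

(** In degree -2 the module attached to each element is spanned by the empty tuple, so one fixed
    point gives one trivial line. *)
Lemma hom_sum0_triv (r : representation F [set: gT]) :
  S = [set x0] -> is_triv r -> mx_rsim (hom_sum F to_mono 0 S_act Q_act) r.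
Proof.
move=> S1 tr; pose c := [ffun p : P * 0.-1.-tuple P => (p.1 == x0)%:R : F].
have M1 := @hom_sum_model F _ _ _ _ to_mono S Q 0 S_act Q_act (fun _ _ => erefl).
apply: model_rsim (chain_act_bij to 0) M1 _.
have Sx0 : x0 \in S by rewrite S1 inE.
have fix0 g : to x0 g = x0 by have := S_act g Sx0; rewrite S1 inE => /eqP.
apply: (model_ext (model_triv (c := c) tr _ _)).
- by exists (x0, [tuple]); rewrite ffunE eqxx oner_eq0.
- by move=> g [x t]; rewrite !ffunE /= -{1}(fix0 g) (inj_eq (act_inj to g)).
move=> z; split=> [[a ->]|[z0 _]].
  split=> [x nS|x Sx]; last by apply/chains_subE => t _; rewrite tuple0.
  apply/rowP => j; rewrite !mxE !ffunE /=; case: eqP => [e|]; last by rewrite mulr0.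
  by rewrite e Sx0 in nS.
exists (z (x0, [tuple])); apply/ffunP => -[x t]; rewrite !ffunE /= [t]tuple0.
have [->|ne] := eqVneq x x0; first by rewrite mulr1.
have nS : x \notin S by rewrite S1 inE.
by have /rowP/(_ (enum_rank [tuple])) := z0 x nS; rewrite !mxE ffunE enum_rankK mulr0.
Qed.

End DegreeMinusTwo.

Lemma masks_full n : masks n n = [:: nseq n true].
Proof.
elim: n => //= n ->; rewrite [masks n n.+1]size0nil //.
by rewrite size_masks bin_small.
Qed.

Lemma free_headT b : free_head true b = b.
Proof. by case: b. Qed.

(** * The two Whitney homologies *)

Section Whitney.
Local Open Scope ring_scope.
Variables (F : fieldType) (A : finType) (k m : nat).
Hypothesis cardA : #|A| = m.+2.
Hypothesis card0 : m.+2%:R != 0 :> F.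
Notation S := (Specht F A [:: m.+1; 1%N]).
Notation T := (Specht F A [:: m.+2]).
Notation P := (subword_poset A k).

(** A chain with [i] elements would exceed the available lengths by one; this is why there are no
    boundaries in the degree of the Whitney homology. *)
Lemma chains_half_interval (d : bool) r i x :
  (0 < r <= k)%N -> (i + (if d then r else 0) = (if d then k else r) + (d : nat))%N ->
  x \in rank_set (@subword_rank A k) r -> chains F i (half_interval d x) = 0.
Proof.
move=> rk iE Sx; apply/eqP; rewrite -submx0; apply/rV_subP => v sv.
rewrite submx0; apply/eqP/(can_inj (@rvfunK F _))/ffunP => t; rewrite rvfun0 [RHS]ffunE.
have sv' := proj1 (chains_subE _ _) sv t.
apply/eqP; apply: contraT => /sv'/andP[st Qt].
have : valid d r (x, t) by rewrite /valid Sx st.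
rewrite valid_sorted // /full => /and3P[/eqP rx sp lt].
case: d iE {sv sv' Qt} sp lt => iE sp lt.
  have := path_lt_size sp lt; have := word_size (last x t).
  move: sp rx => /= /andP[sx _]; rewrite rank_word // => ->.
  by rewrite size_tuple; lia.
have := path_lt_size sp lt; rewrite last_rcons size_rcons size_tuple /=.
move: sp rx; rewrite /= all_rcons => /andP[sx _]; rewrite rank_word // => ->.
by lia.
Qed.

Lemma Whitney_gf (d : bool) r i S_act Q_act :
  (0 < r <= k)%N -> (i.-1.+1 + (if d then r else 0) = (if d then k else r) + (d : nat))%N ->
  (0 < i)%N ->
  has_gf S (@hom_sum F _ P _ _ (@rename_mono A k) (rank_set (@subword_rank A k) r)
      (half_interval d) i S_act Q_act)
    (\sum_(b <- masks (if d then k else r) (i.-1 + ~~ d))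
       'X ^+ count id (free_head d b) * (1 + 'X) ^+ count negb (free_head d b)).
Proof.
move=> rk nE i0; apply: has_gf_ext (hom_sum_facewise_rsim cardA card0 rk S_act Q_act nE _) _.
  move=> x Sx; case: i i0 nE {S_act Q_act} => // i _ nE.
  by rewrite /= (chains_half_interval rk nE Sx) mul0mx genmx0.
by apply: has_gf_sum => b; apply: Wrep_gf.
Qed.

Lemma tensor_powers_gf a b : has_gf S
  (tensor (tensor_power S a) (tensor_power (dadd_grepr S T) b)) ('X ^+ a * (1 + 'X) ^+ b).
Proof.
rewrite -Wrep_true -Wrep_false.
apply: has_gf_ext (Wrep_cat cardA card0 _ _) _.
have := Wrep_gf F cardA (nseq a true ++ nseq b false).
by rewrite !count_cat !count_nseq /= !mul1n !mul0n addn0 add0n.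
Qed.

(** All letters get deleted, so there is a single mask; its first letter is free, which gives
    ['X ^+ (i - 1) * (1 + 'X)]. *)
Lemma WH_rsim i : (1 <= i <= k)%N ->
  mx_rsim (subword_WH F A k i) (dadd_grepr (tensor_power S i) (tensor_power S (i - 1))).
Proof.
move=> ik; apply: (has_gf_rsim (S := S) (@Whitney_gf false i i _ _ ik _ _)
  (has_gf_dadd (has_gf_power _ _) (has_gf_power _ _))) => //; try by case: i ik.
case: i ik => // i _; rewrite [masks _ _](_ : _ = [:: nseq i.+1 true]).
  rewrite big_seq1 /= !count_nseq /= mul1n mul0n addn0 expr1 add0n subn1 exprS.
  by rewrite mulrDr mulr1 addrC [_ * 'X]mulrC.
by rewrite addn1; apply: masks_full.
Qed.

Lemma dual_WH_rsim i : (1 <= i <= k)%N ->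
  mx_rsim (subword_dual_WH F A k (k + 1 - i))
    (muln_grepr (tensor (tensor_power S (k - i)) (tensor_power (dadd_grepr S T) i)) 'C(k, i)).
Proof.
move=> ik; pose r := (subword_rank (\top%O : P) - (k + 1 - i))%N.
have ri : r = i by rewrite /r /=; lia.
apply: (has_gf_rsim (S := S) (@Whitney_gf true r (k + 1 - i) _ _ _ _ _)
  (has_gf_muln _ (tensor_powers_gf _ _))); rewrite ?ri //; try by lia.
(* The masks have [k - i] marks, one for each deletion from length [k] down to length [i]. *)
rewrite addn0 -bin_sub; last by lia.
have -> : ((k + 1 - i).-1 = k - i)%N by lia.
rewrite -size_masks.
rewrite (eq_big_seq (fun=> 'X ^+ (k - i) * (1 + 'X) ^+ i)) => [|b].
  by rewrite big_const_seq count_predT iter_addr_0.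
rewrite mem_masks free_headT => /andP[/eqP sb /eqP cb].
rewrite cb; congr (_ * _ ^+ _).
by have := count_predC id b; rewrite cb sb -[count (predC id) b]/(count negb b); lia.
Qed.

(** On generating polynomials this is the binomial expansion of [(1 + 'X) ^+ i]. *)
Lemma tensor_powers_binomial i : (i <= k)%N ->
  mx_rsim
    (muln_grepr (tensor (tensor_power S (k - i)) (tensor_power (dadd_grepr S T) i)) 'C(k, i))
    (\big[dadd_grepr/grepr0]_(j < i.+1)
       muln_grepr (tensor_power S (j + k - i)) ('C(k, i) * 'C(i, j))).
Proof.
move=> ik; apply: (has_gf_rsim (S := S) (has_gf_muln _ (tensor_powers_gf _ _))
  (has_gf_sum _ (fun j => has_gf_muln _ (has_gf_power _ _)))).
rewrite exprDn mulr_sumr -sumrMnl; apply: eq_bigr => j _.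
by rewrite expr1n mul1r mulrnAr -mulrnA -exprD mulnC -addnBA // [(j + _)%N]addnC.
Qed.

End Whitney.

Theorem theorem13 (R : realType) (A : finType) (n k : nat) :
  #|A| = n -> 2 <= n -> 1 <= k ->
  let C : fieldType := R[i] in
  let WH := subword_WH C A k in
  let WHd := subword_dual_WH C A k in
  let S := Specht C A [:: n.-1; 1] in
  let T := Specht C A [:: n] in
  [/\ forall i, 1 <= i <= k ->
        [/\ mx_rsim (WH i)
              (dadd_grepr (tensor_power S i) (tensor_power S (i - 1))),
            mx_rsim (WHd (k + 1 - i))
              (muln_grepr
                 (tensor (tensor_power S (k - i))
                         (tensor_power (dadd_grepr S T) i))
                 'C(k, i))
          & mx_rsim
              (muln_grepr
                 (tensor (tensor_power S (k - i))
                         (tensor_power (dadd_grepr S T) i))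
                 'C(k, i))
              (\big[dadd_grepr/grepr0]_(j < i.+1)
                 muln_grepr (tensor_power S (j + k - i))
                            ('C(k, i) * 'C(i, j)))],
      mx_rsim (WH 0) T
    & mx_rsim (WHd 0) T].
Proof.
case: n => [|[|m]] // cardA _ k1 C WH WHd S T.
have card0 : (m.+2%:R != 0 :> C)%R by rewrite Num.Theory.pnatr_eq0.
have tT : is_triv T by apply: Specht_triv.
split=> [i ik||].
- split; first exact: WH_rsim.
    exact: dual_WH_rsim.
  by apply: tensor_powers_binomial => //; case/andP: ik.
- apply: (@hom_sum0_triv _ _ _ _ _ _ _ _ (\bot%O : subword_poset A k)) => //.
  apply/setP => -[w|]; rewrite !inE //=.
  by rewrite size_eq0.
apply: (@hom_sum0_triv _ _ _ _ _ _ _ _ (\top%O : subword_poset A k)) => //.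
apply/setP => -[w|]; rewrite !inE //= subn0 ?eqxx //.
apply/negbTE; rewrite neq_ltn ltnS size_bseq //.
Qed.
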